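(* For every $2<p<\infty$ there are $\phi\in\mathrm{Hol}(\mathbb D)$ and $j_0\ge 0$ such that: (i) $T_\phi:H^p\to H^p$ is bounded but not compact; (ii) every sufficiently large hard dyadic block is active (i.e. $\Delta_j\phi\ne0$) and contains a consecutive frequency interval of length $2^{j-1}$ (i.e. $\operatorname{supp}\widehat\phi\cap[2^j,2^{j+1})$ contains $2^{j-1}$ consecutive integers); (iii) $\operatorname{supp}\widehat\phi$ is not an analytic $\Lambda(p)$-set; (iv) $2^{-j/p'}\|\Delta_j\phi\|_{H^p}=1$ for all $j\ge j_0$. In particular, $\phi$ does not satisfy $\bigl(2^{-j/p'}\|\Delta_j\phi\|_{H^p}\bigr)_j\in\ell^t$, and $\phi$ is neither (Hadamard) lacunary nor spectrally supported on an analytic $\Lambda(p)$-set.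
   Context: $\mathbb D$ is the open unit disc, $\mathrm{Hol}(\mathbb D)$ the holomorphic functions on it, $H^p$ the Hardy space; $1/p+1/p'=1$, $t=2p/(p-2)$. For $\phi\in\mathrm{Hol}(\mathbb D)$ with Taylor coefficients $\widehat\phi(n)$: $T_\phi f(z)=\int_0^1f(s)\phi(sz)\,ds$ and $\Delta_j\phi(z)=\sum_{2^j\le n<2^{j+1}}\widehat\phi(n)z^n$ (the $j$th hard dyadic block); $\operatorname{supp}\widehat\phi=\{n\ge0:\widehat\phi(n)\ne0\}$. A set $E\subset\mathbb N_0$ is an analytic $\Lambda(p)$-set if there is $C_E<\infty$ with $\|f\|_{H^p}\le C_E\|f\|_{H^2}$ for every analytic polynomial $f$ whose spectrum (set of frequencies with nonzero coefficient) is contained in $E$. A function is Hadamard lacunary if its support is an increasing sequence $(n_k)$ with $\inf_kn_{k+1}/n_k>1$. *)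

(* Defs.v *)
From HB Require Import structures.
From mathcomp Require Import all_boot all_order all_algebra.
From mathcomp Require Import complex.
From mathcomp Require Import all_classical all_reals all_analysis.

Set Implicit Arguments.
Unset Strict Implicit.
Unset Printing Implicit Defensive.

Import Order.TTheory GRing.Theory Num.Theory.
Import numFieldNormedType.Exports.

Local Open Scope classical_set_scope.
Local Open Scope ring_scope.
Local Open Scope complex_scope.

Section HardySpaces.
Context {R : realType}.
(* The regular module R[i]^o carries the topology of the complex plane and
   the complex (not the real) differential structure. *)
Local Notation C := (R[i]^o).
Local Notation mu := (@lebesgue_measure R).

Definition unit_disc : set C := [set z | `|z| < 1].

(* A function on the disc is represented by a function on the whole plane;
   no notion below depends on its values outside of the disc. *)
Definition holomorphic : set (C -> C) :=
  [set f | forall z, unit_disc z -> derivable f z 1].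

Definition taylor (f : C -> C) (n : nat) : C := derive1n n f 0 / n`!%:R.

Definition spectrum (f : C -> C) : set nat := [set n | taylor f n != 0].

Definition circle_point (r x : R) : C := (r * cos x) +i* (r * sin x).

Definition integral_mean (p : R) (f : C -> C) (r : R) : \bar R :=
  (((2 * pi)^-1)%:E *
   \int[mu]_(x in `[0%R, (2 * pi)%R]) ((Normc.normc (f (circle_point r x)) `^ p)%:E))
     `^ p^-1.

Definition hardy_norm (p : R) (f : C -> C) : \bar R :=
  ereal_sup [set integral_mean p f r | r in `]0, 1[].

Definition hardy (p : R) : set (C -> C) :=
  [set f | holomorphic f /\ (hardy_norm p f < +oo)%E].

Definition integral01 (h : R -> C) : C :=
  Rintegral mu `[0, 1[ (fun s => complex.Re (h s)) +i*
  Rintegral mu `[0, 1[ (fun s => complex.Im (h s)).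

Definition T_ (phi f : C -> C) (z : C) : C :=
  integral01 (fun s => f s%:C * phi (s%:C * z)).

Definition hardy_bounded (p : R) (T : (C -> C) -> C -> C) : Prop :=
  (forall f, hardy p f -> hardy p (T f)) /\
  exists K : R, forall f, hardy p f ->
    (hardy_norm p (T f) <= K%:E * hardy_norm p f)%E.

Definition hardy_compact (p : R) (T : (C -> C) -> C -> C) : Prop :=
  forall u : nat -> C -> C,
    (forall n, hardy p (u n)) ->
    (exists M : R, forall n, (hardy_norm p (u n) <= M%:E)%E) ->
    exists (k : nat -> nat) (g : C -> C),
      [/\ {homo k : m n / (m < n)%N},
          hardy p g &
          hardy_norm p (T (u (k n)) - g) @[n --> \oo] --> 0%E].

Definition dyadic_block (f : C -> C) (j : nat) : {poly R[i]} :=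
  \sum_(2 ^ j <= n < 2 ^ j.+1) taylor f n *: 'X^n.

Definition analytic_Lambda (p : R) (E : set nat) : Prop :=
  exists K : R, forall q : {poly R[i]},
    (forall n, q`_n != 0 -> E n) ->
    (hardy_norm p (horner q) <= K%:E * hardy_norm 2 (horner q))%E.

(* The ratio condition is written multiplicatively because n_0 = 0 is allowed. *)
Definition hadamard_lacunary (f : C -> C) : Prop :=
  exists k : nat -> nat,
    [/\ {homo k : m n / (m < n)%N},
        spectrum f = range k &
        exists q : R, 1 < q /\ forall i, q * (k i)%:R <= (k i.+1)%:R].

Definition has_interval (E : set nat) (a b l : nat) : Prop :=
  exists m : nat, [/\ (a <= m)%N, (m + l <= b)%N &
    forall n, (m <= n < m + l)%N -> E n].

End HardySpaces.

(* Main.v *)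
Require Import Defs.
From mathcomp Require Import all_boot all_order all_algebra.
From mathcomp Require Import complex.
From mathcomp Require Import all_classical all_reals all_analysis.
From mathcomp Require Import measurable_realfun.
From mathcomp Require Import ring lra.

Set Implicit Arguments.
Unset Strict Implicit.
Unset Printing Implicit Defensive.

Import Order.TTheory GRing.Theory Num.Theory.
Import numFieldNormedType.Exports.

Local Open Scope classical_set_scope.
Local Open Scope ring_scope.
Local Open Scope complex_scope.
Import Normc.

(** The symbol is [phi = sum_j a_j F_j], where, with [m = 2^(j-1)] ([m = 1] for
    [j = 0]) and [D(z) = 1 + z + ... + z^(m-1)], the polynomial [F_j(z) = z^(2^j) D(z)^2 / m] is
    a Fejer kernel moved into the [j]th dyadic interval of frequencies ([fejer]).
    Its coefficients are nonnegative and the first [m] of them are positive, so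
    the hard blocks of [phi] are the polynomials [a_j F_j] and the spectrum of
    [phi] contains long intervals.  As a function, [F_j] is a bump of height
    [2^j] on [|1 - z| < 2^-j] that decays like [2^-j / |1 - z|^2]; hence its
    [H^p] norm is comparable to [2^(j/p')] for every [p > 1]
    ([hardy_norm_cfejer_le], [hardy_norm_cfejer_ge]).  The numbers [a_j] that
    normalise the blocks therefore stay between two positive constants.

    Boundedness.  The bumps decay fast enough for [sum_j |F_j(z)|] to be at most
    a constant over [|1 - z|] ([sum_normc_cfejer]), so [|T_phi f(z)|] is at most
    a constant times the integral of [|f(s)| / |1 - s z|] over [0 < s < 1].  On a circle
    this kernel is comparable to the Hilbert kernel [1 / (X(s) + Y(t))], with [X(s) = 1 - s] and
    [Y(t) = |1 - e^(it)|], and is bounded on [L^p] by the Schur test with power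
    weights ([hilbert_ineq]).  What remains is that the restriction of [f] to the
    radius is in [L^p], the Fejer-Riesz inequality ([fejer_riesz]); it is
    the same Hilbert inequality with the two variables exchanged, applied to
    Cauchy's formula ([cauchy_bound]).  Cauchy's formula itself comes
    from Goursat's theorem for rectangles, read in logarithmic polar coordinates.

    Noncompactness.  Let [u_j] be the multiple of [F_j] of norm one.  Since all the
    coefficients are nonnegative, [|T_phi u_j| >= c 2^(j/p)] on [1 - 2^-(j+2) < s < 1],
    so that [|T_phi u_j|^p] has a fixed amount of mass on this shrinking interval
    ([T_block_lower]).  If a subsequence of [T_phi u_j] converged to [g] in [H^p],
    Fejer-Riesz would give convergence in [L^p] of the radius, and [|g|^p] would
    have that mass on arbitrarily short intervals ([not_compact_radial]).

    Spectrum.  The quotient of the norms of [F_j] in [H^p] and in [H^2] grows like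
    [2^(j(1/2 - 1/p))], which refutes the Lambda(p) property of every set that
    contains the spectra of all the [F_j] ([not_Lambda_of_cfejer]).  Two
    consecutive integers, arbitrarily far out, refute lacunarity. *)

(** * The complex plane through the real-valued modulus *)

Section complex_plane.
Context {R : realType}.
Local Notation C := (R[i]^o).
Implicit Types (z w : R[i]).

(** The order and the norm of [R[i]] take values in [R[i]] itself; all the estimates below
    are made with [normc], whose values are in [R]. *)
Lemma normcR z : `|z| = (normc z)%:C.
Proof. by case: z => a b; rewrite normc_def. Qed.

Lemma normc_ge0 z : 0 <= normc z.
Proof. by case: z => a b; exact: sqrtr_ge0. Qed.

Lemma normc_ofR (x : R) : normc x%:C = `|x|.
Proof. by rewrite /normc /= expr0n addr0 sqrtr_sqr. Qed.

Lemma normcX z n : normc (z ^+ n) = normc z ^+ n.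
Proof.
elim: n => [|n ih]; first by rewrite !expr0 normc1.
by rewrite !exprS normcM ih.
Qed.

Lemma normc_conj z : normc (z^*) = normc z.
Proof. by case: z => a b; rewrite /normc /= sqrrN. Qed.

Lemma normcB z w : normc (z - w) = normc (w - z).
Proof. by rewrite -normcN opprB. Qed.

Lemma Re_le_normc z : `|complex.Re z| <= normc z.
Proof. by have := normc_ge_Re z; rewrite normcR lecR. Qed.

Lemma Im_le_normc z : `|complex.Im z| <= normc z.
Proof.
case: z => a b /=; rewrite -[X in X <= _]sqrtr_sqr ler_wsqrtr//.
by rewrite lerDr sqr_ge0.
Qed.

Lemma normc_le_ReIm z : normc z <= `|complex.Re z| + `|complex.Im z|.
Proof.
rewrite {1}(complexE z); apply: (le_trans (le_normcD _ _)).
by rewrite normcM !normc_ofR {1}/normc /= expr0n expr1n add0r sqrtr1 mul1r.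
Qed.

Lemma normc_eq0 z : (normc z == 0) = (z == 0).
Proof. by apply/eqP/eqP => [/eq0_normc//|->]; exact: normc0. Qed.

Lemma normc_gt0 z : (0 < normc z) = (z != 0).
Proof. by rewrite lt_neqAle normc_ge0 andbT eq_sym normc_eq0. Qed.

Lemma ler_normcB z w : normc z - normc w <= normc (z - w).
Proof. by rewrite lerBlDr -{1}(subrK w z) le_normcD. Qed.

Lemma normc_sum I (r : seq I) (P : pred I) (F : I -> R[i]) :
  normc (\sum_(i <- r | P i) F i) <= \sum_(i <- r | P i) normc (F i).
Proof.
elim/big_ind2 : _ => [|x1 x2 y1 y2 h1 h2|//]; first by rewrite normc0.
by apply: (le_trans (le_normcD _ _)); exact: lerD.
Qed.

Lemma ReD z w : complex.Re (z + w) = complex.Re z + complex.Re w.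
Proof. by case: z w => [? ?] [? ?]. Qed.
Lemma ImD z w : complex.Im (z + w) = complex.Im z + complex.Im w.
Proof. by case: z w => [? ?] [? ?]. Qed.
Lemma ReB z w : complex.Re (z - w) = complex.Re z - complex.Re w.
Proof. by case: z w => [? ?] [? ?]. Qed.
Lemma ImB z w : complex.Im (z - w) = complex.Im z - complex.Im w.
Proof. by case: z w => [? ?] [? ?]. Qed.

Lemma unit_discE z : unit_disc (z : C) <-> normc z < 1.
Proof. by rewrite /unit_disc /= (_ : `|z : C| = (normc z)%:C) ?ltcR //; exact: normcR. Qed.

Lemma cvg_normcP (T : Type) (F : set_system T) {FF : Filter F} (g : T -> C) (l : C) :
  g @ F --> l <-> (fun t => normc ((g t : R[i]) - l)) @ F --> (0 : R).
Proof.
split=> h.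
- apply/cvgr0Pnorm_lt => e e0.
  have e0' : 0 < e%:C :> C by rewrite ltcR.
  move/cvgrPdist_lt : h => /(_ _ e0'); apply: filterS => t.
  by rewrite normcR ltcR normcB ger0_norm ?normc_ge0.
- apply/cvgrPdist_lt => e e0.
  have [k ke] : exists k, e = k%:C.
    by apply/complex_realP; exact: gtr0_real.
  move: e0; rewrite ke ltcR => k0.
  move/cvgr0Pnorm_lt : h => /(_ _ k0); apply: filterS => t.
  by rewrite normcR ltcR normcB ger0_norm ?normc_ge0.
Qed.

Lemma cvg_Re (T : Type) (F : set_system T) {FF : Filter F} (g : T -> C) (l : C) :
  g @ F --> l -> (fun t => complex.Re (g t)) @ F --> complex.Re l.
Proof.
move=> /cvg_normcP /cvgr0Pnorm_lt h; apply/cvgrPdist_lt => e /h.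
apply: filterS => t; rewrite ger0_norm ?normc_ge0// distrC -ReB.
exact/le_lt_trans/Re_le_normc.
Qed.

Lemma cvg_Im (T : Type) (F : set_system T) {FF : Filter F} (g : T -> C) (l : C) :
  g @ F --> l -> (fun t => complex.Im (g t)) @ F --> complex.Im l.
Proof.
move=> /cvg_normcP /cvgr0Pnorm_lt h; apply/cvgrPdist_lt => e /h.
apply: filterS => t; rewrite ger0_norm ?normc_ge0// distrC -ImB.
exact/le_lt_trans/Im_le_normc.
Qed.

Lemma cvg_complex (T : Type) (F : set_system T) {FF : Filter F} (u v : T -> R) (a b : R) :
  u @ F --> a -> v @ F --> b -> (fun t => u t +i* v t : C) @ F --> (a +i* b : C).
Proof.
move=> ua vb; apply/cvg_normcP.
apply: (@squeeze_cvgr _ _ _ _ (cst 0) (fun t => `|u t - a| + `|v t - b|)).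
- near=> t; rewrite normc_ge0 /=; exact: (normc_le_ReIm ((u t - a) +i* (v t - b))).
- exact: cvg_cst.
- rewrite -[X in _ --> X](addr0 0); apply: cvgD.
    by apply/norm_cvg0P; rewrite -(subrr a); apply: cvgB => //; exact: cvg_cst.
  by apply/norm_cvg0P; rewrite -(subrr b); apply: cvgB => //; exact: cvg_cst.
Unshelve. all: by end_near. Qed.

Lemma cvg_normc (T : Type) (F : set_system T) {FF : Filter F} (g : T -> C) (l : C) :
  g @ F --> l -> (fun t => normc (g t)) @ F --> normc l.
Proof.
move=> /cvg_normcP /cvgr0Pnorm_lt h; apply/cvgrPdist_lt => e /h.
apply: filterS => t; rewrite ger0_norm ?normc_ge0//; apply/le_lt_trans.
by rewrite ler_norml (normcB (g t)) ler_normcB andbT lerNl opprB normcB ler_normcB.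
Qed.

(** First-order expansions with a real modulus: this form of derivability composes with
    the expansions of functions of two real variables used for the Goursat theorem. *)
Lemma derivable_normc (f : C -> C) z : derivable f z 1 ->
  forall e, 0 < e -> exists2 d : R, 0 < d &
    forall h, normc h < d -> normc (f (z + h) - f z - derive1 f z * h) <= e * normc h.
Proof.
move=> df e e0.
have /cvgrPdist_lt/(_ e%:C) : (fun h : C => h^-1 *: ((f (h + z) : C) - f z)) @ 0^' --> derive1 f z.
  by rewrite derive1E; have := df; rewrite /derivable /derive; under eq_fun do rewrite /= scaler1.
rewrite ltcR => /(_ e0) [d' /= d'0 H].
have [d dE] : exists k, d' = k%:C by apply/complex_realP; exact: gtr0_real.
move: d'0 H; rewrite {}dE ltcR => d0 H; exists d => // h hd.
have [->|h0] := eqVneq h 0.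
  by rewrite addr0 mulr0 subrr subr0 normc0 mulr0.
have := H h; rewrite /ball /= sub0r normcR normcN ltcR => /(_ hd h0).
rewrite normcR ltcR => /ltW h1.
have -> : (f (z + h) : R[i]) - f z - derive1 f z * h =
   - (derive1 f z - h^-1 * (f (h + z) - f z)) * h.
  by rewrite (addrC h z); field.
by rewrite normcM normcN ler_wpM2r// normc_ge0.
Qed.

Lemma is_derive_normc (f : C -> C) z (l : C) :
  (forall e, 0 < e -> exists2 d : R, 0 < d &
    forall h, normc h < d -> normc ((f (z + h) : R[i]) - f z - l * h) <= e * normc h) ->
  derivable f z 1 /\ derive1 f z = l.
Proof.
move=> H.
have cv : (fun h : C => h^-1 *: ((f (h + z) : C) - f z)) @ 0^' --> l.
  apply/cvgrPdist_le => e e0.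
  have [k ke] : exists k, e = k%:C by apply/complex_realP; exact: gtr0_real.
  move: e0; rewrite {}ke ltcR => /H[d d0 {}H].
  exists d%:C; first by rewrite /= ltcR.
  move=> h; rewrite /ball /= sub0r normcR normcN ltcR => hd h0.
  rewrite normcR lecR.
  have hh0 : 0 < normc h by rewrite normc_gt0.
  rewrite -(ler_pM2r hh0) (le_trans _ (H _ hd))//.
  rewrite -normcM -[X in X <= _]normcN.
  rewrite le_eqVlt; apply/orP; left; apply/eqP; congr normc; rewrite (addrC z h) /GRing.scale /=.
  by field.
split; last by apply: cvg_lim => //; exact: norm_hausdorff.
rewrite /derivable; under eq_fun do rewrite /= scaler1.
by apply/cvg_ex; exists l.
Qed.

Lemma derivable_continuous (f : C -> C) z : derivable f z 1 -> {for z, continuous f}.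
Proof. by move=> /derivable1_diffP/differentiable_continuous. Qed.

Lemma continuous_normc (f : C -> C) (z : C) :
  (forall e, 0 < e -> exists2 d : R, 0 < d &
    forall w : R[i], normc (w - z) < d -> normc ((f w : R[i]) - f z) <= e) ->
  {for z, continuous f}.
Proof.
move=> H; apply/(@cvgrPdist_le _ C C (nbhs z) (nbhs_filter z)) => e e0.
have [k ke] : exists k, e = k%:C by apply/complex_realP; exact: gtr0_real.
move: e0; rewrite {}ke ltcR => /H[d d0 {}H].
exists d%:C; first by rewrite /= ltcR.
by move=> w; rewrite /ball /= !normcR ltcR lecR normcB => /H; rewrite normcB.
Qed.

Lemma continuous_mul_at (f g : C -> C) (z : C) : {for z, continuous f} ->
  {for z, continuous g} -> {for z, continuous (fun w : C => f w * g w : C)}.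
Proof. by move=> cf cg; exact: (@cvgM C C (nbhs z) (nbhs_filter z) f g _ _ cf cg). Qed.

End complex_plane.

(** * Integrals of continuous functions over segments *)

Section segment_integral.
Context {R : realType}.
Local Notation mu := (@lebesgue_measure R).
Implicit Types (f g : R -> R) (a b c d x y : R).

Definition seg_int f a b : R := \int[mu]_(x in `[a, b]) f x.

(** Continuity at every point of the segment, as a function on the whole line; this is
    stronger than continuity of the restriction, and needs no one-sided limits. *)
Definition cont_on f a b := forall x, a <= x <= b -> {for x, continuous f}.

Lemma cont_on_integrable f a b : cont_on f a b -> mu.-integrable `[a, b] (EFin \o f).
Proof.
move=> cf; apply: continuous_compact_integrable; first exact: segment_compact.
apply: continuous_in_subspaceT => x; rewrite inE /= in_itv /= => xab.
exact: cf.
Qed.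

Lemma seg_intD f a m b : cont_on f a b -> a <= m <= b ->
  seg_int f a b = seg_int f a m + seg_int f m b.
Proof.
move=> cf /andP[am mb]; rewrite /seg_int.
have := @Rintegral_itvB _ f (BLeft a) (BRight b) m (cont_on_integrable cf).
rewrite !bnd_simp => /(_ am mb) h.
rewrite -[X in _ = _ + X]Rintegral_itv_obnd_cbnd; first by rewrite -h; ring.
apply: integrableS (cont_on_integrable cf) => //.
by apply: subset_itv; rewrite !bnd_simp.
Qed.

Lemma seg_intB f g a b : cont_on f a b -> cont_on g a b ->
  seg_int (fun x => f x - g x) a b = seg_int f a b - seg_int g a b.
Proof. by move=> cf cg; apply: RintegralB => //; exact: cont_on_integrable. Qed.

Lemma seg_int_cst a b (M : R) : a <= b -> seg_int (fun=> M) a b = M * (b - a).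
Proof.
move=> ab; rewrite /seg_int Rintegral_cst//= lebesgue_measure_itv /= lte_fin.
case: ltrP => //= ba.
have -> : b = a by apply/eqP; rewrite eq_le ba ab.
by rewrite subrr.
Qed.

Lemma seg_int_le f a b (M : R) : a <= b -> cont_on f a b ->
  (forall x, a <= x <= b -> `|f x| <= M) -> `|seg_int f a b| <= M * (b - a).
Proof.
move=> ab cf fM; apply: (le_trans (le_normr_Rintegral _ (cont_on_integrable cf))) => //.
rewrite -seg_int_cst//; apply: le_Rintegral => //.
- apply: cont_on_integrable => x xab; apply: continuous_comp; [exact: cf|exact: norm_continuous].
- by apply: cont_on_integrable => x xab; exact: cvg_cst.
Qed.

Lemma seg_int_near f a b (c M : R) : a <= b -> cont_on f a b ->
  (forall x, a <= x <= b -> `|f x - c| <= M) -> `|seg_int f a b - c * (b - a)| <= M * (b - a).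
Proof.
move=> ab cf fM; have cc : cont_on (fun=> c) a b by move=> x _; exact: cvg_cst.
rewrite -(seg_int_cst c ab) -seg_intB//; apply: seg_int_le => //.
by move=> x xab; apply: cvgB; [exact: cf|exact: cc].
Qed.

Lemma cont_onB f g a b : cont_on f a b -> cont_on g a b -> cont_on (fun x => f x - g x) a b.
Proof. by move=> cf cg x xab; apply: cvgB; [exact: cf|exact: cg]. Qed.

End segment_integral.

(** * Goursat theorem for rectangles, in real form *)

Section goursat.
Context {R : realType}.
Implicit Types (P Q : R -> R -> R) (a b c d x y : R).

(** The left ends of nested segments whose lengths are halved at each step; the common
    point is the supremum of the left ends. *)
Lemma nested_dyadic (u : nat -> R) l : 0 <= l ->
  (forall n, u n <= u n.+1 <= u n + l / 2 ^+ n.+1) ->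
  exists x, forall n, u n <= x <= u n + l / 2 ^+ n.
Proof.
move=> l0 hu.
have half n : l / 2 ^+ n = l / 2 ^+ n.+1 + l / 2 ^+ n.+1.
  by rewrite exprS; field; rewrite expf_neq0.
have mono n k : u n <= u (n + k)%N.
  elim: k => [|k ih]; first by rewrite addn0.
  by rewrite addnS (le_trans ih)//; case/andP: (hu (n + k)%N).
have down n k : u (n + k)%N + l / 2 ^+ (n + k) <= u n + l / 2 ^+ n.
  elim: k => [|k ih]; first by rewrite addn0.
  rewrite addnS (le_trans _ ih)//; case/andP: (hu (n + k)%N) => _ h.
  by rewrite [X in _ <= _ + X]half addrA lerD2r.
have pos n : 0 <= l / 2 ^+ n by rewrite divr_ge0// exprn_ge0.
have cross n m : u n <= u m + l / 2 ^+ m.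
  have [nm|mn] := leqP n m.
    by rewrite -(subnKC nm) (le_trans (mono n (m - n)%N))// lerDl.
  by rewrite -(subnKC (ltnW mn)) (le_trans _ (down m (n - m)%N))// lerDl.
exists (sup (range u)) => n; apply/andP; split.
- apply: ub_le_sup; last by exists n.
  by exists (u 0%N + l / 2 ^+ 0) => _ [k _ <-]; exact: cross.
- apply: ge_sup; first by exists (u 0%N), 0%N.
  by move=> _ [k _ <-]; exact: cross.
Qed.

(** The integral of [P dx + Q dy] along the boundary of the rectangle. *)
Definition rect_int P Q a b c d : R :=
  seg_int (fun x => P x c - P x d) a b + seg_int (fun y => Q b y - Q a y) c d.

(** Differentiability of [P] and [Q] at a point with [dP/dy = dQ/dx]; continuity of
    the partial derivatives is not asked for, as in the Goursat theorem. *)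
Definition closed_form P Q x0 y0 := exists al be ga : R, forall e, 0 < e ->
  exists2 dl : R, 0 < dl & forall x y, `|x - x0| < dl -> `|y - y0| < dl ->
    `|P x y - P x0 y0 - al * (x - x0) - be * (y - y0)| <= e * (`|x - x0| + `|y - y0|) /\
    `|Q x y - Q x0 y0 - be * (x - x0) - ga * (y - y0)| <= e * (`|x - x0| + `|y - y0|).

Lemma continuous_slope (f : R -> R) x0 (M dl : R) : 0 < dl ->
  (forall x, `|x - x0| < dl -> `|f x - f x0| <= M * `|x - x0|) -> {for x0, continuous f}.
Proof.
move=> dl0 H; apply/cvgrPdist_le => e e0.
have M0 : 0 < `|M| + 1 by rewrite ltr_wpDl.
exists (Num.min dl (e / (`|M| + 1))); first by rewrite /= lt_min dl0 divr_gt0.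
move=> x; rewrite /ball /= lt_min distrC => /andP[xd xe].
rewrite distrC (le_trans (H _ xd))//.
rewrite (@le_trans _ _ ((`|M| + 1) * `|x - x0|))//.
  by rewrite ler_wpM2r// (le_trans (ler_norm M))// lerDl.
by rewrite mulrC -ler_pdivlMr// ltW.
Qed.

Lemma closed_form_cont P Q x0 y0 : closed_form P Q x0 y0 ->
  [/\ {for x0, continuous (fun x => P x y0)} & {for y0, continuous (fun y => Q x0 y)}].
Proof.
move=> [al [be [ga /(_ 1 ltr01)[dl dl0 H]]]]; split.
- apply: (@continuous_slope _ _ (1 + `|al|) dl) => // x xd.
  have [] := H x y0 xd; first by rewrite subrr normr0.
  rewrite subrr normr0 mulr0 subr0 addr0 mulrDl mul1r -normrM => h _.
  by rewrite -[X in `|X| <= _](subrK (al * (x - x0))) (le_trans (ler_normD _ _))// lerD2r.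
- apply: (@continuous_slope _ _ (1 + `|ga|) dl) => // x xd.
  have [] := H x0 x _ xd; first by rewrite subrr normr0.
  rewrite subrr normr0 !mulr0 subr0 add0r mulrDl !mul1r -normrM => _ h.
  rewrite subr0 in h.
  by rewrite -[X in `|X| <= _](subrK (ga * (x - y0))) (le_trans (ler_normD _ _))// lerD2r.
Qed.

Section rectangle.
Variables (P Q : R -> R -> R) (A B C D : R).
Hypothesis PQ : forall x y, A <= x <= B -> C <= y <= D -> closed_form P Q x y.

Let cP y a b : C <= y <= D -> A <= a -> b <= B -> cont_on (P ^~ y) a b.
Proof.
move=> yCD Aa bB x /andP[ax xb].
have xAB : A <= x <= B by rewrite (le_trans Aa)//= (le_trans xb).
by have [] := closed_form_cont (PQ xAB yCD).
Qed.

Let cQ x c d : A <= x <= B -> C <= c -> d <= D -> cont_on (Q x) c d.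
Proof.
move=> xAB Cc dD y /andP[cy yd].
have yCD : C <= y <= D by rewrite (le_trans Cc)//= (le_trans yd).
by have [] := closed_form_cont (PQ xAB yCD).
Qed.

Let split_x a m b c d : A <= a -> a <= m -> m <= b -> b <= B -> C <= c -> c <= d -> d <= D ->
  rect_int P Q a b c d = rect_int P Q a m c d + rect_int P Q m b c d.
Proof.
move=> Aa am mb bB Cc cd dD; rewrite /rect_int (@seg_intD _ _ a m b); last 2 first.
- by apply: cont_onB; apply: cP => //; rewrite ?Cc ?dD ?(le_trans cd) ?(le_trans Cc).
- by rewrite am.
rewrite !seg_intB; try (apply: cQ => //; lra); try (apply: cP => //; lra).
ring.
Qed.

Let split_y a b c m d : A <= a -> a <= b -> b <= B -> C <= c -> c <= m -> m <= d -> d <= D ->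
  rect_int P Q a b c d = rect_int P Q a b c m + rect_int P Q a b m d.
Proof.
move=> Aa ab bB Cc cm md dD; rewrite /rect_int [in LHS](@seg_intD _ _ c m d); last 2 first.
- by apply: cont_onB; apply: cQ => //; lra.
- by rewrite cm.
rewrite !seg_intB; try (apply: cQ => //; lra); try (apply: cP => //; lra).
ring.
Qed.

Let bisect x y l k : 0 <= l -> 0 <= k -> A <= x -> x + (l + l) <= B -> C <= y -> y + (k + k) <= D ->
  exists q : R * R, [/\ x <= q.1 <= x + l, y <= q.2 <= y + k &
    `|rect_int P Q x (x + (l + l)) y (y + (k + k))| <=
    4 * `|rect_int P Q q.1 (q.1 + l) q.2 (q.2 + k)| ].
Proof.
move=> l0 k0 Ax xB Cy yD.
rewrite !addrA in xB yD *.
set r1 := rect_int P Q x (x + l) y (y + k).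
set r2 := rect_int P Q x (x + l) (y + k) (y + k + k).
set r3 := rect_int P Q (x + l) (x + l + l) y (y + k).
set r4 := rect_int P Q (x + l) (x + l + l) (y + k) (y + k + k).
have E : rect_int P Q x (x + l + l) y (y + k + k) = r1 + r2 + (r3 + r4).
  rewrite (@split_x x (x + l)); try lra.
  rewrite (@split_y x _ y (y + k)); try lra.
  rewrite (@split_y (x + l) _ y (y + k)); try lra.
  by [].
have E1 : `|rect_int P Q x (x + l + l) y (y + k + k)| <= `|r1| + `|r2| + (`|r3| + `|r4|).
  by rewrite E (le_trans (ler_normD _ _))// lerD// ler_normD.
pose M := `|rect_int P Q x (x + l + l) y (y + k + k)|.
rewrite -/M in E1.
have [h1|h1] := leP M (4 * `|r1|).
  by exists (x, y); split => //=; lra.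
have [h2|h2] := leP M (4 * `|r2|).
  by exists (x, y + k); split => //=; lra.
have [h3|h3] := leP M (4 * `|r3|).
  by exists (x + l, y); split => //=; lra.
exists (x + l, y + k); split => //=; rewrite -/r4 -/M; lra.
Qed.

(** Goursat: bisect into four rectangles and keep the one with the largest boundary
    integral. At the limit point the form is, up to a small error, an affine closed form,
    whose boundary integrals vanish; the error is at most quadratic in the diameter, which
    balances the factor [4^n] of the bisections. *)
Lemma goursat_rectangle : A <= B -> C <= D -> rect_int P Q A B C D = 0.
Proof.
move=> AB CD.
pose l n := (B - A) / 2 ^+ n; pose k n := (D - C) / 2 ^+ n.
have half (z : R) n : z / 2 ^+ n = z / 2 ^+ n.+1 + z / 2 ^+ n.+1.
  by rewrite exprS; field; rewrite expf_neq0.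
have l0 n : 0 <= l n by rewrite divr_ge0 ?exprn_ge0// subr_ge0.
have k0 n : 0 <= k n by rewrite divr_ge0 ?exprn_ge0// subr_ge0.
(* The guarded statement holds for every pair, so that choice applies; the guard is
   an invariant of the sequence. *)
have step (np : nat * (R * R)) : exists q : R * R,
    [/\ A <= np.2.1, np.2.1 + l np.1 <= B, C <= np.2.2 & np.2.2 + k np.1 <= D] ->
    [/\ np.2.1 <= q.1 <= np.2.1 + l np.1.+1, np.2.2 <= q.2 <= np.2.2 + k np.1.+1 &
    `|rect_int P Q np.2.1 (np.2.1 + l np.1) np.2.2 (np.2.2 + k np.1)| <=
    4 * `|rect_int P Q q.1 (q.1 + l np.1.+1) q.2 (q.2 + k np.1.+1)| ].
  case: np => n [x y] /=.
  have [[h1 h2 h3 h4]|] := pselect [/\ A <= x, x + l n <= B, C <= y & y + k n <= D]; last first.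
    by move=> h; exists (x, y) => /h.
  have := @bisect x y (l n.+1) (k n.+1) (l0 _) (k0 _) h1 _ h3.
  rewrite -!half => /(_ h2 h4)[q hq]; exists q => _; exact: hq.
have [g gP] := choice step.
pose s := fix s n := if n is m.+1 then g (m, s m) else (A, C).
have inv n : [/\ A <= (s n).1, (s n).1 + l n <= B, C <= (s n).2 & (s n).2 + k n <= D].
  elim: n => [|n [h1 h2 h3 h4]]; first by rewrite /l /k expr0 !divr1 /=; split; lra.
  have [/= /andP[h5 h6] /andP[h7 h8] _] := gP (n, s n) (And4 h1 h2 h3 h4).
  have hl := half (B - A) n; have hk := half (D - C) n; rewrite -/(l n) -/(k n) in hl hk.
  rewrite -/(l n.+1) -/(k n.+1) in hl hk.
  by split => /=; lra.
pose Phi n := `|rect_int P Q (s n).1 ((s n).1 + l n) (s n).2 ((s n).2 + k n)|.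
have PhiS n : Phi n <= 4 * Phi n.+1 by have [_ _] := gP (n, s n) (inv n).
have Phi0 n : Phi 0%N <= 4 ^+ n * Phi n.
  elim: n => [|n ih]; first by rewrite expr0 mul1r.
  by rewrite (le_trans ih)// exprSr -mulrA ler_wpM2l// exprn_ge0.
have [x0 hx0] : exists x, forall n, (s n).1 <= x <= (s n).1 + l n.
  apply: nested_dyadic; first by rewrite subr_ge0.
  by move=> n; have [] := gP (n, s n) (inv n).
have [y0 hy0] : exists y, forall n, (s n).2 <= y <= (s n).2 + k n.
  apply: nested_dyadic; first by rewrite subr_ge0.
  by move=> n; have [] := gP (n, s n) (inv n).
have [al [be [ga H]]] : closed_form P Q x0 y0.
  apply: PQ.
    by have [_] := (hx0 0%N, inv 0%N); have [] := inv 0%N; have := hx0 0%N; lra.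
  by have [] := inv 0%N; have := hy0 0%N; lra.
pose S := (B - A) + (D - C).
have S0 : 0 <= S by rewrite addr_ge0 ?subr_ge0.
suff small e : 0 < e -> Phi 0%N <= 2 * e * S ^+ 2.
  have -> : rect_int P Q A B C D = rect_int P Q (s 0%N).1 ((s 0%N).1 + l 0%N) (s 0%N).2 ((s 0%N).2 + k 0%N).
    by rewrite /l /k expr0 !divr1 /= !subrKC.
  apply/eqP; rewrite -normr_le0; apply/ler_addgt0Pr => e e0; rewrite add0r.
  have S1 : 0 < 2 * (S ^+ 2 + 1) by rewrite mulr_gt0// ltr_wpDl// sqr_ge0.
  have := small (e / (2 * (S ^+ 2 + 1))); rewrite divr_gt0// => /(_ isT) h.
  apply: (le_trans h).
  have -> : 2 * (e / (2 * (S ^+ 2 + 1))) * S ^+ 2 = e * (S ^+ 2 / (S ^+ 2 + 1)).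
    by field; rewrite gt_eqF// ltr_wpDl// sqr_ge0.
  by rewrite ger_pMr// ler_pdivrMr ?mul1r ?lerDl// ltr_wpDl// sqr_ge0.
move=> e0; have {H}[dl dl0 H] := H _ e0.
(* n such that the n-th rectangle lies where the first-order expansion holds *)
have [n hn] : exists n, S / 2 ^+ n < dl.
  have h : 0 <= S / dl by rewrite divr_ge0// ltW.
  exists (Num.Def.truncn (S / dl)).+1.
  rewrite ltr_pdivrMr ?exprn_gt0// mulrC -ltr_pdivrMr//.
  apply: (lt_le_trans (truncnS_gt (S / dl))).
  rewrite -natrX ler_nat; apply: ltnW; exact: ltn_expl.
apply: (le_trans (Phi0 n)).
have [h1 h2 h3 h4] := inv n; have /andP[hx1 hx2] := hx0 n; have /andP[hy1 hy2] := hy0 n.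
have lkS : l n + k n = S / 2 ^+ n by rewrite /l /k -mulrDl.
have := l0 n; have := k0 n => kn0 ln0.
pose r := l n + k n.
have r0 : 0 <= r by rewrite addr_ge0.
have near x y : (s n).1 <= x <= (s n).1 + l n -> (s n).2 <= y <= (s n).2 + k n ->
    `|P x y - P x0 y0 - al * (x - x0) - be * (y - y0)| <= e * r /\
    `|Q x y - Q x0 y0 - be * (x - x0) - ga * (y - y0)| <= e * r.
  move=> hx hy.
  have hxl : `|x - x0| <= l n by rewrite ler_norml; lra.
  have hyk : `|y - y0| <= k n by rewrite ler_norml; lra.
  have [] := H x y; try (apply: le_lt_trans hn; rewrite -lkS; lra).
  move=> p1 p2; split.
    by apply: (le_trans p1); rewrite ler_wpM2l ?(ltW e0)// lerD.
  by apply: (le_trans p2); rewrite ler_wpM2l ?(ltW e0)// lerD.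
rewrite /Phi /rect_int.
set I := seg_int _ _ _; set J := seg_int (fun y => _) _ _.
have b1 : `|I - (- be * k n) * (((s n).1 + l n) - (s n).1)| <= 2 * e * r * (((s n).1 + l n) - (s n).1).
  apply: seg_int_near; first lra.
    by apply: cont_onB; apply: cP => //; lra.
  move=> x hx.
  have [p1 _] := near x (s n).2 hx ltac:(lra).
  have [p2 _] := near x ((s n).2 + k n) hx ltac:(lra).
  move: p1 p2; rewrite !ler_norml => /andP[p1 p2] /andP[p3 p4]; apply/andP; split; lra.
have b2 : `|J - (be * l n) * (((s n).2 + k n) - (s n).2)| <= 2 * e * r * (((s n).2 + k n) - (s n).2).
  apply: seg_int_near; first lra.
    by apply: cont_onB; apply: cQ => //; lra.
  move=> y hy.
  have [_ p1] := near (s n).1 y ltac:(lra) hy.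
  have [_ p2] := near ((s n).1 + l n) y ltac:(lra) hy.
  move: p1 p2; rewrite !ler_norml => /andP[p1 p2] /andP[p3 p4]; apply/andP; split; lra.
rewrite !(addrC _ (l n)) !(addrC _ (k n)) !addrK in b1 b2.
have b3 : `|I + J| <= 2 * e * r ^+ 2.
  have -> : I + J = (I - - be * k n * l n) + (J - be * l n * k n) by ring.
  apply: (le_trans (ler_normD _ _)); apply: (le_trans (lerD b1 b2)).
  by rewrite -mulrDr -/r expr2 !mulrA.
apply: (@le_trans _ _ (4 ^+ n * (2 * e * r ^+ 2))).
  by rewrite ler_wpM2l// exprn_ge0.
have -> : 4 ^+ n = (2 : R) ^+ n * 2 ^+ n by rewrite -exprMn; congr (_ ^+ n); ring.
rewrite /r lkS le_eqVlt; apply/orP; left; apply/eqP; field.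
by rewrite expf_neq0.
Qed.

End rectangle.

End goursat.

(** * Mean values over circles and the Cauchy formula *)

Section polar.
Context {R : realType}.
Local Notation C := (R[i]^o).
Local Notation mu := (@lebesgue_measure R).

Lemma derivable_slope (f : R -> R) (x0 l : R) : is_derive x0 (1 : R) f l ->
  forall e, 0 < e -> exists2 d : R, 0 < d &
    forall h, `|h| < d -> `|f (x0 + h) - f x0 - l * h| <= e * `|h|.
Proof.
move=> [df dl] e e0.
have /cvgrPdist_lt/(_ e e0)[d /= d0 H] :
    (fun h : R => h^-1 *: (f (h + x0) - f x0)) @ 0^' --> l.
  by rewrite -dl; have := df; rewrite /derivable /derive; under eq_fun do rewrite /= scaler1.
exists d => // h hd.
have [->|h0] := eqVneq h 0.
  by rewrite addr0 mulr0 subrr subr0 normr0 mulr0.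
have := H h; rewrite /ball /= sub0r normrN => /(_ hd h0) /ltW h1.
have -> : f (x0 + h) - f x0 - l * h = - (l - h^-1 * (f (h + x0) - f x0)) * h.
  by rewrite (addrC h x0); field.
by rewrite normrM normrN ler_wpM2r.
Qed.

Lemma exp_polar_slope e : 0 < e -> exists2 d : R, 0 < d & forall x y : R, `|x| < d -> `|y| < d ->
  normc (circle_point (expR x) y - 1 - (x +i* y)) <= e * (`|x| + `|y|).
Proof.
move=> e0; pose e1 := Num.min 1 (e / 10).
have e10 : 0 < e1 by rewrite lt_min ltr01 divr_gt0.
have [e11 e1e] : e1 <= 1 /\ 10 * e1 <= e.
  split; first by rewrite ge_min lexx.
  by rewrite mulrC -ler_pdivlMr// ge_min lexx orbT.
clearbody e1.
have [d1 d10 H1] := derivable_slope (is_derive_expR (0 : R)) e10.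
have [d2 d20 H2] := derivable_slope (is_derive_sin (0 : R)) e10.
have [d3 d30 H3] := derivable_slope (is_derive_cos (0 : R)) e10.
exists (Num.min e1 (Num.min d1 (Num.min d2 d3))); first by rewrite lt_min e10 lt_min d10 lt_min d20.
move=> x y; rewrite !lt_min => /and4P[xe xd1 _ _] /and4P[_ _ yd2 yd3].
have := H1 _ xd1; have := H2 _ yd2; have := H3 _ yd3.
rewrite !add0r expR0 cos0 sin0 oppr0 mul0r !subr0 !mul1r => {H1 H2 H3} hc hs hx.
apply: (le_trans (normc_le_ReIm _)) => /=; rewrite subr0.
set X := expR x in hx *; set c := cos y in hc *; set s := sin y in hs *.
have ax := normr_ge0 x; have ay := normr_ge0 y.
have X1 : `|X - 1| <= 2 * `|x|.
  rewrite -[X - 1](subrK x) (le_trans (ler_normD _ _))// mulr_natl mulr2n lerD2r.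
  by rewrite (le_trans hx)// ler_piMl.
have X3 : `|X| <= 3.
  rewrite -[X](subrK 1) (le_trans (ler_normD _ _))// normr1.
  have : `|x| < 1 by exact: lt_le_trans e11.
  lra.
have -> : X * c - 1 - x = (X - 1 - x) + X * (c - 1) by ring.
rewrite addr0 in hs.
have -> : X * s - y = X * (s - y) + (X - 1) * y by ring.
have h1 : `|X - 1 - x + X * (c - 1)| <= e1 * `|x| + 3 * (e1 * `|y|).
  by rewrite (le_trans (ler_normD _ _))// lerD// normrM ler_pM.
have h2 : `|X * (s - y) + (X - 1) * y| <= 3 * (e1 * `|y|) + 2 * e1 * `|y|.
  rewrite (le_trans (ler_normD _ _))// lerD// normrM ler_pM//.
  by rewrite (le_trans X1)// ler_wpM2l// ltW.
apply: (le_trans (lerD h1 h2)).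
have : 10 * e1 * (`|x| + `|y|) <= e * (`|x| + `|y|) by rewrite ler_wpM2r// addr_ge0.
have : 0 <= e1 * `|x| by rewrite mulr_ge0// ltW.
have : 0 <= e1 * `|y| by rewrite mulr_ge0// ltW.
lra.
Qed.

Lemma normc_circle_point (r t : R) : normc (circle_point r t) = `|r|.
Proof.
rewrite /circle_point /normc !exprMn -mulrDr cos2Dsin2 mulr1.
exact: sqrtr_sqr.
Qed.

Lemma circle_pointM (r r' t : R) : r%:C * circle_point r' t = circle_point (r * r') t.
Proof. by rewrite /circle_point; simpc; rewrite !mulrA. Qed.

Lemma circle_pointD (r r' t t' : R) :
  circle_point r t * circle_point r' t' = circle_point (r * r') (t + t').
Proof. by rewrite /circle_point cosD sinD; simpc; congr (_ +i* _); ring. Qed.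

Lemma circle_point_continuous2 (r t : R) :
  (fun q : R * R => circle_point q.1 q.2 : C) @ (r, t) --> (circle_point r t : C).
Proof.
apply: cvg_complex; apply: cvgM.
- exact: cvg_fst.
- by apply: cvg_comp; [exact: cvg_snd|exact: continuous_cos].
- exact: cvg_fst.
- by apply: cvg_comp; [exact: cvg_snd|exact: continuous_sin].
Qed.

Lemma circle_point_continuous (r t : R) :
  (fun t : R => circle_point r t : C) @ t --> (circle_point r t : C).
Proof.
apply: cvg_complex; apply: cvgM; try exact: cvg_cst.
- exact: continuous_cos.
- exact: continuous_sin.
Qed.

Lemma circle_point_continuousl (r t : R) :
  (fun r : R => circle_point r t : C) @ r --> (circle_point r t : C).
Proof. by apply: cvg_complex; apply: cvgM; try exact: cvg_cst; exact: cvg_id. Qed.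

(** The chain rule for [x + i y |-> h (exp (x + i y))], whose derivative is [h'(w) w]. *)
Lemma polar_slope (h : C -> C) (x0 y0 : R) : derivable h (circle_point (expR x0) y0) 1 ->
  exists L : R[i], forall e, 0 < e -> exists2 d : R, 0 < d & forall x y : R,
    `|x - x0| < d -> `|y - y0| < d ->
    normc ((h (circle_point (expR x) y) : R[i]) - h (circle_point (expR x0) y0)
      - L * ((x - x0) +i* (y - y0))) <= e * (`|x - x0| + `|y - y0|).
Proof.
set w0 := circle_point _ _ => dh; exists (derive1 h w0 * w0) => e e0.
pose M := normc w0 + normc (derive1 h w0 * w0) + 1.
have n1 := normc_ge0 w0; have n2 := normc_ge0 (derive1 h w0 * w0).
have M0 : 0 < M by rewrite ltr_wpDl// addr_ge0.
pose e1 := Num.min 1 (e / (3 * M)).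
have e10 : 0 < e1 by rewrite lt_min ltr01 divr_gt0// mulr_gt0.
have [e11 e1e] : e1 <= 1 /\ 3 * M * e1 <= e.
  split; first by rewrite ge_min lexx.
  by rewrite mulrC -ler_pdivlMr ?mulr_gt0// ge_min lexx orbT.
have [d1 d10 H1] := derivable_normc dh e10.
have [d2 d20 H2] := exp_polar_slope e10.
exists (Num.min d2 (d1 / (6 * M))); first by rewrite lt_min d20 divr_gt0// mulr_gt0.
move=> x y; rewrite !lt_min => /andP[xd2 xd1] /andP[yd2 yd1].
have := H2 _ _ xd2 yd2; set E := circle_point _ _ => hE.
have Ew : circle_point (expR x) y = w0 + w0 * (E - 1).
  rewrite mulrBr mulr1 subrKC circle_pointD -expRD.
  by congr (circle_point (expR _) _); ring.
set D := `|x - x0| + `|y - y0| in hE *.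
have D0 : 0 <= D by rewrite addr_ge0.
have nE : normc (E - 1) <= 3 * D.
  rewrite -[E - 1](subrK ((x - x0) +i* (y - y0))); apply: (le_trans (le_normcD _ _)).
  have h' : normc ((x - x0) +i* (y - y0)) <= D := normc_le_ReIm ((x - x0) +i* (y - y0)).
  have h2 : e1 * D <= 1 * D by rewrite ler_wpM2r.
  apply: (le_trans (lerD hE h')); lra.
have nk : normc (w0 * (E - 1)) <= 3 * normc w0 * D.
  by rewrite normcM -mulrA mulrCA ler_wpM2l.
have := H1 (w0 * (E - 1)); rewrite -Ew => {}H1.
have {}H1 : normc ((h (circle_point (expR x) y) : R[i]) - h w0 - derive1 h w0 * (w0 * (E - 1)))
     <= e1 * (3 * normc w0 * D).
  apply: (@le_trans _ _ (e1 * normc (w0 * (E - 1)))); last by rewrite ler_wpM2l// ltW.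
  apply: H1; apply: (le_lt_trans nk).
  apply: (@le_lt_trans _ _ (3 * M * D)).
    by rewrite ler_wpM2r// ler_wpM2l// /M; lra.
  rewrite !ltr_pdivlMr ?mulr_gt0// in xd1 yd1.
  rewrite /D; lra.
set z := (x - x0) +i* (y - y0) in hE nE *.
have -> : (h (circle_point (expR x) y) : R[i]) - h w0 - derive1 h w0 * w0 * z =
  ((h (circle_point (expR x) y) : R[i]) - h w0 - derive1 h w0 * (w0 * (E - 1))) +
   derive1 h w0 * w0 * (E - 1 - z) by ring.
apply: (le_trans (le_normcD _ _)); rewrite [X in _ + X]normcM.
apply: (@le_trans _ _ (e1 * (3 * normc w0 * D) + normc (derive1 h w0 * w0) * (e1 * D))).
  by rewrite lerD// ler_wpM2l.
apply: (@le_trans _ _ (3 * M * e1 * D)); last by rewrite ler_wpM2r.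
rewrite -subr_ge0.
have -> : 3 * M * e1 * D - (e1 * (3 * normc w0 * D) + normc (derive1 h w0 * w0) * (e1 * D)) =
  e1 * D * (2 * normc (derive1 h w0 * w0) + 3) by rewrite /M; ring.
by rewrite mulr_ge0 ?mulr_ge0 ?(ltW e10)//; lra.
Qed.

(** In logarithmic polar coordinates [h] is again holomorphic, so the Cauchy-Riemann
    equations make [Im h dx + Re h dy] closed. *)
Lemma polar_closed_form (h : C -> C) (x0 y0 : R) : derivable h (circle_point (expR x0) y0) 1 ->
  closed_form (fun x y => complex.Im (h (circle_point (expR x) y)))
    (fun x y => complex.Re (h (circle_point (expR x) y))) x0 y0.
Proof.
move=> /polar_slope[L HL]; exists (complex.Im L), (complex.Re L), (- complex.Im L) => e e0.
have [d d0 H] := HL e e0; exists d => // x y xd yd.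
have {}H := H x y xd yd; split.
- apply: le_trans H; apply: le_trans (Im_le_normc _).
  rewrite !ImB; case: L {HL} => a b /=; rewrite le_eqVlt; apply/orP; left; apply/eqP.
  by congr `|_|; ring.
- apply: le_trans H; apply: le_trans (Re_le_normc _).
  rewrite !ReB; case: L {HL} => a b /=; rewrite le_eqVlt; apply/orP; left; apply/eqP.
  by congr `|_|; ring.
Qed.

Definition circle_int (h : C -> C) (r : R) : R :=
  seg_int (fun t => complex.Re (h (circle_point r t))) 0 (2 * pi).

(** Goursat on the rectangle [[ln r1, ln r2] x [0, 2 pi]]: the two horizontal sides
    cancel by periodicity, and the vertical sides are the two circles. *)
Lemma circle_int_const (h : C -> C) (r1 r2 : R) : 0 < r1 -> r1 <= r2 ->
  (forall z : R[i], r1 <= normc z <= r2 -> derivable h z 1) ->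
  circle_int h r1 = circle_int h r2.
Proof.
move=> r10 r12 dh; have r20 : 0 < r2 by exact: lt_le_trans r12.
have pi0 : 0 <= 2 * pi :> R by rewrite mulr_ge0 ?pi_ge0.
have := @goursat_rectangle R _ _ (ln r1) (ln r2) 0 (2 * pi) _ _ pi0.
move=> /(_ (fun x y => complex.Im (h (circle_point (expR x) y)))
  (fun x y => complex.Re (h (circle_point (expR x) y)))).
rewrite /rect_int.
have E x : complex.Im (h (circle_point (expR x) 0)) - complex.Im (h (circle_point (expR x) (2 * pi))) = 0.
  have -> : circle_point (expR x) (2 * pi) = circle_point (expR x) 0.
    by rewrite /circle_point mulr_natl cos2pi sin2pi cos0 sin0.
  by rewrite subrr.
under [X in seg_int X (ln r1) _]eq_fun do rewrite E.
rewrite seg_int_cst ?ler_ln ?posrE// mul0r add0r !lnK ?posrE//.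
have dh' x y : ln r1 <= x <= ln r2 -> derivable h (circle_point (expR x) y) 1.
  move=> /andP[h1 h2]; apply: dh; rewrite normc_circle_point gtr0_norm ?expR_gt0//.
  have -> : r1 = expR (ln r1) by rewrite lnK// posrE.
  by have -> : r2 = expR (ln r2); [rewrite lnK// posrE|rewrite !ler_expR h1].
have cc r : r1 <= r <= r2 -> cont_on (fun t => complex.Re (h (circle_point r t))) 0 (2 * pi).
  move=> rr y _; apply: (@cvg_Re R _ _ _ (fun t => h (circle_point r t))).
  apply: cvg_comp; first exact: circle_point_continuous.
  apply: derivable_continuous; apply: dh.
  by rewrite normc_circle_point ger0_norm//; lra.
rewrite seg_intB; last 2 first.
- by apply: cc; rewrite lexx r12.
- by apply: cc; rewrite lexx r12.
move=> H; apply/esym/eqP; rewrite -subr_eq0 -/(circle_int h r1) -/(circle_int h r2).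
apply/eqP; apply: H => // x y xx yy; apply: polar_closed_form; exact: dh'.
Qed.

Lemma eq_at_right_limit (F : R -> R) (x0 b c : R) : x0 < b -> {for x0, continuous F} ->
  (forall x, x0 < x < b -> F x = c) -> F x0 = c.
Proof.
move=> x0b cF Fc.
have h1 : F @ x0^'+ --> F x0 by apply: cvg_at_right_filter.
have h2 : F @ x0^'+ --> c.
  apply: (@cvg_trans _ (cst c @ x0^'+)); last exact: cvg_cst.
  apply: near_eq_cvg; near=> x; rewrite Fc//; apply/andP; split; near: x.
  - exact: nbhs_right_gt.
  - exact: nbhs_right_lt.
exact: (cvg_unique _ h1 h2).
Unshelve. all: by end_near. Qed.

Lemma eq_at_left_limit (F : R -> R) (x0 b c : R) : b < x0 -> {for x0, continuous F} ->
  (forall x, b < x < x0 -> F x = c) -> F x0 = c.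
Proof.
move=> x0b cF Fc.
have h1 : F @ x0^'- --> F x0 by apply: cvg_at_left_filter.
have h2 : F @ x0^'- --> c.
  apply: (@cvg_trans _ (cst c @ x0^'-)); last exact: cvg_cst.
  apply: near_eq_cvg; near=> x; rewrite Fc//; apply/andP; split; near: x.
  - exact: nbhs_left_gt.
  - exact: nbhs_left_lt.
exact: (cvg_unique _ h1 h2).
Unshelve. all: by end_near. Qed.

(** The uniform bound that allows continuity to pass under the integral over circles. *)
Lemma bounded_on_disc (h : C -> C) (r0 : R) : 0 <= r0 ->
  (forall z : R[i], normc z <= r0 -> {for (z : C), continuous h}) ->
  exists M : R, forall r t, `|r| <= r0 -> 0 <= t <= 2 * pi -> normc (h (circle_point r t)) <= M.
Proof.
move=> r00 ch.
pose g (q : R * R) : R := normc (h (circle_point q.1 q.2)).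
pose K : set (R * R) := `[- r0, r0] `*` `[0, 2 * pi].
have cK : compact K by apply: compact_setX; exact: segment_compact.
have cg : {within K, continuous g}.
  apply: continuous_in_subspaceT => -[r t]; rewrite inE => -[/= + _].
  rewrite in_itv /= -ler_norml => hr.
  apply: (@cvg_normc R _ _ _ (fun q : R * R => h (circle_point q.1 q.2))).
  apply: cvg_comp; first exact: circle_point_continuous2.
  by apply: ch; rewrite normc_circle_point.
have := compact_bounded (continuous_compact cg cK) => -[M [_ HM]].
exists (M + 1) => r t hr ht.
have := HM (M + 1); rewrite ltrDl => /(_ ltr01 (g (r, t))).
rewrite /= ger0_norm ?normc_ge0//; apply.
by exists (r, t) => //; split; rewrite /= in_itv /= -?ler_norml.
Qed.

Lemma circle_int_continuous (h : C -> C) (r : R) : `|r| < 1 ->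
  (forall z : R[i], normc z < 1 -> {for (z : C), continuous h}) ->
  {for r, continuous (circle_int h)}.
Proof.
move=> r1 ch.
pose r0 := (`|r| + 1) / 2.
have n0 := normr_ge0 r.
have [r00 r01 rr0] : [/\ 0 <= r0, r0 < 1 & `|r| < r0] by rewrite /r0; split; lra.
have ch0 (z : R[i]) : normc z <= r0 -> {for (z : C), continuous h}.
  by move=> zr; apply: ch; exact: le_lt_trans r01.
have [M HM] := bounded_on_disc r00 ch0.
have cc x y : - r0 < x < r0 -> {for y, continuous (fun t => complex.Re (h (circle_point x t)))}.
  move=> xr; apply: (@cvg_Re R _ _ _ (fun t => h (circle_point x t))).
  apply: cvg_comp; first exact: circle_point_continuous.
  by apply: ch0; rewrite normc_circle_point ler_norml; lra.
have mM : mu.-integrable `[0, 2 * pi] (EFin \o (fun=> M)).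
  by apply: cont_on_integrable => x _; exact: cvg_cst.
have := @continuity_under_integral R _ _ mu (fun x t => complex.Re (h (circle_point x t)))
  `[0, 2 * pi] _ (- r0) r0 _ _ (fun=> M) mM.
apply => //; last by rewrite inE /= in_itv /= -ltr_norml.
- move=> x; rewrite /= in_itv /= => xr; apply: cont_on_integrable => y _; exact: cc.
- apply: aeW => y yB x; rewrite inE /= in_itv /= => xr.
  apply: (@cvg_Re R _ _ _ (fun r => h (circle_point r y))).
  apply: cvg_comp; first exact: circle_point_continuousl.
  by apply: ch0; rewrite normc_circle_point ler_norml; lra.
- move=> x; rewrite /= in_itv /= => xr; apply: aeW => y; rewrite /= in_itv /= => yB.
  by apply: (le_trans (Re_le_normc _)); apply: HM => //; rewrite ler_norml; lra.
Qed.

(** One circle of exceptional points is allowed, where [h] is only continuous: the mean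
    is constant on either side of it, and continuous in the radius. This is what dispenses with
    a removable singularity theorem in the proof of the Cauchy formula. *)
Lemma mean_value (h : C -> C) (a r : R) : 0 <= a -> 0 <= r < 1 ->
  (forall z : R[i], normc z < 1 -> {for (z : C), continuous h}) ->
  (forall z : R[i], normc z < 1 -> normc z != a -> derivable h z 1) ->
  circle_int h r = 2 * pi * complex.Re (h 0).
Proof.
move=> a0 /andP[r0 r1] ch dh.
have -> : 2 * pi * complex.Re (h 0) = circle_int h 0.
  rewrite /circle_int.
  have -> : (fun t => complex.Re (h (circle_point 0 t))) = fun=> complex.Re (h 0).
    by apply/funext => t; rewrite /circle_point !mul0r.
  by rewrite seg_int_cst ?mulr_ge0 ?pi_ge0// subr0 mulrC.
have cc x : 0 <= x < 1 -> {for x, continuous (circle_int h)}.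
  by move=> /andP[x0 x1]; apply: circle_int_continuous; rewrite ?ger0_norm.
have constE x y : 0 < x -> x <= y -> y < 1 -> (y < a \/ a < x) ->
    circle_int h x = circle_int h y.
  move=> x0 xy y1 har; apply: circle_int_const => // z /andP[z1 z2].
  apply: dh; first exact: le_lt_trans y1.
  by case: har => [ra|ra]; apply/eqP; lra.
have inner x : 0 <= x -> x < a -> x < 1 -> circle_int h x = circle_int h 0.
  rewrite le_eqVlt => /orP[/eqP<-//|x0] xa x1.
  apply/esym/(@eq_at_right_limit _ 0 x) => //; first by apply: cc; rewrite lexx ltr01.
  by move=> y /andP[y0 yx]; apply: constE => //; [exact: ltW|left].
have mid : a < 1 -> circle_int h a = circle_int h 0.
  move=> a1; move: a0; rewrite le_eqVlt => /orP[/eqP<-//|a0'].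
  apply: (@eq_at_left_limit _ a 0) => //; first by apply: cc; rewrite ltW.
  by move=> x /andP[x0 xa]; apply: inner => //; [exact: ltW|exact: lt_trans a1].
have [ra|ar|ra] := ltgtP r a; [exact: inner| |by rewrite ra mid// -ra].
have a1 : a < 1 by exact: lt_trans r1.
rewrite -mid//; apply/esym/(@eq_at_right_limit _ a r) => //; first by apply: cc; rewrite a0.
move=> y /andP[y0 yx]; apply: constE => //; [exact: le_lt_trans y0|exact: ltW|by right].
Qed.

Definition chord (t : R) : R := normc (1 - circle_point 1 t).

Lemma chord_ge0 t : 0 <= chord t. Proof. exact: normc_ge0. Qed.

Lemma chord_continuous : continuous chord.
Proof.
move=> t; apply: (@cvg_normc R _ _ _ (fun t => (1 : C) - (circle_point 1 t : C))).
exact: (cvgB (cvg_cst (1 : C)) (@circle_point_continuous 1 t)).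
Qed.

(** The Cauchy kernel is dominated by a Hilbert kernel [1 / (X + Y)] whose two terms
    depend on the radius and on the angle separately. *)
Lemma cauchy_kernel_lower (s t : R) : 0 <= s <= 1 ->
  1 - s + chord t <= 3 * normc (1 - circle_point s t : R[i]).
Proof.
move=> /andP[s0 s1].
have h1 : 1 - s <= normc (1 - circle_point s t : R[i]).
  by rewrite (le_trans _ (ler_normcB _ _))// normc1 normc_circle_point ger0_norm.
have h2 : chord t <= normc (1 - circle_point s t : R[i]) + (1 - s).
  rewrite /chord.
  have -> : 1 - circle_point 1 t = (1 - circle_point s t : R[i]) + circle_point (s - 1) t.
    by rewrite /circle_point; simpc; congr (_ +i* _); ring.
  by rewrite (le_trans (le_normcD _ _))// normc_circle_point distrC ger0_norm// subr_ge0.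
lra.
Qed.

Lemma circle_point_conj (r t : R) : (circle_point r t)^* = circle_point r (- t).
Proof. by rewrite /circle_point cosN sinN mulrN. Qed.

Lemma circle_pointN_inv (s t : R) :
  complex.Re ((1 - circle_point s (- t) : R[i])^-1) = complex.Re ((1 - circle_point s t : R[i])^-1).
Proof.
rewrite -circle_point_conj -(conjc1 R) -rmorphB -conjc_inv.
by rewrite conjc1; case: (1 - circle_point s t : R[i])^-1.
Qed.

Lemma cont_on_circle (h : C -> C) (r : R) :
  (forall t, {for (circle_point r t : C), continuous h}) ->
  forall a b, cont_on (fun t => complex.Re (h (circle_point r t))) a b.
Proof.
move=> ch a b t _; apply: (@cvg_Re R _ _ _ (fun t => h (circle_point r t))).
by apply: cvg_comp; [exact: circle_point_continuous|exact: ch].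
Qed.

(** The mean value property of [1 / (1 - q z)] on the circle of radius [q], with [q^2 = s]:
    this circle stays inside the disc. *)
Lemma circle_int_cauchy (s : R) : 0 <= s < 1 ->
  seg_int (fun t => complex.Re ((1 - circle_point s t : R[i])^-1)) 0 (2 * pi) = 2 * pi.
Proof.
move=> /andP[s0 s1]; pose q := Num.sqrt s.
have q0 : 0 <= q by exact: sqrtr_ge0.
have q1 : q < 1 by rewrite -sqrtr1 ltr_sqrt.
have den (z : R[i]) : normc z < 1 -> 1 - q%:C * z != 0.
  move=> z1; rewrite -normc_gt0 (lt_le_trans _ (ler_normcB _ _))// normc1 normcM normc_ofR ger0_norm//.
  by rewrite subr_gt0 mulr_ilt1// normc_ge0.
pose g (z : C) : C := (1 - q%:C * z)^-1.
have dg (z : R[i]) : normc z < 1 -> derivable g z 1.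
  move=> z1; apply: derivableV; first exact: den.
  by apply: derivableB; [exact: derivable_cst|apply: derivableM; [exact: derivable_cst|exact: derivable_id]].
have := @mean_value g 0 q (lexx _); rewrite q0 q1 => /(_ isT).
have -> : g 0 = 1 by rewrite /g mulr0 subr0 invr1.
rewrite mulr1 => E; rewrite -[RHS]E; first last.
- by move=> z z1 _; exact: dg.
- by move=> z z1; apply: derivable_continuous; exact: dg.
rewrite /circle_int; congr seg_int; apply/funext => t.
by rewrite /g circle_pointM -expr2 sqr_sqrtr.
Qed.

Lemma derivable_subr (a z : C) : derivable (fun w : C => (w : R[i]) - a : C) z 1.
Proof.
suff [] : derivable (fun w : C => (w : R[i]) - a : C) z 1 /\
    derive1 (fun w : C => (w : R[i]) - a : C) z = 1 by [].
apply: is_derive_normc => e e0; exists 1 => // h _.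
have -> : (z : R[i]) + h - a - (z - a) - 1 * h = 0 by ring.
by rewrite normc0 mulr_ge0 ?normc_ge0// ltW.
Qed.

(** Cauchy formula at the point [a = s r] of the radius. The mean value property
    is applied to [z (f z - f a) / (z - a)], which vanishes at [0]; it says that [f a] is the mean of
    [f] against the kernel [z / (z - a)], of which only the modulus is kept. *)
Lemma cauchy_bound (f : C -> C) (r s : R) : holomorphic f -> 0 < r < 1 -> 0 <= s < 1 ->
  2 * pi * normc (f (s * r)%:C) <=
  seg_int (fun t => normc (f (circle_point r t)) * (3 / (1 - s + chord t))) 0 (2 * pi).
Proof.
move=> hf /andP[r0 r1] /andP[s0 s1].
have df (z : R[i]) : normc z < 1 -> derivable f z 1.
  by move=> z1; apply: hf; exact/unit_discE.
have cf (z : R[i]) : normc z < 1 -> {for (z : C), continuous f}.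
  by move=> z1; apply: derivable_continuous; exact: df.
have sc : 0 <= s <= 1 by rewrite s0 ltW.
have kp t : 0 < 1 - s + chord t by rewrite ltr_wpDr ?chord_ge0// subr_gt0.
have cG : cont_on (fun t => normc (f (circle_point r t)) * (3 / (1 - s + chord t))) 0 (2 * pi).
  move=> t _; apply: cvgM.
    apply: (@cvg_normc R _ _ _ (fun t => f (circle_point r t))).
    apply: cvg_comp; first exact: circle_point_continuous.
    by apply: cf; rewrite normc_circle_point gtr0_norm.
  apply: cvgM; first exact: cvg_cst.
  apply: cvgV; first by rewrite gt_eqF.
  by apply: cvgD; [exact: cvg_cst|exact: chord_continuous].
pose a := s * r.
have a0 : 0 <= a by rewrite mulr_ge0// ltW.
have ar : a < r by rewrite gtr_pMl.
have a1 : a < 1 by exact: lt_trans r1.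
have na : normc a%:C < 1 by rewrite normc_ofR ger0_norm.
pose fa : R[i] := f a%:C.
have [fa0|fa0] := eqVneq fa 0.
  rewrite -/a -/fa fa0 normc0 mulr0; apply: Rintegral_ge0 => t _.
  by rewrite mulr_ge0 ?normc_ge0// divr_ge0// ltW.
have nfa : 0 < normc fa by rewrite normc_gt0.
(* the unimodular factor that makes c * fa positive, since real parts are integrated *)
pose c : R[i] := (normc fa)^-1%:C * fa^*.
have nc : normc c = 1.
  by rewrite normcM normc_conj normc_ofR ger0_norm ?invr_ge0 ?normc_ge0// mulVf// gt_eqF.
have cfa : c * fa = (normc fa)%:C.
  rewrite /c -mulrA (mulrC fa^*) -sqr_normc normcR -rmorphXn -rmorphM.
  by congr (_%:C); rewrite expr2 mulKf// gt_eqF.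
(* q extends the difference quotient by continuity; it is differentiable off the point a *)
pose q0 (z : C) : C := (f z - fa) / (z - a%:C).
pose q (z : C) : C := if z == a%:C then derive1 f a%:C else q0 z.
pose h (z : C) : C := c * (z * q z).
have dh (z : R[i]) : normc z < 1 -> z != a%:C -> derivable h z 1.
  move=> z1 za; apply: derivableM; first exact: derivable_cst.
  apply: derivableM; first exact: derivable_id.
  apply: (@near_eq_derivable _ _ _ q0).
    exists (normc (z - a%:C))%:C; first by rewrite /= ltcR normc_gt0 subr_eq0.
    move=> y; rewrite /ball /= normcR ltcR => zy; rewrite /q ifN//.
    by apply: contraTneq zy => ->; rewrite -leNgt.
  apply: derivableM.
    by apply: derivableB; [exact: df|exact: derivable_cst].
  apply: derivableV; first by rewrite subr_eq0.
  exact: derivable_subr.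
have cq : {for (a%:C : C), continuous q}.
  apply: continuous_normc => e e0.
  have [d d0 H] := derivable_normc (df _ na) e0.
  exists d => // z zd.
  rewrite {2}/q eqxx /q.
  case: ifPn => [_|za]; first by rewrite subrr normc0 ltW.
  have za0 : (z : R[i]) - a%:C != 0 by rewrite subr_eq0.
  have nza : 0 < normc ((z : R[i]) - a%:C) by rewrite normc_gt0.
  rewrite -(ler_pM2r nza) -normcM mulrBl /q0 divfK//.
  by have := H _ zd; rewrite subrKC.
have ch (z : R[i]) : normc z < 1 -> {for (z : C), continuous h}.
  move=> z1; have [->|za] := eqVneq z a%:C; last by apply: derivable_continuous; exact: dh.
  apply: continuous_mul_at; first exact: (@cst_continuous C C c).
  by apply: continuous_mul_at; [exact: (derivable_continuous (@derivable_id C C _ _))|exact: cq].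
have h00 : h 0 = 0.
  by rewrite /h mul0r mulr0.
have mh : circle_int h r = 0.
  have -> : circle_int h r = 2 * pi * complex.Re (h 0).
    apply: (@mean_value h a r a0 _ ch); first by rewrite (ltW r0).
    move=> z z1 za; apply: (dh _ z1); apply: contra za => /eqP ->.
    by rewrite normc_ofR ger0_norm.
  by rewrite h00 mulr0.
pose K t := (1 - circle_point s (- t) : R[i])^-1.
pose F t := complex.Re (c * (f (circle_point r t) : R[i]) * K t).
have FE : F = fun t => complex.Re (h (circle_point r t)) +
                 normc fa * complex.Re ((1 - circle_point s t : R[i])^-1).
  apply/funext => t; rewrite -circle_pointN_inv -/(K t) /F.
  have wa : circle_point r t != a%:C.
    by apply/eqP => /(congr1 (@normc R)); rewrite normc_circle_point normc_ofR !ger0_norm ?(ltW r0)//; lra.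
  have wE : circle_point r t / (circle_point r t - a%:C) = K t.
    have w0 : circle_point r t != 0.
      by rewrite -normc_gt0 normc_circle_point gtr0_norm.
    have -> : circle_point r t - a%:C = (circle_point r t : R[i]) * (1 - circle_point s (- t)).
      rewrite mulrBr mulr1 circle_pointD subrr /circle_point cos0 sin0 mulr0 mulr1 /a.
      by rewrite (mulrC s).
    by rewrite /K invfM mulrA divff// mul1r.
  have -> : h (circle_point r t) = c * (((f (circle_point r t) : R[i]) - fa) * K t).
    by rewrite -wE /h /q (negbTE wa) /q0; congr (c * _); rewrite mulrCA.
  have -> : normc fa * complex.Re (K t) = complex.Re ((normc fa)%:C * K t).
    by case: (K t) => x y; simpc.
  by rewrite -cfa -ReD; congr complex.Re; ring.
have cg t : {for t, continuous (fun t => complex.Re ((1 - circle_point s t : R[i])^-1))}.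
  apply: (@cvg_Re R _ _ _ (fun t => ((1 : C) - (circle_point s t : C))^-1)).
  apply: cvgV; first by rewrite -normc_gt0; have := cauchy_kernel_lower t sc; have := kp t; lra.
  exact: (cvgB (cvg_cst (1 : C)) (@circle_point_continuous s t)).
have c1 : cont_on (fun t => complex.Re (h (circle_point r t))) 0 (2 * pi).
  by apply: cont_on_circle => t; apply: ch; rewrite normc_circle_point gtr0_norm.
have c2 : cont_on (fun t => complex.Re ((1 - circle_point s t : R[i])^-1)) 0 (2 * pi).
  by move=> t _; exact: cg.
have cF : cont_on F 0 (2 * pi).
  by rewrite FE => t tt; apply: cvgD; [exact: c1|apply: cvgM; [exact: cvg_cst|exact: c2]].
have -> : 2 * pi * normc (f (s * r)%:C) = seg_int F 0 (2 * pi).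
  rewrite FE /seg_int RintegralD//; last 2 first.
  - exact: cont_on_integrable.
  - by apply: cont_on_integrable => t tt; apply: cvgM; [exact: cvg_cst|exact: c2].
  rewrite RintegralZl//; last exact: cont_on_integrable.
  rewrite -/(seg_int _ 0 (2 * pi)) -/(circle_int h r) mh add0r.
  by rewrite -/(seg_int _ 0 (2 * pi)) circle_int_cauchy ?s0// mulrC.
apply: le_Rintegral => //; try exact: cont_on_integrable.
move=> t _; rewrite (le_trans (ler_norm _))// (le_trans (Re_le_normc _))//.
rewrite normcM normcM nc mul1r ler_wpM2l ?normc_ge0//.
rewrite /K normcV -circle_point_conj -(conjc1 R) -rmorphB normc_conj.
have := cauchy_kernel_lower t sc.
have := kp t.
set X := 1 - s + chord t; set Y := normc _ => X0 XY.
have Y0 : 0 < Y by lra.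
by rewrite ler_pdivlMr// mulrC ler_pdivrMr.
Qed.

End polar.

(** * The Schur test *)

Lemma ler_poweR (R : realType) (r : R) (x y : \bar R) :
  0 <= r -> (0 <= x)%E -> (x <= y)%E -> (x `^ r <= y `^ r)%E.
Proof.
move=> r0 x0 xy; apply: gt0_ler_poweR => //; rewrite in_itv /= leey andbT//.
exact: le_trans xy.
Qed.

Section schur.
Context {R : realType} d1 d2 (T1 : measurableType d1) (T2 : measurableType d2).
Variables (m1 : {sigma_finite_measure set T1 -> \bar R}).
Variables (m2 : {sigma_finite_measure set T2 -> \bar R}).

(** Hoelder for [K g = (K^(1/p) g / w) (K^(1/q) w)], then Tonelli. *)
Lemma schur_test (K : T1 * T2 -> R) (w : T1 -> R) (v : T2 -> R) (p q A B : R) :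
  0 < p -> 0 < q -> p^-1 + q^-1 = 1 -> 0 <= A -> 0 <= B ->
  measurable_fun setT K -> measurable_fun setT w -> measurable_fun setT v ->
  (forall z, 0 <= K z) -> (forall x, 0 < w x) -> (forall y, 0 < v y) ->
  (forall y, (\int[m1]_x (K (x, y) * w x `^ q)%:E <= (A * v y `^ q)%:E)%E) ->
  (forall x, (\int[m2]_y (K (x, y) * v y `^ p)%:E <= (B * w x `^ p)%:E)%E) ->
  forall g : T1 -> R, measurable_fun setT g -> (forall x, 0 <= g x) ->
  (\int[m2]_y ((\int[m1]_x (K (x, y) * g x)%:E) `^ p) <=
    (A `^ (p / q) * B)%:E * \int[m1]_x (g x `^ p)%:E)%E.
Proof.
move=> p0 q0 pq A0 B0 mK mw mv K0 w0 v0 hA hB g mg g0.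
have mKx y : measurable_fun setT (fun x => K (x, y)) by exact: measurableT_comp.
have mKy x : measurable_fun setT (fun y => K (x, y)) by exact: measurableT_comp.
have mpow (d : measure_display) (T : measurableType d) (f : T -> R) r : measurable_fun setT f ->
    measurable_fun setT (fun x => f x `^ r).
  by move=> mf; exact: (@measurableT_comp _ _ _ _ _ _ (@powR R ^~ r)).
have pointwise y : ((\int[m1]_x (K (x, y) * g x)%:E) `^ p <=
   \int[m1]_x ((A `^ (p / q) * v y `^ p) * (K (x, y) * (g x / w x) `^ p))%:E)%E.
  pose f1 x := K (x, y) `^ p^-1 * (g x / w x).
  pose f2 x := K (x, y) `^ q^-1 * w x.
  have mgw : measurable_fun setT (fun x => g x / w x).
    apply: measurable_funM => //.
    rewrite (_ : (fun x => (w x)^-1) = fun x => w x `^ (-1)); first exact: mpow.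
    by apply/funext => x; rewrite powR_inv1// ltW.
  have mf1 : measurable_fun setT f1 by apply: measurable_funM => //; exact: mpow.
  have mf2 : measurable_fun setT f2 by apply: measurable_funM => //; exact: mpow.
  have f1f2 x : f1 x * f2 x = K (x, y) * g x.
    rewrite /f1 /f2 mulrACA -powRD ?pq ?oner_eq0// powRr1// divfK// gt_eqF//.
  have f10 x : 0 <= f1 x by rewrite mulr_ge0 ?powR_ge0// divr_ge0// ltW.
  have f20 x : 0 <= f2 x by rewrite mulr_ge0 ?powR_ge0// ltW.
  have := hoelder m1 mf1 mf2 p0 q0 pq.
  rewrite Lnorm1.
  have -> : (\int[m1]_x `|(EFin \o (f1 \* f2)%R) x| = \int[m1]_x (K (x, y) * g x)%:E)%E.
    by apply: eq_integral => x _; rewrite /= f1f2 ger0_norm// mulr_ge0.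
  move=> H.
  have : ((\int[m1]_x (K (x, y) * g x)%:E) `^ p <=
      ('N[m1]_p%:E[EFin \o f1] * 'N[m1]_q%:E[EFin \o f2]) `^ p)%E.
    apply: ler_poweR => //; first exact: ltW.
    by apply: integral_ge0 => x _; rewrite lee_fin mulr_ge0.
  move=> /le_trans; apply; rewrite poweRM ?Lnorm_ge0//.
  rewrite powR_Lnorm ?gt_eqF//.
  have -> : p = q * (p / q) by field; rewrite gt_eqF.
  rewrite [X in (_ * X)%E]poweRrM powR_Lnorm ?gt_eqF//.
  have -> : q * (p / q) = p by field; rewrite gt_eqF.
  have -> : (\int[m1]_x `|(EFin \o f2) x| `^ q = \int[m1]_x (K (x, y) * w x `^ q)%:E)%E.
    apply: eq_integral => x _; rewrite /= ger0_norm// powRM ?powR_ge0 ?(ltW (w0 _))//.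
    by rewrite -powRrM mulVf ?gt_eqF// powRr1.
  have -> : (\int[m1]_x `|(EFin \o f1) x| `^ p = \int[m1]_x (K (x, y) * (g x / w x) `^ p)%:E)%E.
    apply: eq_integral => x _; rewrite /= ger0_norm// /f1 powRM ?powR_ge0 ?divr_ge0 ?(ltW (w0 _))//.
    by rewrite -powRrM mulVf ?gt_eqF// powRr1.
  under [X in (_ <= X)%E]eq_integral do rewrite EFinM.
  rewrite ge0_integralZl//; last 3 first.
  - apply/measurable_EFinP; apply: measurable_funM => //; exact: mpow.
  - by move=> x _; rewrite lee_fin mulr_ge0// powR_ge0.
  - by rewrite lee_fin mulr_ge0 ?powR_ge0.
  rewrite muleC lee_wpmul2r//.
    by apply: integral_ge0 => x _; rewrite lee_fin mulr_ge0 ?powR_ge0.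
  apply: (@le_trans _ _ ((A * v y `^ q)%:E `^ (p / q))%E).
    apply: ler_poweR => //; first by rewrite divr_ge0 ?(ltW p0) ?(ltW q0).
    by apply: integral_ge0 => x _; rewrite lee_fin mulr_ge0 ?powR_ge0.
  rewrite poweR_EFin powRM ?powR_ge0// -powRrM.
  by have -> : q * (p / q) = p by field; rewrite gt_eqF.
pose F (z : T1 * T2) : \bar R := ((A `^ (p / q) * v z.2 `^ p) * (K z * (g z.1 / w z.1) `^ p))%:E.
have mF : measurable_fun setT F.
  apply/measurable_EFinP; apply: measurable_funM.
    apply: measurable_funM => //; apply/(mpow).
    exact: (measurableT_comp mv measurable_snd).
  apply: measurable_funM => //; apply/(mpow); apply: measurable_funM.
    exact: (measurableT_comp mg measurable_fst).
  rewrite (_ : (fun z => (w z.1)^-1) = fun z => w z.1 `^ (-1)).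
    by apply/(mpow); exact: (measurableT_comp mw measurable_fst).
  by apply/funext => x; rewrite powR_inv1// ltW.
have F0 z : (0 <= F z)%E by rewrite lee_fin !mulr_ge0 ?powR_ge0.
apply: (@le_trans _ _ (\int[m2]_y \int[m1]_x F (x, y))%E).
  apply: ge0_le_integral => //.
  - by move=> y _; exact: poweR_ge0.
  - apply: (measurableT_comp (measurable_poweR p)).
    apply: (@measurable_fun_fubini_tonelli_G _ _ _ _ _ m1 (fun z => (K z * g z.1)%:E)).
      apply/measurable_EFinP; apply: measurable_funM => //; exact: measurableT_comp.
    by move=> z; rewrite lee_fin mulr_ge0.
  - exact: (@measurable_fun_fubini_tonelli_G _ _ _ _ _ m1 F).
rewrite -fubini_tonelli//.
have -> : ((A `^ (p / q) * B)%:E * \int[m1]_x (g x `^ p)%:E =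
    \int[m1]_x ((A `^ (p / q) * B) * g x `^ p)%:E)%E.
  rewrite -ge0_integralZl//; first by apply/measurable_EFinP; exact: mpow.
  - by move=> x _; rewrite lee_fin powR_ge0.
  - by rewrite lee_fin mulr_ge0 ?powR_ge0.
apply: ge0_le_integral => //.
- by move=> x _; apply: integral_ge0.
- exact: (@measurable_fun_fubini_tonelli_F _ _ _ _ _ m2 F).
- by apply/measurable_EFinP; apply: measurable_funM => //; exact: mpow.
move=> x _; rewrite /F.
have -> : (\int[m2]_y (A `^ (p / q) * v y `^ p * (K (x, y) * (g x / w x) `^ p))%:E =
   (A `^ (p / q) * (g x / w x) `^ p)%:E * \int[m2]_y (K (x, y) * v y `^ p)%:E)%E.
  rewrite -(@ge0_integralZl _ _ _ m2 setT measurableT (fun y => (K (x, y) * v y `^ p)%:E)).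
  - by apply: eq_integral => y _; rewrite -EFinM; congr EFin; ring.
  - by apply/measurable_EFinP; apply: measurable_funM => //; exact: mpow.
  - by move=> y _; rewrite lee_fin mulr_ge0 ?powR_ge0.
  - by rewrite lee_fin mulr_ge0 ?powR_ge0.
apply: (@le_trans _ _ ((A `^ (p / q) * (g x / w x) `^ p)%:E * (B * w x `^ p)%:E)%E).
  by rewrite lee_wpmul2l// lee_fin mulr_ge0 ?powR_ge0.
rewrite -EFinM lee_fin le_eqVlt; apply/orP; left; apply/eqP.
have -> : g x `^ p = (g x / w x) `^ p * w x `^ p.
  by rewrite -powRM ?divr_ge0 ?(ltW (w0 _))// divfK// gt_eqF.
ring.
Qed.

End schur.

(** * Riesz weights and the length of chords *)

Section weights.
Context {R : realType}.
Local Notation mu := (@lebesgue_measure R).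
Implicit Types (a b c u v x y s t : R).

Lemma integral_segE (f : R -> R) a b : cont_on f a b ->
  (\int[mu]_(x in `[a, b]) (f x)%:E = (seg_int f a b)%:E)%E.
Proof.
move=> cf; rewrite /seg_int /Rintegral fineK//.
by apply: integrable_fin_num => //; exact: cont_on_integrable.
Qed.

Lemma seg_int_mono (f g : R -> R) a b : cont_on f a b -> cont_on g a b ->
  (forall x, a <= x <= b -> f x <= g x) -> seg_int f a b <= seg_int g a b.
Proof.
move=> cf cg fg; apply: le_Rintegral => //; try exact: cont_on_integrable.
Qed.

(** Monotone convergence, to pass from segments to an open or half-open interval. *)
Lemma integral_exhaust (f : R -> R) (D : set R) (u v : nat -> R) (M : R) :
  D = \bigcup_n (`[u n, v n])%classic -> measurable_fun D f -> (forall x, D x -> 0 <= f x) ->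
  (forall n, u n.+1 <= u n) -> (forall n, v n <= v n.+1) ->
  (forall n, cont_on f (u n) (v n)) -> (forall n, seg_int f (u n) (v n) <= M) ->
  (\int[mu]_(x in D) (f x)%:E <= M%:E)%E.
Proof.
move=> DE mf f0 hu hv cf hM.
have sub n : `[u n, v n]%classic `<=` D by rewrite DE => x xn; exists n.
have mD : measurable D by rewrite DE; apply: bigcup_measurable => n _; exact: measurable_itv.
have nd : nondecreasing_seq (fun n => `[u n, v n]%classic : set R).
  by apply/nondecreasing_seqP => n; rewrite subsetEset; apply: subset_itv; rewrite bnd_simp.
have H := @ge0_nondecreasing_set_cvg_integral _ (measurableTypeR R) R (fun n => `[u n, v n]%classic) (fun x => (f x)%:E) mu nd.
have {}H : (\int[mu]_(x in `[u i, v i]) (f x)%:E @[i --> \oo] --> \int[mu]_(x in D) (f x)%:E)%E.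
  rewrite DE; apply: H.
  - by move=> n; exact: measurable_itv.
  - by move=> n; apply/measurable_EFinP; exact: (measurable_funS mD (sub n)).
  - by move=> n x /sub/f0; rewrite lee_fin.
rewrite -(cvg_lim _ H)//; apply: lime_le; first by apply/cvg_ex; eexists; exact: H.
by near=> n; rewrite integral_segE// lee_fin.
Unshelve. all: by end_near. Qed.

Lemma powR_continuous (e x : R) : 0 < x -> {for x, continuous (@powR R ^~ e)}.
Proof.
move=> x0; have : derivable (@powR R ^~ e) x 1 by apply: derivable_powR; rewrite in_itv /= x0.
by move=> /derivable1_diffP/differentiable_continuous.
Qed.

(** A power weight against the Hilbert kernel, as it appears in the Schur test. *)
Definition riesz_weight a y x : R := x `^ (- a) / (x + y).

Lemma riesz_weight_cont a y x : 0 < y -> 0 < x -> {for x, continuous (riesz_weight a y)}.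
Proof.
move=> y0 x0; apply: cvgM.
  exact: powR_continuous.
apply: cvgV; first by rewrite gt_eqF// addr_gt0.
by apply: cvgD; [exact: cvg_id|exact: cvg_cst].
Qed.

Lemma riesz_weight_anti a y x x' : 0 < a -> 0 < y -> 0 < x -> x <= x' ->
  riesz_weight a y x' <= riesz_weight a y x.
Proof.
move=> a0 y0 x0 xx'; have x'0 : 0 < x' by exact: lt_le_trans xx'.
rewrite /riesz_weight !powRN ler_pM ?invr_ge0 ?powR_ge0//.
- by rewrite addr_ge0// ltW.
- by rewrite lef_pV2 ?posrE ?powR_gt0// ge0_ler_powR ?nnegrE ?(ltW a0) ?(ltW x0) ?(ltW x'0).
- by rewrite lef_pV2 ?posrE ?addr_gt0// lerD2r.
Qed.

(** The integral over a whole half-line scales like [y^(-a)]. With [b = 1 - a] and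
    [Z = c + sg s], the integrand is at most a constant times [Z^(-a) (Z^b + y^b)^(-1/b)],
    since [Z + y] and [(Z^b + y^b)^(1/b)] are comparable; this majorant has the explicit
    primitive [- (Z^b + y^b)^(-a/b) / sg], up to a factor. *)
Lemma seg_int_riesz a y c sg u v : 0 < a < 1 -> 0 < y -> sg != 0 -> u <= v ->
  (forall s, u <= s <= v -> 0 < c + sg * s) ->
  seg_int (fun s => riesz_weight a y (c + sg * s)) u v <=
    2 `^ (1 - a)^-1 / (a * `|sg|) * y `^ (- a).
Proof.
move=> /andP[a0 a1] y0 sg0 uv Z0; pose b := 1 - a.
have b0 : 0 < b by rewrite subr_gt0.
have b1 : b < 1 by rewrite /b; lra.
pose Z s := c + sg * s.
have Zc s : {for s, continuous Z}.
  by apply: cvgD; [exact: cvg_cst|apply: cvgM; [exact: cvg_cst|exact: cvg_id]].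
pose W s := Z s `^ b + y `^ b.
have yb : 0 < y `^ b by exact: powR_gt0.
have W0 s : 0 < W s by rewrite ltr_wpDl// powR_ge0.
pose F s := (- sg^-1) * W s `^ (- (a / b)).
pose f s := a * (Z s `^ (- a) * W s `^ (- b^-1)).
have dF s : u <= s <= v -> is_derive s 1 F (f s).
  move=> suv; have Zs := Z0 _ suv.
  have dZ : is_derive s (1 : R) Z sg.
    by rewrite /Z; apply: is_derive_eq; rewrite add0r /GRing.scale /= mulr1; idtac; ring.
  have dP : is_derive s (1 : R) (fun s => Z s `^ b) (b * Z s `^ (b - 1) * sg).
    by apply: (@is_derive1_comp R (@powR R ^~ b) Z); exact: is_derive1_powR.
  have dW : is_derive s (1 : R) W (b * Z s `^ (b - 1) * sg).
    by rewrite /W; apply: is_derive_eq; rewrite addr0.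
  have dWp : is_derive s (1 : R) (fun s => W s `^ (- (a / b)))
     (- (a / b) * W s `^ (- (a / b) - 1) * (b * Z s `^ (b - 1) * sg)).
    apply: (@is_derive1_comp R (@powR R ^~ (- (a / b))) W) => //.
    exact: is_derive1_powR.
  apply: (@is_derive_eq _ _ _ _ _ _ _ ((- sg^-1) * (- (a / b) * W s `^ (- (a / b) - 1) * (b * Z s `^ (b - 1) * sg)))).
  rewrite /f.
  have -> : - (a / b) - 1 = - b^-1 by rewrite /b; field; rewrite subr_eq0 gt_eqF.
  have -> : b - 1 = - a by rewrite /b; ring.
  by field; rewrite sg0 gt_eqF.
have cf : cont_on f u v.
  move=> s suv; have Zs := Z0 _ suv.
  apply: cvgM; first exact: cvg_cst.
  apply: cvgM.
    by apply: (@continuous_comp _ _ _ Z (@powR R ^~ (- a))); [exact: Zc|exact: powR_continuous].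
  apply: (@continuous_comp _ _ _ W (@powR R ^~ (- b^-1))); last exact: powR_continuous.
  apply: cvgD; last exact: cvg_cst.
  by apply: (@continuous_comp _ _ _ Z (@powR R ^~ b)); [exact: Zc|exact: powR_continuous].
have dom s : u <= s <= v -> riesz_weight a y (Z s) <= (2 `^ b^-1 / a) * f s.
  move=> suv; have Zs : 0 < Z s := Z0 _ suv.
  have -> : 2 `^ b^-1 / a * f s = Z s `^ (- a) * (2 `^ b^-1 * W s `^ (- b^-1)).
    by rewrite /f; field; rewrite gt_eqF.
  rewrite /riesz_weight ler_wpM2l ?powR_ge0//.
  have Wb : 0 < W s `^ b^-1 by exact: powR_gt0.
  have Zy : 0 < Z s + y by exact: addr_gt0.
  rewrite powRN ler_pdivlMr//.
  rewrite mulrC ler_pdivrMr// mulrC.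
  have -> : (Z s + y) * 2 `^ b^-1 = ((Z s + y) `^ b * 2) `^ b^-1.
    rewrite powRM ?powR_ge0// -powRrM mulfV ?gt_eqF// powRr1//.
    by rewrite addr_ge0// ltW.
  have Zp : Z s `^ b <= (Z s + y) `^ b.
    by rewrite ge0_ler_powR ?nnegrE ?(ltW b0) ?(ltW Zs) ?(ltW Zy) ?lerDl ?(ltW y0).
  have yp : y `^ b <= (Z s + y) `^ b.
    by rewrite ge0_ler_powR ?nnegrE ?(ltW b0) ?(ltW y0) ?(ltW Zy) ?lerDr ?(ltW Zs).
  rewrite ge0_ler_powR ?nnegrE ?invr_ge0 ?(ltW b0) ?(ltW (W0 _)) ?mulr_ge0 ?powR_ge0//.
  by rewrite mulr_natr mulr2n /W lerD.
have cw : cont_on (fun s => riesz_weight a y (Z s)) u v.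
  move=> s suv; apply: (@continuous_comp _ _ _ Z (riesz_weight a y)); first exact: Zc.
  by apply: riesz_weight_cont => //; exact: Z0.
have c0 : 0 <= 2 `^ b^-1 / a by rewrite divr_ge0 ?powR_ge0 ?ltW.
apply: (@le_trans _ _ (seg_int (fun s => (2 `^ b^-1 / a) * f s) u v)).
  by apply: seg_int_mono => // s suv; apply: cvgM; [exact: cvg_cst|exact: cf].
rewrite /seg_int RintegralZl//; last exact: cont_on_integrable.
rewrite invfM -/b !mulrA -[X in _ <= X]mulrA ler_wpM2l// -/(seg_int f u v).
move: uv; rewrite le_eqVlt => /predU1P[uv|uv].
  by rewrite uv /seg_int set_itv1 Rintegral_set1 mulr_ge0 ?powR_ge0.
have cF s : u <= s <= v -> {for s, continuous F}.
  by move=> suv; have [/derivable1_diffP/differentiable_continuous ? _] := dF _ suv.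
have : (\int[mu]_(x in `[u, v]) (f x)%:E = (F v)%:E - (F u)%:E)%E.
  apply: continuous_FTC2 => //.
  - by apply: continuous_in_subspaceT => s; rewrite inE /= in_itv /= => suv; exact: cf.
  - split.
    + by move=> s; rewrite in_itv /= => /andP[us sv]; have [] := dF s ltac:(lra).
    + by apply: cvg_at_right_filter; apply: cF; rewrite lexx ltW.
    + by apply: cvg_at_left_filter; apply: cF; rewrite lexx ltW.
  - by move=> s; rewrite in_itv /= => /andP[us sv]; rewrite derive1E; have [_ ->] := dF s ltac:(lra).
rewrite integral_segE// -EFinB => -[->].
have Wy s : W s `^ (- (a / b)) <= y `^ (- a).
  have -> : - a = b * (- (a / b)) by field; rewrite gt_eqF.
  rewrite powRrM !powRN lef_pV2 ?posrE ?powR_gt0//.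
  rewrite ge0_ler_powR ?nnegrE ?divr_ge0 ?(ltW a0) ?(ltW b0) ?powR_ge0 ?(ltW (W0 _))//.
  by rewrite /W lerDr powR_ge0.
have -> : F v - F u = sg^-1 * (W u `^ (- (a / b)) - W v `^ (- (a / b))).
  have E (p q : R) : (- sg^-1) * p - (- sg^-1) * q = sg^-1 * (q - p) by ring.
  exact: E.
rewrite (le_trans (ler_norm _))// normrM normfV ler_wpM2l ?invr_ge0//.
have [h1 h2] := (Wy u, Wy v).
have h3 := powR_ge0 (W u) (- (a / b)); have h4 := powR_ge0 (W v) (- (a / b)).
move: h1 h2 h3 h4; set X := W u `^ _; set Y := W v `^ _; set y' := y `^ _.
move: X Y y' => X Y y' h1 h2 h3 h4.
by rewrite ler_norml; lra.
Qed.

Lemma sin_lower (x : R) : 0 <= x <= pi / 2 -> x / 2 <= sin x.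
Proof.
move=> /andP[x0 xpi]; pose w := x / 2.
have pi0 := @pi_gt0 R.
have w0 : 0 <= w by rewrite divr_ge0.
have wpi : w <= pi / 4 by rewrite /w; lra.
have cw : 0 <= cos w by apply: cos_ge0_pihalf; lra.
have sw : w * cos w <= sin w.
  move: w0; rewrite le_eqVlt => /predU1P[<-|w0]; first by rewrite mul0r sin0.
  have [|z] := @MVT R sin cos 0 w w0 (fun z _ => is_derive_sin z).
    by apply: continuous_subspaceT; exact: continuous_sin.
  rewrite in_itv /= => /andP[z0 zw]; rewrite sin0 !subr0 => ->.
  rewrite mulrC ler_wpM2r ?(ltW w0)//.
  by apply: ltW; rewrite ltr_cos// in_itv /=; apply/andP; split; lra.
have c2 : 2^-1 <= cos w * cos w.
  have : cos x = 2 * (cos w * cos w) - 1.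
    have -> : x = w *+ 2 by rewrite /w; field.
    by rewrite cos_mulr2n; ring.
  have : 0 <= cos x by apply: cos_ge0_pihalf; lra.
  lra.
have -> : sin x = 2 * (sin w * cos w).
  have -> : x = w *+ 2 by rewrite /w; field.
  by rewrite sin_mulr2n; ring.
have : w * cos w * cos w <= sin w * cos w by rewrite ler_wpM2r.
have : w * 2^-1 <= w * (cos w * cos w) by rewrite ler_wpM2l.
have : x = 2 * w by rewrite /w; field.
lra.
Qed.

Lemma chordE t : chord t ^+ 2 = (2 * sin (t / 2)) ^+ 2.
Proof.
rewrite /chord /circle_point /normc /= sqr_sqrtr ?addr_ge0 ?sqr_ge0// !mul1r sub0r sqrrN.
have h := cos2Dsin2 t; have h2 := cos2Dsin2 (t / 2).
have : cos t = 1 - 2 * sin (t / 2) ^+ 2.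
  have {1}-> : t = (t / 2) *+ 2 by field.
  rewrite cos_mulr2n mulr2n; lra.
move=> E; rewrite exprMn.
have -> : (1 - cos t) ^+ 2 + sin t ^+ 2 = 1 - 2 * cos t + (cos t ^+ 2 + sin t ^+ 2) by ring.
rewrite h E; ring.
Qed.

(** Near [0], and by [chord_sym] near [2 pi], the chord is comparable to the arc. *)
Lemma chord_lower t : 0 <= t <= pi -> t / 2 <= chord t.
Proof.
move=> /andP[t0 tpi]; have : t / 2 <= 2 * sin (t / 2).
  have := @sin_lower (t / 2); have := @pi_gt0 R; move=> pi0 H.
  have : t / 2 / 2 <= sin (t / 2) by apply: H; lra.
  lra.
move=> h; have t20 : 0 <= t / 2 by rewrite divr_ge0.
rewrite -(@ler_pXn2r _ 2) ?nnegrE ?chord_ge0// chordE ler_pXn2r ?nnegrE//.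
exact: le_trans h.
Qed.

Lemma chord_sym t : chord (2 * pi - t) = chord t.
Proof.
have E : circle_point 1 (2 * pi - t) = (circle_point 1 t)^*.
  rewrite circle_point_conj /circle_point.
  have -> : 2 * pi - t = - t + pi *+ 2 by rewrite mulr_natl addrC.
  by rewrite cosD2pi sinD2pi.
by rewrite /chord E -(conjc1 R) -rmorphB normc_conj conjc1.
Qed.

Lemma chord_gt0 t : 0 < t < 2 * pi -> 0 < chord t.
Proof.
move=> /andP[t0 t2]; have [tpi|tpi] := leP t pi.
  by rewrite (lt_le_trans _ (chord_lower _))// ?divr_gt0// (ltW t0).
by rewrite -chord_sym (lt_le_trans _ (chord_lower _))// ?divr_gt0//; lra.
Qed.

End weights.

(** * Hilbert inequality for the kernel 1 / (X + Y) *)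

Section hilbert.
Context {R : realType}.
Local Notation mu := (@lebesgue_measure R).
Implicit Types (a c x y s t : R) (D E : set R) (X Y : R -> R).

(** The property of a distance function [X] that makes power weights work in the Schur
    test: [X] is distributed like the coordinate of a half-line. *)
Definition hilbert_scale D X := [/\ measurable D, measurable_fun D X,
  (forall x, D x -> 0 < X x) &
  forall a, 0 < a < 1 -> exists2 c, 0 <= c & forall y, 0 < y ->
    (\int[mu]_(x in D) (riesz_weight a y (X x))%:E <= (c * y `^ (- a))%:E)%E].

Lemma radius_scale : hilbert_scale `[0, 1[ (fun s => 1 - s).
Proof.
have X0 s : `[0, 1[%classic s -> 0 < 1 - s by rewrite /= in_itv /= subr_gt0 => /andP[].
have Xc s : {for s, continuous (fun s => 1 - s : R)}.
  by apply: cvgB; [exact: cvg_cst|exact: cvg_id].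
split => //.
  by apply: measurable_funS (continuous_measurable_fun Xc).
move=> a a01; exists (2 `^ (1 - a)^-1 / (a * `|-1|)).
  by rewrite divr_ge0 ?powR_ge0// mulr_ge0//; lra.
move=> y y0.
have cw (s : R) : s < 1 -> {for s, continuous (fun s => riesz_weight a y (1 - s))}.
  move=> s1; apply: (@continuous_comp _ _ _ (fun s => 1 - s) (riesz_weight a y)); first exact: Xc.
  by apply: riesz_weight_cont => //; rewrite subr_gt0.
apply: (@integral_exhaust R _ _ (fun=> 0) (fun n => 1 - n.+1%:R^-1)).
- apply/seteqP; split => [s|s [n _]] /=; rewrite !in_itv /=.
    move=> /andP[s0 s1]; have ds : 0 < 1 - s by rewrite subr_gt0.
    exists (Num.Def.truncn ((1 - s)^-1)) => //=; rewrite in_itv /= s0 /=.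
    rewrite lerBrDr -lerBrDl -[leRHS]invrK lef_pV2 ?posrE ?invr_gt0//.
    by apply/ltW; exact: truncnS_gt.
  move=> /andP[s0 s1]; rewrite s0 /= (le_lt_trans s1)// gtrDl oppr_lt0 invr_gt0//.
- have mo : measurable_fun [set` `]-oo, (1 : R)[] (fun s : R => riesz_weight a y (1 - s)).
    apply: open_continuous_measurable_fun; first exact: interval_open.
    by move=> s; rewrite inE /= in_itv /= => s1; exact: cw.
  apply: measurable_funS mo => //.
  by apply: subset_itv; rewrite bnd_simp.
- by move=> s /X0 Xs; rewrite /riesz_weight divr_ge0 ?powR_ge0// addr_ge0// ltW.
- by [].
- by move=> n; rewrite lerB// lef_pV2 ?posrE// ler_nat.
- move=> n s /andP[_ s1]; apply: cw; rewrite (le_lt_trans s1)// gtrDl oppr_lt0 invr_gt0//.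
move=> n.
have n1 : n.+1%:R^-1 <= 1 :> R by rewrite invf_le1// ler1n.
have -> : (fun s => riesz_weight a y (1 - s)) = (fun s => riesz_weight a y (1 + (-1) * s)).
  by apply/funext => s; rewrite mulN1r.
apply: seg_int_riesz => //.
- by rewrite subr_ge0.
- move=> s /andP[_ s1]; rewrite mulN1r subr_gt0 (le_lt_trans s1)// gtrDl oppr_lt0 invr_gt0//.
Qed.

Lemma circle_scale : hilbert_scale `]0, (2 * pi)[ (@chord R).
Proof.
split => //.
- by apply: measurable_funS (continuous_measurable_fun (@chord_continuous R)).
- by move=> t; rewrite /= in_itv /=; exact: chord_gt0.
move=> a /[dup] a01 /andP[a0 a1]; pose C0 := 2 `^ (1 - a)^-1 / (a * `|2^-1|) : R.
have C00 : 0 <= C0 by rewrite divr_ge0 ?powR_ge0// mulr_ge0// ltW.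
exists (C0 + C0); first by rewrite addr_ge0.
move=> y y0.
have pi2 : 2 <= pi :> R by exact: pi_ge2.
have cw (t : R) : 0 < t < 2 * pi -> {for t, continuous (fun t => riesz_weight a y (chord t))}.
  move=> tt; apply: (@continuous_comp _ _ _ chord (riesz_weight a y)); first exact: chord_continuous.
  by apply: riesz_weight_cont => //; exact: chord_gt0.
have in1 n : 0 < n.+1%:R^-1 :> R by rewrite invr_gt0.
have n1 n : n.+1%:R^-1 <= 1 :> R by rewrite invf_le1// ler1n.
apply: (@integral_exhaust R _ _ (fun n => n.+1%:R^-1) (fun n => 2 * pi - n.+1%:R^-1)).
- apply/seteqP; split => [t|t [n _]] /=; rewrite !in_itv /=; last first.
    by move=> /andP[h1 h2]; rewrite (lt_le_trans (in1 n) h1) (le_lt_trans h2)// gtrDl oppr_lt0.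
  move=> /andP[t0 t1].
  pose d := Num.min t (2 * pi - t).
  have d0 : 0 < d by rewrite lt_min t0 subr_gt0.
  have [dt dpt] : d <= t /\ d <= 2 * pi - t by rewrite /d !ge_min !lexx orbT.
  exists (Num.Def.truncn (d^-1)) => //=; rewrite in_itv /=.
  have : (Num.Def.truncn (d^-1)).+1%:R^-1 <= d.
    by rewrite -[leRHS]invrK lef_pV2 ?posrE ?invr_gt0//; apply/ltW; exact: truncnS_gt.
  move=> h; apply/andP; split; first exact: le_trans h dt.
  by rewrite lerBrDr -lerBrDl; exact: le_trans h dpt.
- apply: open_continuous_measurable_fun; first exact: interval_open.
  by move=> s; rewrite inE /= in_itv /=; exact: cw.
- move=> t; rewrite /= in_itv /= => /chord_gt0 Xs.
  by rewrite /riesz_weight divr_ge0 ?powR_ge0// addr_ge0// ltW.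
- by move=> n; rewrite lef_pV2 ?posrE// ler_nat.
- by move=> n; rewrite lerB// lef_pV2 ?posrE// ler_nat.
- move=> n t; move: (n.+1%:R^-1) (in1 n) => e e0 /andP[t0 t1]; apply: cw; lra.
move=> n; move: (n.+1%:R^-1) (in1 n) (n1 n) => e i0 i1.
have cwn b d : e <= b -> d <= 2 * pi - e -> cont_on (fun t => riesz_weight a y (chord t)) b d.
  by move=> hb hd t /andP[t1 t2]; apply: cw; lra.
rewrite (@seg_intD _ _ _ pi); [|exact: cwn|lra].
rewrite [leRHS]mulrDl; apply: lerD.
- apply: (@le_trans _ _ (seg_int (fun t => riesz_weight a y (0 + 2^-1 * t)) e pi)).
    apply: seg_int_mono; first by apply: cwn => //; lra.
      move=> t /andP[t1 t2]; apply: (@continuous_comp _ _ _ (fun t => 0 + 2^-1 * t) (riesz_weight a y)).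
        by apply: cvgD; [exact: cvg_cst|apply: cvgM; [exact: cvg_cst|exact: cvg_id]].
      by apply: riesz_weight_cont => //; lra.
    move=> t /andP[t1 t2]; apply: riesz_weight_anti => //; first lra.
    by rewrite add0r mulrC; apply: chord_lower; lra.
  apply: seg_int_riesz => //; first lra.
  by move=> s /andP[s1 s2]; lra.
- have -> : C0 = 2 `^ (1 - a)^-1 / (a * `|- 2^-1|) by rewrite normrN.
  apply: (@le_trans _ _ (seg_int (fun t => riesz_weight a y (pi + (- 2^-1) * t)) pi (2 * pi - e))).
    apply: seg_int_mono; first by apply: cwn => //; lra.
      move=> t /andP[t1 t2]; apply: (@continuous_comp _ _ _ (fun t => pi + (- 2^-1) * t) (riesz_weight a y)).
        by apply: cvgD; [exact: cvg_cst|apply: cvgM; [exact: cvg_cst|exact: cvg_id]].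
      by apply: riesz_weight_cont => //; lra.
    move=> t /andP[t1 t2]; apply: riesz_weight_anti => //; first lra.
    rewrite -chord_sym.
    have -> : pi + - 2^-1 * t = (2 * pi - t) / 2 by field.
    by apply: chord_lower; lra.
  apply: seg_int_riesz => //; first lra.
  by move=> s /andP[s1 s2]; lra.
Qed.

(** Schur test with the weights [X^(-1/(p q))] and [Y^(-1/(p q))]. The inequality is
    symmetric in the two scales; it is used in both directions between a circle and a radius. *)
Lemma hilbert_ineq D X E Y (p : R) : 1 < p -> hilbert_scale D X -> hilbert_scale E Y ->
  exists2 c, 0 <= c & forall g h : R -> R, measurable_fun D g -> (forall x, D x -> 0 <= g x) ->
    measurable_fun E h -> (forall y, E y -> 0 <= h y) ->
    (forall y, E y -> ((h y)%:E <= \int[mu]_(x in D) (g x / (X x + Y y))%:E)%E) ->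
    (\int[mu]_(y in E) (h y `^ p)%:E <= c%:E * \int[mu]_(x in D) (g x `^ p)%:E)%E.
Proof.
move=> p1 [mD mX X0 wX] [mE mY Y0 wY].
have p0 : 0 < p by lra.
pose q := p / (p - 1).
have q0 : 0 < q by rewrite divr_gt0// subr_gt0.
have pq : p^-1 + q^-1 = 1 by rewrite /q; field; lra.
have ip : 0 < p^-1 < 1 by rewrite invr_gt0 p0 invf_lt1.
have iq : 0 < q^-1 < 1 by rewrite invr_gt0 q0 /=; have := ip; lra.
have [A A0 hA] := wX _ ip; have [B B0 hB] := wY _ iq.
exists (A `^ (p / q) * B); first by rewrite mulr_ge0 ?powR_ge0.
move=> g h mg g0 mh h0 hg.
(* The Schur test is for positive weights on the whole line: X and Y are extended by 1. *)
have ext (Z : R -> R) (F : set R) : measurable F -> measurable_fun F Z -> (forall x, F x -> 0 < Z x) ->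
    exists Z' : R -> R, [/\ measurable_fun setT Z', (forall x, 0 < Z' x) & forall x, F x -> Z' x = Z x].
  move=> mF mZ Z0; exists ((Z \_ F) \+ \1_(~` F)); split.
  - apply: measurable_funD; first exact/(measurable_restrictT _ mF).
    by apply: measurable_indic; exact: measurableC.
  - move=> x; rewrite /= patchE indicE in_setC; case: ifPn => xF.
      by rewrite addr0; apply: Z0; exact: set_mem.
    by rewrite [X in X + _](_ : _ = 0)// add0r.
  - by move=> x Fx; rewrite /= patchE indicE in_setC mem_set// addr0.
have [X' [mX' X'0 X'E]] := ext _ _ mD mX X0.
have [Y' [mY' Y'0 Y'E]] := ext _ _ mE mY Y0.
have mpow (d : measure_display) (T : measurableType d) (f : T -> R) r : measurable_fun setT f ->
    measurable_fun setT (fun z => f z `^ r).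
  by move=> mf; exact: (@measurableT_comp _ _ _ _ _ _ (@powR R ^~ r)).
pose K (z : measurableTypeR R * measurableTypeR R) : R := \1_D z.1 * \1_E z.2 * (X' z.1 + Y' z.2) `^ (-1).
have mK : measurable_fun setT K.
  apply: measurable_funM; first apply: measurable_funM.
  - exact: (measurableT_comp (measurable_indic mD) measurable_fst).
  - exact: (measurableT_comp (measurable_indic mE) measurable_snd).
  - apply/mpow/measurable_funD.
    + exact: (measurableT_comp mX' measurable_fst).
    + exact: (measurableT_comp mY' measurable_snd).
pose w x := X' x `^ (- (p * q)^-1); pose v y := Y' y `^ (- (p * q)^-1).
have XY x y : 0 < X' x + Y' y by rewrite addr_gt0.
have KE x y : D x -> E y -> K (x, y) = (X' x + Y' y)^-1.
  by move=> Dx Ey; rewrite /K /= !indicE !mem_set// !mul1r powR_inv1// ltW.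
have wq x : w x `^ q = X' x `^ (- p^-1).
  by rewrite /w -powRrM; congr (_ `^ _); field; rewrite !gt_eqF.
have wp x : w x `^ p = X' x `^ (- q^-1).
  by rewrite /w -powRrM; congr (_ `^ _); field; rewrite !gt_eqF.
have vq x : v x `^ q = Y' x `^ (- p^-1).
  by rewrite /v -powRrM; congr (_ `^ _); field; rewrite !gt_eqF.
have vp x : v x `^ p = Y' x `^ (- q^-1).
  by rewrite /v -powRrM; congr (_ `^ _); field; rewrite !gt_eqF.
have K0 z : 0 <= K z by rewrite /K !mulr_ge0 ?powR_ge0.
have w0 x : 0 < w x by exact: powR_gt0.
have v0 y : 0 < v y by exact: powR_gt0.
have KnE x y : ~ E y -> K (x, y) = 0 by move=> nE; rewrite /K /= !indicE (memNset nE) mulr0 mul0r.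
have KnD x y : ~ D x -> K (x, y) = 0 by move=> nD; rewrite /K /= !indicE (memNset nD) mul0r mul0r.
have hA' y : (\int[mu]_x (K (x, y) * w x `^ q)%:E <= (A * v y `^ q)%:E)%E.
  have [Ey|nEy] := pselect (E y); last first.
    under eq_integral do rewrite KnE// mul0r.
    by rewrite integral0 lee_fin mulr_ge0 ?powR_ge0.
  apply: (@le_trans _ _ (\int[mu]_(x in D) (riesz_weight p^-1 (Y' y) (X x))%:E)%E); last first.
    by rewrite vq; exact: hA.
  rewrite [leRHS]integral_mkcond le_eqVlt; apply/orP; left; apply/eqP.
  apply: eq_integral => x _; rewrite patchE; case: ifPn => xD.
    by have Dx := set_mem xD; rewrite KE// wq X'E// mulrC.
  have nD : ~ D x by move=> /mem_set hx; rewrite hx in xD.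
  by rewrite KnD// mul0r.
have hB' x : (\int[mu]_y (K (x, y) * v y `^ p)%:E <= (B * w x `^ p)%:E)%E.
  have [Dx|nDx] := pselect (D x); last first.
    under eq_integral do rewrite KnD// mul0r.
    by rewrite integral0 lee_fin mulr_ge0 ?powR_ge0.
  apply: (@le_trans _ _ (\int[mu]_(y in E) (riesz_weight q^-1 (X' x) (Y y))%:E)%E); last first.
    by rewrite wp; exact: hB.
  rewrite [leRHS]integral_mkcond le_eqVlt; apply/orP; left; apply/eqP.
  apply: eq_integral => y _; rewrite patchE; case: ifPn => yE.
    by have Ey := set_mem yE; rewrite KE// vp Y'E// mulrC addrC.
  have nE : ~ E y by move=> /mem_set hx; rewrite hx in yE.
  by rewrite KnE// mul0r.
have mg' : measurable_fun setT (g \_ D) by exact/(measurable_restrictT _ mD).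
have g'0 x : 0 <= (g \_ D) x.
  by rewrite patchE; case: ifPn => // /set_mem; exact: g0.
have H := @schur_test R _ _ _ _ mu mu K w v p q A B p0 q0 pq A0 B0 mK (mpow _ _ _ _ mX') (mpow _ _ _ _ mY')
  K0 w0 v0 hA' hB' _ mg' g'0.
have EL : (\int[mu]_(y in E) (h y `^ p)%:E <=
    \int[mu]_y ((\int[mu]_x (K (x, y) * (g \_ D) x)%:E) `^ p))%E.
  rewrite integral_mkcond; apply: ge0_le_integral => //.
  - by move=> y _; rewrite patchE; case: ifPn => // _; rewrite lee_fin powR_ge0.
  - apply/(measurable_restrictT _ mE)/measurable_EFinP.
    exact: (measurableT_comp (f := @powR R ^~ p)).
  - apply: (measurableT_comp (measurable_poweR p)).
    apply: (@measurable_fun_fubini_tonelli_G _ _ _ _ _ mu (fun z => (K z * (g \_ D) z.1)%:E)).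
      apply/measurable_EFinP; apply: measurable_funM => //.
      exact: (measurableT_comp mg' measurable_fst).
    by move=> z; rewrite lee_fin mulr_ge0.
  move=> y _; rewrite patchE; case: ifPn => yE; last exact: poweR_ge0.
  have Ey := set_mem yE; rewrite -poweR_EFin; apply: ler_poweR; rewrite ?lee_fin ?(ltW p0) ?h0//.
  apply: (le_trans (hg _ Ey)); rewrite integral_mkcond le_eqVlt; apply/orP; left; apply/eqP.
  apply: eq_integral => x _; rewrite !patchE; case: ifPn => xD.
    by have Dx := set_mem xD; rewrite KE// X'E// Y'E// mulrC.
  by rewrite mulr0.
have ER : (\int[mu]_(x in D) (g x `^ p)%:E = \int[mu]_x (((g \_ D) x) `^ p)%:E)%E.
  rewrite integral_mkcond; apply: eq_integral => x _; rewrite !patchE; case: ifPn => // xD.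
  by rewrite powR0// gt_eqF.
by rewrite ER; exact: (le_trans EL).
Qed.

End hilbert.

(** * Hardy norms, the Fejer-Riesz inequality and boundedness of T *)

Section hardy_space.
Context {R : realType}.
Local Notation C := (R[i]^o).
Local Notation mu := (@lebesgue_measure R).
Implicit Types (f phi : C -> C) (p r s t : R).

Lemma holomorphic_continuous f z : holomorphic f -> normc z < 1 -> {for (z : C), continuous f}.
Proof. by move=> hf z1; apply: derivable_continuous; apply: hf; exact/unit_discE. Qed.

Lemma normc_circle_continuous f r : holomorphic f -> `|r| < 1 ->
  continuous (fun t => normc (f (circle_point r t))).
Proof.
move=> hf r1 t; apply: (@cvg_normc R _ _ _ (fun t => f (circle_point r t))).
apply: cvg_comp; first exact: circle_point_continuous.
by apply: holomorphic_continuous => //; rewrite normc_circle_point.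
Qed.

Lemma ofR_continuous (s : R) : (fun s : R => s%:C : C) @ s --> (s%:C : C).
Proof. by apply: cvg_complex; [exact: cvg_id|exact: cvg_cst]. Qed.

Lemma measurable_powR_comp d (T : measurableType d) (D : set T) (g : T -> R) p :
  measurable_fun D g -> measurable_fun D (fun x => g x `^ p).
Proof. by move=> mg; exact: (measurableT_comp (f := @powR R ^~ p)). Qed.

Lemma cvg_powR_nneg (u : nat -> R) l p : 0 < p -> (forall n, 0 <= u n) ->
  u @ \oo --> l -> (fun n => u n `^ p) @ \oo --> l `^ p.
Proof.
move=> p0 u0 ul.
have : 0 <= l by rewrite -(cvg_lim _ ul)//; apply: limr_ge; [apply/cvg_ex; exists l|near=> n].
rewrite le_eqVlt => /predU1P[l0|l0]; last first.
  exact: (cvg_comp _ _ ul (powR_continuous l0)).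
rewrite -l0 in ul *; rewrite powR0 ?gt_eqF//; apply/cvgr0Pnorm_le => e e0.
have d0 : 0 < e `^ p^-1 by exact: powR_gt0.
move/cvgr0Pnorm_le : ul => /(_ _ d0); apply: filterS => n.
rewrite ger0_norm// ger0_norm ?powR_ge0// => h.
have -> : e = (e `^ p^-1) `^ p by rewrite -powRrM mulVf ?gt_eqF// powRr1// ltW.
by rewrite ge0_ler_powR ?nnegrE ?powR_ge0// ltW.
Unshelve. all: by end_near. Qed.

Lemma integral_circle_open (g : R -> R) : measurable_fun setT g ->
  (\int[mu]_(t in `[0%R, (2 * pi)%R]) (g t)%:E = \int[mu]_(t in `]0%R, (2 * pi)%R[) (g t)%:E)%E.
Proof.
move=> mg; have m (A : set R) : measurable A -> measurable_fun A (fun t => (g t)%:E).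
  by move=> mA; apply/measurable_EFinP; exact: measurable_funS mg.
rewrite -integral_itv_bndo_bndc; last exact: m.
by rewrite -integral_itv_obnd_cbnd//; exact: m.
Qed.

(** The integral inside [integral_mean], before normalisation and root. *)
Definition circle_powint p f r : \bar R :=
  (\int[mu]_(t in `[0%R, (2 * pi)%R]) (normc (f (circle_point r t)) `^ p)%:E)%E.

Lemma circle_powint_ge0 p f r : (0 <= circle_powint p f r)%E.
Proof. by apply: integral_ge0 => t _; rewrite lee_fin powR_ge0. Qed.

Lemma integral_mean_ge0 p f r : (0 <= integral_mean p f r)%E.
Proof. exact: poweR_ge0. Qed.

Lemma hardy_norm_ge0 p f : (0 <= hardy_norm p f)%E.
Proof.
apply: (@le_trans _ _ (integral_mean p f 2^-1)); first exact: integral_mean_ge0.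
by apply: ereal_sup_ubound; exists 2^-1 => //; rewrite /= in_itv /=; apply/andP; split; lra.
Qed.

Lemma circle_powint_le p f r : 0 < p -> 0 < r < 1 ->
  (circle_powint p f r <= (2 * pi)%:E * hardy_norm p f `^ p)%E.
Proof.
move=> p0 r01; have pi0 : 0 < 2 * pi :> R by rewrite mulr_gt0 ?pi_gt0.
have : (integral_mean p f r <= hardy_norm p f)%E.
  by apply: ereal_sup_ubound; exists r => //; rewrite /= in_itv.
move=> /(ler_poweR (ltW p0) (integral_mean_ge0 _ _ _)).
rewrite /integral_mean -poweRrM mulVf ?gt_eqF// poweRe1; last first.
  by rewrite mule_ge0 ?circle_powint_ge0// lee_fin invr_ge0 ltW.
move=> h; rewrite -lee_pdivrMl//; exact: h.
Qed.

Lemma hardy_norm_le p f (M : \bar R) : 0 < p -> (0 <= M)%E ->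
  (forall r, 0 < r < 1 -> (circle_powint p f r <= (2 * pi)%:E * M `^ p)%E) ->
  (hardy_norm p f <= M)%E.
Proof.
move=> p0 M0 H; have pi0 : 0 < 2 * pi :> R by rewrite mulr_gt0 ?pi_gt0.
apply: ge_ereal_sup => _ [r r01 <-]; move: r01; rewrite /= in_itv /= => /H h.
rewrite /integral_mean.
have -> : M = ((M `^ p) `^ p^-1)%E by rewrite -poweRrM mulfV ?gt_eqF// poweRe1.
apply: ler_poweR; first by rewrite invr_ge0 ltW.
  by rewrite mule_ge0 ?circle_powint_ge0// lee_fin invr_ge0 ltW.
by rewrite lee_pdivrMl.
Qed.

Lemma measurable_radius (g : R -> R) : (forall s, `|s| < 1 -> {for s, continuous g}) ->
  measurable_fun (`[0%R, 1%R[ : set R) g.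
Proof.
move=> cg; have mo : measurable_fun [set` `](-1)%R, (1 : R)[] g.
  apply: open_continuous_measurable_fun; first exact: interval_open.
  by move=> s; rewrite inE /= in_itv /= => s1; apply: cg; rewrite ltr_norml.
apply: measurable_funS mo => //.
by apply: subset_itv; rewrite bnd_simp ?ltrN10// lerN10.
Qed.

Lemma measurable_radial_normc f : holomorphic f ->
  measurable_fun (`[0%R, 1%R[ : set R) (fun s => normc (f s%:C)).
Proof.
move=> hf; apply: measurable_radius => s s1.
apply: (@cvg_normc R _ _ _ (fun s => f s%:C)).
apply: cvg_comp; first exact: ofR_continuous.
by apply: holomorphic_continuous => //; rewrite normc_ofR.
Qed.

(** For the dilate [f (r .)], Cauchy formula bounds the values on the radius by a Hilbert
    transform of the values on the circle of radius [r]; Fatou lets [r] tend to [1]. *)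
Lemma fejer_riesz p : 1 < p -> exists2 c : R, 0 <= c & forall f, holomorphic f ->
  (\int[mu]_(s in `[0%R, 1%R[) (normc (f s%:C) `^ p)%:E <= c%:E * hardy_norm p f `^ p)%E.
Proof.
move=> p1; have p0 : 0 < p by lra.
have pi0 : 0 < 2 * pi :> R by rewrite mulr_gt0 ?pi_gt0.
have [c c0 H] := hilbert_ineq p1 (@circle_scale R) (@radius_scale R).
pose k : R := 3 / (2 * pi).
have k0 : 0 <= k by rewrite divr_ge0// ltW.
exists (c * (k `^ p * (2 * pi))).
  by rewrite mulr_ge0// mulr_ge0 ?powR_ge0// ltW.
move=> f hf.
set M := (_ * _)%E.
have segc (r s : R) : `|s * r| < 1 -> {for s, continuous (fun s => normc (f (s * r)%:C))}.
  move=> sr; apply: (@cvg_normc R _ _ _ (fun s => f (s * r)%:C)).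
  apply: (@cvg_comp _ _ _ (fun s : R => (s * r)%:C : C)); last first.
    by apply: (@holomorphic_continuous f (s * r)%:C) => //; rewrite normc_ofR.
  by apply: cvg_complex; [apply: cvgM; [exact: cvg_id|exact: cvg_cst]|exact: cvg_cst].
have segm (r : R) : 0 <= r <= 1 -> measurable_fun (`[0%R, 1%R[ : set R) (fun s => normc (f (s * r)%:C)).
  move=> r01.
  apply: measurable_radius => s s1; apply: segc.
  rewrite normrM (ger0_norm (proj1 (andP r01))) (le_lt_trans _ s1)// ler_piMr//.
  by case/andP: r01.
have step (r : R) : 0 < r < 1 ->
    (\int[mu]_(s in `[0%R, 1%R[) (normc (f (s * r)%:C) `^ p)%:E <= M)%E.
  move=> /andP[r0 r1].
  pose g t := k * normc (f (circle_point r t)).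
  have gc : continuous g.
    move=> t; apply: cvgM; first exact: cvg_cst.
    by apply: normc_circle_continuous => //; rewrite gtr0_norm.
  have mg : measurable_fun setT g by exact: continuous_measurable_fun.
  have g0 t : 0 <= g t by rewrite mulr_ge0// normc_ge0.
  have mg' : measurable_fun (`]0%R, (2 * pi)%R[ : set R) g by exact: measurable_funS mg.
  have mh : measurable_fun (`[0%R, 1%R[ : set R) (fun s => normc (f (s * r)%:C)).
    by apply: segm; rewrite (ltW r0) (ltW r1).
  apply: (le_trans (H g _ mg' (fun t _ => g0 t) mh (fun s _ => normc_ge0 _) _)).

    move=> s; rewrite /= in_itv /= => /andP[s0 s1].
    have cb := cauchy_bound hf (introT andP (conj r0 r1)) (introT andP (conj s0 s1)).
    have kp t : 0 < 1 - s + chord t by rewrite ltr_wpDr ?chord_ge0// subr_gt0.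
    have cK : continuous (fun t => (3 / (1 - s + chord t)) : R).
      move=> t; apply: cvgM; first exact: cvg_cst.
      apply: cvgV; first by rewrite gt_eqF.
      by apply: cvgD; [exact: cvg_cst|exact: chord_continuous].
    have cG : continuous (fun t => normc (f (circle_point r t)) * (3 / (1 - s + chord t))).
      move=> t; apply: cvgM; last exact: cK.
      by apply: normc_circle_continuous => //; rewrite gtr0_norm.
    have -> : (\int[mu]_(x in `]0%R, (2 * pi)%R[) (g x / (chord x + (1 - s)))%:E =
       (2 * pi)^-1%:E * \int[mu]_(x in `[0%R, (2 * pi)%R]) (normc (f (circle_point r x)) * (3 / (1 - s + chord x)))%:E)%E.
      rewrite integral_circle_open; last exact: continuous_measurable_fun.
      rewrite -ge0_integralZl//.
      - apply: eq_integral => t _; rewrite -EFinM; congr EFin.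
        by rewrite /g /k (addrC (chord t)); move: (2 * pi)^-1 (1 - s + chord t)^-1 => u v; ring.
      - by apply/measurable_EFinP; apply: measurable_funS (continuous_measurable_fun cG).
      - by move=> t _; rewrite lee_fin mulr_ge0 ?normc_ge0// divr_ge0// ltW.
      - by rewrite lee_fin invr_ge0 ltW.
    rewrite integral_segE; last by move=> t _; exact: cG.
    by rewrite -EFinM lee_fin -(ler_pM2l pi0) [leRHS]mulrA mulfV ?gt_eqF// mul1r.
  rewrite /M EFinM -muleA lee_wpmul2l ?lee_fin//.
  have -> : (\int[mu]_(x in `]0%R, (2 * pi)%R[) (g x `^ p)%:E = (k `^ p)%:E * circle_powint p f r)%E.
    have mcc : measurable_fun setT (fun t => normc (f (circle_point r t))).
      by apply: continuous_measurable_fun; apply: normc_circle_continuous => //; rewrite gtr0_norm.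
    rewrite /circle_powint integral_circle_open; last exact: measurable_powR_comp.
    rewrite -ge0_integralZl//.
    - by apply: eq_integral => t _; rewrite -EFinM /g powRM// normc_ge0.
    - by apply/measurable_EFinP/measurable_powR_comp; exact: measurable_funS mcc.
    - by move=> t _; rewrite lee_fin powR_ge0.
    - by rewrite lee_fin powR_ge0.
  by rewrite EFinM -muleA lee_wpmul2l ?lee_fin ?powR_ge0// circle_powint_le// r0.
pose rr (n : nat) : R := 1 - n.+2%:R^-1.
have rr01 n : 0 < rr n < 1.
  by rewrite /rr subr_gt0 invf_lt1// ltr1n /= gtrDl oppr_lt0 invr_gt0.
pose F n s : \bar R := (normc (f (s * rr n)%:C) `^ p)%:E.
have FM n : (\int[mu]_(s in `[0%R, 1%R[) F n s <= M)%E by exact: step.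
have F0 n s : (0 <= F n s)%E by rewrite lee_fin powR_ge0.
have mF n : measurable_fun (`[0%R, 1%R[ : set R) (F n).
  apply/measurable_EFinP; apply: measurable_powR_comp; apply: segm.
  by have /andP[h1 h2] := rr01 n; rewrite !ltW.
have FL : (\int[mu]_(s in `[0%R, 1%R[) (normc (f s%:C) `^ p)%:E =
   \int[mu]_(s in `[0%R, 1%R[) limn_einf (F^~ s))%E.
  apply: eq_integral => s; rewrite inE /= in_itv /= => /andP[s0 s1].
  suff h : F n s @[n --> \oo] --> (normc (f s%:C) `^ p)%:E by rewrite (cvg_limn_einf_sup h).
  apply: cvg_EFin; first by near=> n.
  apply: cvg_powR_nneg => //; first by move=> n; exact: normc_ge0.
  have hr : rr @ \oo --> (1 : R).
    rewrite -[X in _ --> X](subr0 1); apply: cvgB; first exact: cvg_cst.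
    by have h := @cvg_harmonic R; rewrite -(cvg_shiftS (@harmonic R)) in h; exact: h.
  have cs : {for (1 : R), continuous (fun r => normc (f (s * r)%:C))}.
    apply: (@cvg_normc R _ _ _ (fun r => f (s * r)%:C)).
    apply: (@cvg_comp _ _ _ (fun r : R => (s * r)%:C : C)); last first.
      by apply: (@holomorphic_continuous f (s * 1)%:C) => //; rewrite mulr1 normc_ofR ger0_norm.
    by apply: cvg_complex; [apply: cvgM; [exact: cvg_cst|exact: cvg_id]|exact: cvg_cst].
  by have := cvg_comp _ _ hr cs; rewrite mulr1.
rewrite FL; apply: (le_trans (fatou _ _ _ _)) => //.
rewrite limn_einf_lim; apply: lime_le; first exact: is_cvg_einfs.
near=> n; apply: (le_trans _ (FM n)); apply: ereal_inf_lbound.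
by exists n => /=.
Unshelve. all: by end_near. Qed.

Lemma integral01_le (h : R -> C) :
  measurable_fun (`[0%R, 1%R[ : set R) (fun s => complex.Re (h s)) ->
  measurable_fun (`[0%R, 1%R[ : set R) (fun s => complex.Im (h s)) ->
  ((normc (integral01 h))%:E <= 2%:E * \int[mu]_(s in `[0%R, 1%R[) (normc (h s))%:E)%E.
Proof.
move=> mR mI; set I := (\int[mu]_(s in _) _)%E.
have mN : measurable_fun (`[0%R, 1%R[ : set R) (fun s => (normc (h s))).
  rewrite (_ : (fun s => normc (h s)) =
      fun s => Num.sqrt (complex.Re (h s) * complex.Re (h s) + complex.Im (h s) * complex.Im (h s))).
    apply: (measurableT_comp (f := @Num.sqrt R)).
      by apply: continuous_measurable_fun; exact: sqrt_continuous.
    by apply: measurable_funD; exact: measurable_funM.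
  by apply/funext => s; case: (h s) => a b; rewrite /normc /= !expr2.
have part (g : R -> R) : measurable_fun (`[0%R, 1%R[ : set R) g -> (forall s, `|g s| <= normc (h s)) ->
    (`|Rintegral mu `[0%R, 1%R[ g|%:E <= I)%E.
  move=> mg gh; apply: (@le_trans _ _ (`|\int[mu]_(s in `[0%R, 1%R[) (g s)%:E|)%E).
    by rewrite /Rintegral; case: (\int[mu]_(s in _) _)%E => [x| |] //=; rewrite ?normr0 ?leey.
  apply: (le_trans (le_abse_integral _ _ _)) => //; first exact/measurable_EFinP.
  apply: ge0_le_integral => //.
  - by apply: measurableT_comp => //; exact/measurable_EFinP.
  - exact/measurable_EFinP.
  - by move=> s _; rewrite lee_fin.
apply: (@le_trans _ _ (`|Rintegral mu `[0%R, 1%R[ (fun s => complex.Re (h s))|%:E +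
   `|Rintegral mu `[0%R, 1%R[ (fun s => complex.Im (h s))|%:E)%E).
  by rewrite -EFinD lee_fin; exact: (normc_le_ReIm (_ +i* _)).
have -> : (2%:E * I = I + I)%E by rewrite mule_natl mule2n.
apply: leeD; apply: part => // s; [exact: Re_le_normc|exact: Im_le_normc].
Qed.

Lemma T_integrand_continuous phi f z s : holomorphic phi -> holomorphic f ->
  normc z <= 1 -> `|s| < 1 ->
  (fun s : R => f s%:C * phi (s%:C * z) : C) @ s --> (f s%:C * phi (s%:C * z) : C).
Proof.
move=> hphi hf z1 s1; apply: cvgM.
  apply: cvg_comp; first exact: ofR_continuous.
  by apply: holomorphic_continuous => //; rewrite normc_ofR.
apply: (@cvg_comp _ _ _ (fun s : R => s%:C * z : C)).
  apply: cvgM; first exact: ofR_continuous.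
  exact: cvg_cst.
apply: (@holomorphic_continuous phi (s%:C * z)) => //.
rewrite normcM normc_ofR (le_lt_trans _ s1)// ler_piMr//.
Qed.

(** On circles, [T phi f] is dominated by a Hilbert transform of [|f|] on the radius. *)
Lemma T_circle_bound phi f A r t : holomorphic phi -> holomorphic f -> 0 < r < 1 ->
  (forall z, normc z < 1 -> normc (phi z) <= A / normc (1 - z)) ->
  ((normc (T_ phi f (circle_point r t)))%:E <=
   \int[mu]_(s in `[0%R, 1%R[) ((6 * A) * normc (f s%:C) / ((1 - s) + chord t))%:E)%E.
Proof.
move=> hphi hf /andP[r0 r1] hA.
have z1 : normc (circle_point r t : R[i]) <= 1 by rewrite normc_circle_point gtr0_norm// ltW.
have ct s := @T_integrand_continuous phi f (circle_point r t) s hphi hf z1.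
apply: (le_trans (integral01_le _ _)).
- apply: measurable_radius => s s1; exact: (cvg_Re (ct s s1)).
- apply: measurable_radius => s s1; exact: (cvg_Im (ct s s1)).
have A0 : 0 <= A.
  have := hA 0; rewrite normc0 subr0 normc1 divr1 => /(_ ltr01).
  exact/le_trans/normc_ge0.
have kp s : 0 <= s < 1 -> 0 < 1 - s + chord t.
  by move=> /andP[s0 s1]; rewrite ltr_wpDr ?chord_ge0// subr_gt0.
have mL : measurable_fun (`[0%R, 1%R[ : set R)
    (fun s => normc (f s%:C * phi (s%:C * circle_point r t))).
  by apply: measurable_radius => s s1; exact: (cvg_normc (ct s s1)).
rewrite -ge0_integralZl//; last 2 first.
- exact/measurable_EFinP.
- by move=> s _; rewrite lee_fin normc_ge0.
apply: ge0_le_integral => //.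
- by move=> s _; rewrite -EFinM lee_fin mulr_ge0// normc_ge0.
- by apply: emeasurable_funM => //; exact/measurable_EFinP.
- apply/measurable_EFinP; apply: measurable_radius => s s1.
  have s1' : s < 1 by apply: le_lt_trans s1; exact: ler_norm.
  apply: cvgM.
    apply: cvgM; first exact: cvg_cst.
    apply: (@cvg_normc R _ _ _ (fun s => f s%:C)).
    apply: cvg_comp; first exact: ofR_continuous.
    by apply: holomorphic_continuous => //; rewrite normc_ofR.
  apply: cvgV; first by rewrite gt_eqF// ltr_wpDr ?chord_ge0// subr_gt0.
  by apply: cvgD; [apply: cvgB; [exact: cvg_cst|exact: cvg_id]|exact: cvg_cst].
move=> s; rewrite /= in_itv /= => s01; have /andP[s0 s1] := s01.
rewrite -EFinM lee_fin normcM.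
have zs : normc (s%:C * circle_point r t) < 1.
  rewrite circle_pointM normc_circle_point ger0_norm ?mulr_ge0 ?(ltW r0)//.
  by rewrite mulr_ilt1 ?(ltW r0).
have hphi1 := hA _ zs.
have ker : 1 - s + chord t <= 3 * normc (1 - s%:C * circle_point r t).
  rewrite circle_pointM; have sr : s * r <= s by rewrite ler_piMr// ltW.
  have sr0 : 0 <= s * r by rewrite mulr_ge0// ltW.
  have := @cauchy_kernel_lower R (s * r) t; rewrite sr0 /= => h.
  have : s * r <= 1 by lra.
  move=> /h; lra.
have k0 := kp _ s01.
have d0 : 0 < normc (1 - s%:C * circle_point r t) by lra.
have : normc (phi (s%:C * circle_point r t)) <= 3 * A / (1 - s + chord t).
  apply: (le_trans hphi1); rewrite ler_pdivrMr// mulrAC ler_pdivlMr//.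
  by rewrite [leRHS]mulrAC [leRHS]mulrC ler_wpM2l.
have := normc_ge0 (f s%:C).
move: (normc (f s%:C)) (normc (phi _)) => F P F0 hP.
have -> : 6 * A * F / (1 - s + chord t) = 2 * (F * (3 * A / (1 - s + chord t))) by ring.
by rewrite !ler_wpM2l.
Qed.

(** Hilbert inequality from the radius to the circle, followed by Fejer-Riesz. *)
Lemma T_bounded phi p A : 1 < p -> holomorphic phi ->
  (forall z, normc z < 1 -> normc (phi z) <= A / normc (1 - z)) ->
  (forall f, hardy p f -> holomorphic (T_ phi f)) ->
  hardy_bounded p (T_ phi).
Proof.
move=> p1 hphi hA hT; have p0 : 0 < p by lra.
have pi0 : 0 < 2 * pi :> R by rewrite mulr_gt0 ?pi_gt0.
have A0 : 0 <= A.
  have := hA 0; rewrite normc0 subr0 normc1 divr1 => /(_ ltr01).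
  exact/le_trans/normc_ge0.
have [c1 c10 H] := hilbert_ineq p1 (@radius_scale R) (@circle_scale R).
have [c2 c20 FR] := fejer_riesz p1.
pose B := (c1 * ((6 * A) `^ p * c2)) / (2 * pi).
have B0 : 0 <= B by rewrite divr_ge0 ?(ltW pi0)// mulr_ge0// mulr_ge0 ?powR_ge0.
have main f : hardy p f -> (hardy_norm p (T_ phi f) <= (B `^ p^-1)%:E * hardy_norm p f)%E.
  move=> [hf fp]; apply: hardy_norm_le => //.
    by rewrite mule_ge0 ?hardy_norm_ge0// lee_fin powR_ge0.
  move=> r r01.
  have r1 : `|r| < 1 by rewrite gtr0_norm; case/andP: r01.
  have cT : continuous (fun t => normc (T_ phi f (circle_point r t))).
    exact: (normc_circle_continuous (hT f (conj hf fp)) r1).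
  have mT : measurable_fun setT (fun t => normc (T_ phi f (circle_point r t))).
    exact: continuous_measurable_fun.
  have mf := measurable_radial_normc hf.
  rewrite /circle_powint integral_circle_open; last exact: measurable_powR_comp.
  have mg : measurable_fun (`[0%R, 1%R[ : set R) (fun s => 6 * A * normc (f s%:C)).
    exact: measurable_funM.
  have g0 (s : R) : [set` `[0%R, (1 : R)[] s -> 0 <= 6 * A * normc (f s%:C).
    by move=> _; rewrite mulr_ge0 ?normc_ge0// mulr_ge0.
  have mT' : measurable_fun (`]0%R, (2 * pi)%R[ : set R) (fun t => normc (T_ phi f (circle_point r t))).
    exact: measurable_funS mT.
  apply: (le_trans (H _ _ mg g0 mT' (fun t _ => normc_ge0 _)
    (fun t _ => T_circle_bound t hphi hf r01 hA))).
  have -> : (\int[mu]_(s in `[0%R, 1%R[) ((6 * A * normc (f s%:C)) `^ p)%:E =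
     ((6 * A) `^ p)%:E * \int[mu]_(s in `[0%R, 1%R[) (normc (f s%:C) `^ p)%:E)%E.
    rewrite -ge0_integralZl//.
    - by apply: eq_integral => s _; rewrite -EFinM powRM ?normc_ge0// mulr_ge0.
    - by apply/measurable_EFinP; exact: measurable_powR_comp.
    - by move=> s _; rewrite lee_fin powR_ge0.
    - by rewrite lee_fin powR_ge0.
  rewrite poweRM ?hardy_norm_ge0// ?lee_fin ?powR_ge0//.
  rewrite poweR_EFin -powRrM mulVf ?gt_eqF// powRr1//.
  rewrite [leRHS]muleA -(EFinM (2 * pi)) (_ : 2 * pi * B = c1 * ((6 * A) `^ p * c2)); last first.
    by rewrite /B mulrC divfK// gt_eqF.
  rewrite EFinM -muleA lee_wpmul2l ?lee_fin// EFinM -muleA lee_wpmul2l ?lee_fin ?powR_ge0//.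
  exact: FR.
split; last by exists (B `^ p^-1).
move=> f hf; split; first exact: hT.
apply: (le_lt_trans (main f hf)).
case: hf => _ fp; have h0 := hardy_norm_ge0 p f.
have -> : hardy_norm p f = (fine (hardy_norm p f))%:E by rewrite fineK// ge0_fin_numE.
by rewrite -EFinM ltey.
Qed.

End hardy_space.

(** * Power series with real coefficients *)

Section real_power_series.
Context {R : realType}.
Local Notation C := (R[i]^o).
Implicit Types (c : nat -> R) (q r : R) (z w h : R[i]).

Definition csum (u : nat -> R[i]) : R[i] :=
  limn (series (fun n => complex.Re (u n))) +i* limn (series (fun n => complex.Im (u n))).

Lemma Re_sum n (u : nat -> R[i]) :
  complex.Re (\sum_(0 <= k < n) u k) = \sum_(0 <= k < n) complex.Re (u k).
Proof. by elim/big_rec2 : _ => // i x y _ <-; rewrite ReD. Qed.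

Lemma Im_sum n (u : nat -> R[i]) :
  complex.Im (\sum_(0 <= k < n) u k) = \sum_(0 <= k < n) complex.Im (u k).
Proof. by elim/big_rec2 : _ => // i x y _ <-; rewrite ImD. Qed.

Lemma csum_cvg (u : nat -> R[i]) : cvgn (series (fun n => normc (u n))) ->
  (fun n => \sum_(0 <= k < n) u k : C) @ \oo --> (csum u : C).
Proof.
move=> cu.
have part (g : nat -> R) : (forall n, `|g n| <= normc (u n)) -> series g @ \oo --> limn (series g).
  move=> hg; apply: normed_cvg; apply: series_le_cvg cu => n.
  - exact: normr_ge0.
  - exact: normc_ge0.
  - exact: hg.
rewrite (_ : (fun n => _) = fun n => (series (fun n => complex.Re (u n)) n +i*
    series (fun n => complex.Im (u n)) n)).
  by apply: cvg_complex; apply: part => n; [exact: Re_le_normc|exact: Im_le_normc].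
by apply/funext => n; rewrite /series /= -Re_sum -Im_sum; case: (\sum_(_ <= _ < _) _).
Qed.

Lemma normc_lim_le (u : nat -> C) (l : C) (M : R) : u @ \oo --> l ->
  (forall n, normc (u n) <= M) -> normc l <= M.
Proof.
move=> ul uM; have nl : (fun n => normc (u n)) @ \oo --> normc l by exact: cvg_normc.
rewrite -(cvg_lim _ nl)//; apply: limr_le; first by apply/cvg_ex; exists (normc l).
by near=> n; exact: uM.
Unshelve. all: by end_near. Qed.

Lemma natmul_geometric_bounded q : 0 < q < 1 -> exists M, forall n, n%:R * q ^+ n <= M.
Proof.
move=> /andP[q0 q1]; pose d := q^-1 - 1.
have d0 : 0 < d by rewrite subr_gt0 invf_gt1.
exists d^-1 => n.
have bern : n%:R * d <= (1 + d) ^+ n.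
  elim: n => [|n ih]; first by rewrite mul0r exprn_ge0// addr_ge0// ltW.
  rewrite exprS mulrDl mul1r -natr1 mulrDl mul1r lerD//.
  rewrite -[leLHS]mulr1 ler_pM2l//.
  by rewrite exprn_ege1// lerDl ltW.
have qd : 1 + d = q^-1 by rewrite /d; ring.
rewrite -(ler_pM2r d0) mulVf ?gt_eqF// mulrAC.
have qn : 0 < q ^+ n by exact: exprn_gt0.
by rewrite -(ler_pM2r (_ : 0 < q ^- n)) ?invr_gt0// mulfK ?gt_eqF// mul1r -exprVn -qd.
Qed.

(** The coefficient sequences of power series that converge in the unit disc. *)
Definition tame c := forall q, 0 < q < 1 -> exists M, forall n, `|c n| * q ^+ n <= M.

(** Half of the decay of [q ^+ n] absorbs the coefficients, the other half is summable. *)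
Lemma sqrt_split q : 0 < q < 1 -> exists2 r, 0 < r < 1 & forall n, q ^+ n = r ^+ n * r ^+ n.
Proof.
move=> /andP[q0 q1]; exists (Num.sqrt q).
  by rewrite sqrtr_gt0 q0 /= -sqrtr1 ltr_sqrt.
by move=> n; rewrite -exprMn -expr2 sqr_sqrtr// ltW.
Qed.

Lemma tame_natmul c : tame c -> tame (fun n => n%:R * c n).
Proof.
move=> tc q /sqrt_split[r r01 qr].
have [M HM] := tc r r01; have [M' HM'] := natmul_geometric_bounded r01.
exists (M' * M) => n; rewrite normrM normr_nat qr mulrACA.
have r0 : 0 <= r ^+ n by rewrite exprn_ge0//; case/andP: r01 => /ltW.
by rewrite ler_pM// mulr_ge0.
Qed.

Lemma tame_shift c : tame c -> tame (fun n => c n.+1).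
Proof.
move=> tc q /[dup] q01 /andP[q0 _]; have [M HM] := tc q q01.
by exists (M / q) => n; rewrite ler_pdivlMr// -mulrA -exprSr.
Qed.

(** The coefficients of the derived series. *)
Definition dcoef c n := n.+1%:R * c n.+1.

Lemma tame_dcoef c : tame c -> tame (dcoef c).
Proof. by move=> tc; exact: (tame_shift (tame_natmul tc)). Qed.

Lemma tame_summable c q : tame c -> 0 < q < 1 -> cvgn (series (fun n => `|c n| * q ^+ n)).
Proof.
move=> tc /sqrt_split[r /[dup] r01 /andP[r0 r1] qr]; have [M HM] := tc r r01.
have rn n : 0 <= r ^+ n by rewrite exprn_ge0// ltW.
apply: (@series_le_cvg _ _ (fun n => M * r ^+ n)) => [n|n|n|].
- by rewrite mulr_ge0// qr mulr_ge0.
- by rewrite mulr_ge0// (le_trans _ (HM 0%N))// mulr_ge0.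
- by rewrite qr mulrA ler_wpM2r.
- by apply: is_cvg_geometric_series; rewrite ger0_norm// ltW.
Qed.

Definition power_series c z : R[i] := csum (fun n => (c n)%:C * z ^+ n).

Lemma ps_summable c z : tame c -> normc z < 1 ->
  cvgn (series (fun n => normc ((c n)%:C * z ^+ n))).
Proof.
move=> tc z1; pose q := (1 + normc z) / 2.
have z0 := normc_ge0 z.
have q01 : 0 < q < 1 by rewrite /q; apply/andP; split; lra.
apply: series_le_cvg (tame_summable tc q01) => n.
- exact: normc_ge0.
- by rewrite mulr_ge0// exprn_ge0//; case/andP: q01 => /ltW.
- by rewrite normcM normc_ofR normcX ler_wpM2l// lerXn2r ?nnegrE//; rewrite /q; lra.
Qed.

Lemma ps_cvg c z : tame c -> normc z < 1 ->
  (fun n => \sum_(0 <= k < n) (c k)%:C * z ^+ k : C) @ \oo --> (power_series c z : C).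
Proof. by move=> tc z1; apply: csum_cvg; exact: ps_summable. Qed.

(** The second-order Taylor remainder of a power, by induction from
    [(w + h)^(n+2) = (w + h) (w + h)^(n+1)]; the factor [q ^+ 2] avoids negative powers of [q]. *)
Lemma power_remainder w h q n : 0 < q -> normc w <= q -> normc (w + h) <= q ->
  q ^+ 2 * normc ((w + h) ^+ n.+1 - w ^+ n.+1 - n.+1%:R * w ^+ n * h) <=
    n.+1%:R ^+ 2 * q ^+ n.+1 * normc h ^+ 2.
Proof.
move=> q0 wq whq; elim: n => [|n ih].
  rewrite !expr1 expr0 mulr1 mul1r.
  have -> : w + h - w - h = 0 by ring.
  by rewrite normc0 mulr0 !mulr_ge0 ?exprn_ge0 ?normc_ge0 ?(ltW q0).
have -> : (w + h) ^+ n.+2 - w ^+ n.+2 - n.+2%:R * w ^+ n.+1 * h =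
  (w + h) * ((w + h) ^+ n.+1 - w ^+ n.+1 - n.+1%:R * w ^+ n * h) + n.+1%:R * w ^+ n * h ^+ 2.
  by rewrite !exprS expr0 -[n.+2%:R]natr1; ring.
have h2 : 0 <= normc h ^+ 2 by rewrite exprn_ge0// normc_ge0.
have qn m : 0 <= q ^+ m by rewrite exprn_ge0// ltW.
apply: (@le_trans _ _ (q ^+ 2 * (q * normc ((w + h) ^+ n.+1 - w ^+ n.+1 - n.+1%:R * w ^+ n * h) +
    n.+1%:R * q ^+ n * normc h ^+ 2))).
  rewrite ler_wpM2l// (le_trans (le_normcD _ _))// lerD//.
    by rewrite normcM ler_wpM2r// normc_ge0.
  rewrite normcM normcX ler_wpM2r//.
  have -> : (n.+1%:R : R[i]) = (n.+1%:R : R)%:C by rewrite rmorph_nat.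
  by rewrite normcM normc_ofR normr_nat normcX ler_wpM2l// lerXn2r ?nnegrE ?normc_ge0// ltW.
rewrite mulrDr (mulrCA (q ^+ 2) q).
apply: (@le_trans _ _ (q * (n.+1%:R ^+ 2 * q ^+ n.+1 * normc h ^+ 2) +
    q ^+ 2 * (n.+1%:R * q ^+ n * normc h ^+ 2))).
  by rewrite lerD// ler_wpM2l// ltW.
have -> : q * (n.+1%:R ^+ 2 * q ^+ n.+1 * normc h ^+ 2) +
    q ^+ 2 * (n.+1%:R * q ^+ n * normc h ^+ 2) =
  (n.+1%:R ^+ 2 + n.+1%:R) * (q ^+ n.+2 * normc h ^+ 2) by rewrite !exprS; ring.
rewrite -mulrA; apply: ler_wpM2r; first exact: mulr_ge0.
rewrite -[X in _ <= X ^+ 2]natr1.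
have : 0 <= n.+1%:R :> R by [].
move: (n.+1%:R) => x x0; rewrite sqrrD1; lra.
Qed.

(** A uniform quadratic remainder on each smaller disc. It gives the derivative of the
    series, and later the derivative under the integral sign in [T_holomorphic]. *)
Lemma ps_remainder c q : tame c -> 0 < q < 1 -> exists2 S, 0 <= S & forall w h,
  normc w <= q -> normc (w + h) <= q ->
  normc (power_series c (w + h) - power_series c w - power_series (dcoef c) w * h) <= S * normc h ^+ 2.
Proof.
move=> tc /[dup] q01 /andP[q0 q1].
have t2 := tame_natmul (tame_natmul tc).
have sm := tame_summable t2 q01.
set u := (fun n => _) in sm.
have u0 n : 0 <= u n by rewrite mulr_ge0// exprn_ge0// ltW.
have S0 : 0 <= limn (series u).
  by apply: limr_ge => //; near=> n; rewrite /series /= sumr_ge0.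
exists (limn (series u) / q ^+ 2); first by rewrite divr_ge0// exprn_ge0// ltW.
move=> w h wq whq.
have w1 : normc w < 1 by exact: le_lt_trans q1.
have wh1 : normc (w + h) < 1 by exact: le_lt_trans q1.
pose v n : C := (\sum_(0 <= k < n.+1) (c k)%:C * (w + h) ^+ k : R[i]) -
   (\sum_(0 <= k < n.+1) (c k)%:C * w ^+ k : R[i]) - (\sum_(0 <= k < n) (dcoef c k)%:C * w ^+ k : R[i]) * h.
have vl : v @ \oo --> (power_series c (w + h) - power_series c w - power_series (dcoef c) w * h : C).
  have h1 := ps_cvg tc wh1; have h2 := ps_cvg tc w1; have h3 := ps_cvg (tame_dcoef tc) w1.
  rewrite -(cvg_shiftS (fun n => \sum_(0 <= k < n) (c k)%:C * (w + h) ^+ k : C)) in h1.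
  rewrite -(cvg_shiftS (fun n => \sum_(0 <= k < n) (c k)%:C * w ^+ k : C)) in h2.
  exact: (cvgB (cvgB h1 h2) (cvgM h3 (cvg_cst (h : C)))).
apply: (normc_lim_le vl) => n.
have -> : v n = \sum_(0 <= k < n) (c k.+1)%:C * ((w + h) ^+ k.+1 - w ^+ k.+1 - k.+1%:R * w ^+ k * h).
  rewrite /v !big_nat_recl// !expr0 !mulr1 mulr_suml opprD addrACA subrr add0r -!sumrB.
  apply: eq_bigr => k _; rewrite /dcoef rmorphM rmorph_nat; ring.
apply: (le_trans (normc_sum _ _ _)).
rewrite mulrAC ler_pdivlMr ?exprn_gt0// mulr_suml.
apply: (@le_trans _ _ (\sum_(0 <= k < n) u k.+1 * normc h ^+ 2)).
  apply: ler_sum => k _; rewrite normcM normc_ofR mulrAC -mulrA.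
  have := power_remainder k q0 wq whq; rewrite [q ^+ 2 * _]mulrC => H.
  apply: (le_trans (ler_wpM2l (normr_ge0 (c k.+1)) H)).
  by rewrite /u !normrM normr_nat expr2 le_eqVlt; apply/orP; left; apply/eqP; ring.
rewrite -mulr_suml ler_wpM2r ?exprn_ge0 ?normc_ge0//.
apply: (@le_trans _ _ (series u n.+1)).
  by rewrite /series /= [leRHS]big_nat_recl// lerDr.
apply: nondecreasing_cvgn_le => //.
apply/nondecreasing_seqP => m; rewrite /series /= [leRHS]big_nat_recr//= lerDl.
exact: u0.
Unshelve. all: by end_near. Qed.

Lemma ps_derive c z : tame c -> normc z < 1 ->
  derivable (power_series c : C -> C) z 1 /\ derive1 (power_series c : C -> C) z = power_series (dcoef c) z.
Proof.
move=> tc z1; apply: is_derive_normc => e e0.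
pose q := (1 + normc z) / 2.
have z0 := normc_ge0 z.
have [q01 zq] : 0 < q < 1 /\ normc z < q by rewrite /q; split; [apply/andP; split|]; lra.
have [S S0 HS] := ps_remainder tc q01.
exists (Num.min (q - normc z) (e / (S + 1))).
  by rewrite lt_min subr_gt0 zq divr_gt0// ltr_wpDl.
move=> h; rewrite lt_min => /andP[hq he].
apply: (le_trans (HS _ _ (ltW zq) _)).
  by rewrite (le_trans (le_normcD _ _))//; lra.
rewrite expr2 mulrA ler_wpM2r ?normc_ge0//.
rewrite ltr_pdivlMr ?ltr_wpDl// in he.
have := normc_ge0 h; move: (normc h) he => x he x0.
by apply: le_trans (ltW he); rewrite mulrC ler_wpM2l// lerDl.
Qed.

Lemma ps_holomorphic c : tame c -> holomorphic (power_series c : C -> C).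
Proof. by move=> tc z /unit_discE z1; have [] := ps_derive tc z1. Qed.

Lemma ps0 c : tame c -> power_series c 0 = (c 0%N)%:C.
Proof.
move=> tc; have h : normc 0 < 1 :> R by rewrite normc0.
have h2 : (fun n => \sum_(0 <= k < n) (c k)%:C * 0 ^+ k : C) @ \oo --> ((c 0%N)%:C : C).
  apply: (@cvg_trans _ (cst ((c 0%N)%:C : C) @ \oo)); last exact: cvg_cst.
  apply: near_eq_cvg; exists 1%N => // -[//|n] _.
  rewrite /= big_nat_recl// expr0 mulr1 big1 ?addr0// => k _.
  by rewrite exprS mul0r mulr0.
exact: (cvg_unique (@norm_hausdorff _ C) (ps_cvg tc h) h2).
Qed.

Lemma derive1n_ps c n z : tame c -> normc z < 1 ->
  derive1n n (power_series c : C -> C) z = power_series (iter n dcoef c) z.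
Proof.
move=> tc; have ti m : tame (iter m dcoef c) by elim: m => //= m; exact: tame_dcoef.
elim: n z => [//|n ih] z z1.
rewrite derive1nS derive1E.
rewrite (@near_eq_derive _ C C _ (power_series (iter n dcoef c) : C -> C)).
  by rewrite -derive1E iterS; have [_ ->] := ps_derive (ti n) z1.
exists (1 - normc z)%:C; first by rewrite /= ltcR subr_gt0.
move=> w; rewrite /ball /= normcR ltcR => zw; apply: ih.
by have := ler_normcB w z; rewrite normcB; lra.
Qed.

Lemma iter_dcoef c n k : iter n dcoef c k * k`!%:R = (k + n)`!%:R * c (k + n)%N.
Proof.
elim: n k => [|n ih] k; first by rewrite addn0 mulrC.
rewrite iterS /dcoef addnS -addSn -ih factS natrM; ring.
Qed.

Lemma taylor_ps c n : tame c -> taylor (power_series c : C -> C) n = (c n)%:C.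
Proof.
move=> tc; have ti m : tame (iter m dcoef c) by elim: m => //= m; exact: tame_dcoef.
rewrite /taylor derive1n_ps ?normc0// ps0//.
have := iter_dcoef c n 0; rewrite fact0 mulr1 add0n => ->.
rewrite rmorphM rmorph_nat mulrAC mulfV ?mul1r// pnatr_eq0 -lt0n; exact: fact_gt0.
Qed.

End real_power_series.

(** * Holomorphy of T f *)

Section T_holomorphic.
Context {R : realType}.
Local Notation C := (R[i]^o).
Local Notation mu := (@lebesgue_measure R).
Local Notation I01 := ([set` `[0%R, (1%R : R)[]).
Implicit Types (c : nat -> R) (q r s : R) (z w h : R[i]) (u v : R -> C).

Lemma ps_bound c q : tame c -> 0 < q < 1 -> exists2 M, 0 <= M & forall w, normc w <= q -> normc (power_series c w) <= M.
Proof.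
move=> tc /[dup] q01 /andP[q0 q1]; have sm := tame_summable tc q01.
set x := (fun n => _) in sm.
have x0 n : 0 <= x n by rewrite mulr_ge0// exprn_ge0// ltW.
have le n : \sum_(0 <= k < n) x k <= limn (series x).
  apply: nondecreasing_cvgn_le => //.
  by apply/nondecreasing_seqP => m; rewrite /series /= [leRHS]big_nat_recr//= lerDl.
exists (limn (series x)).
  by apply: le_trans (le 0%N); rewrite big_nil.
move=> w wq; apply: (normc_lim_le (ps_cvg tc (le_lt_trans wq q1))) => n.
apply: (le_trans (normc_sum _ _ _)); apply: le_trans (le n).
apply: ler_sum => k _; rewrite normcM normc_ofR normcX ler_wpM2l//.
by rewrite lerXn2r ?nnegrE ?normc_ge0// ltW.
Qed.

(** The integrability under which [integral01] is linear. *)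
Definition int01 u := mu.-integrable I01 (EFin \o (fun s => complex.Re (u s))) /\
  mu.-integrable I01 (EFin \o (fun s => complex.Im (u s))).

Lemma int01_dominated u (g : R -> R) : mu.-integrable I01 (EFin \o g) ->
  (forall s, `|s| < 1 -> u @ s --> u s) -> (forall s, 0 <= s < 1 -> normc (u s) <= g s) -> int01 u.
Proof.
move=> ig cu ug; split; apply: (le_integrable _ _ _ ig) => //.
- apply/measurable_EFinP; apply: measurable_radius => s s1; exact: (cvg_Re (cu s s1)).
- move=> s; rewrite /= in_itv /= => /ug h; rewrite lee_fin (le_trans (Re_le_normc _))//.
  by rewrite (le_trans h)// ler_norm.
- apply/measurable_EFinP; apply: measurable_radius => s s1; exact: (cvg_Im (cu s s1)).
- move=> s; rewrite /= in_itv /= => /ug h; rewrite lee_fin (le_trans (Im_le_normc _))//.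
  by rewrite (le_trans h)// ler_norm.
Qed.

Lemma integral01B u v : int01 u -> int01 v ->
  integral01 (fun s => (u s : R[i]) - v s) = integral01 u - integral01 v.
Proof.
move=> [u1 u2] [v1 v2]; rewrite /integral01.
have -> : (fun s => complex.Re ((u s : R[i]) - v s)) = fun s => complex.Re (u s) - complex.Re (v s).
  by apply/funext => s; rewrite ReB.
have -> : (fun s => complex.Im ((u s : R[i]) - v s)) = fun s => complex.Im (u s) - complex.Im (v s).
  by apply/funext => s; rewrite ImB.
by rewrite RintegralB// RintegralB.
Qed.

Lemma integrable01_mulr (g : R -> R) (k : R) : mu.-integrable I01 (EFin \o g) ->
  mu.-integrable I01 (EFin \o (fun s => g s * k)).
Proof.
move=> ig; have := integrableZr _ k ig; rewrite /= => H.
by apply: eq_integrable (H _) => // s _; rewrite /= EFinM.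
Qed.

Lemma Re_mulr u (a b : R) : (fun s => complex.Re ((u s : R[i]) * (a +i* b))) =
  fun s => complex.Re (u s) * a - complex.Im (u s) * b.
Proof. by apply/funext => s; case: (u s). Qed.

Lemma Im_mulr u (a b : R) : (fun s => complex.Im ((u s : R[i]) * (a +i* b))) =
  fun s => complex.Re (u s) * b + complex.Im (u s) * a.
Proof. by apply/funext => s; case: (u s). Qed.

Lemma int01Z u h : int01 u -> int01 (fun s => (u s : R[i]) * h).
Proof.
case: h => a b [u1 u2]; split; rewrite ?Re_mulr ?Im_mulr.
  have := integrableB _ (integrable01_mulr a u1) (integrable01_mulr b u2) => /(_ (measurable_itv _)) H.
  by apply: eq_integrable H => // s _; rewrite /= EFinB.
have := integrableD _ (integrable01_mulr b u1) (integrable01_mulr a u2) => /(_ (measurable_itv _)) H.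
by apply: eq_integrable H => // s _; rewrite /= EFinD.
Qed.

Lemma integral01Z u h : int01 u -> integral01 (fun s => (u s : R[i]) * h) = integral01 u * h.
Proof.
case: h => a b [u1 u2]; rewrite /integral01 Re_mulr Im_mulr.
rewrite RintegralB ?RintegralD//; try exact: integrable01_mulr.
by rewrite !RintegralZr//; simpc.
Qed.

Lemma hardy_radius_powR_integrable p (f : C -> C) : 1 < p -> hardy p f ->
  mu.-integrable I01 (EFin \o (fun s => normc (f s%:C) `^ p)).
Proof.
move=> p1 [hf fp]; have [c c0 FR] := fejer_riesz p1.
have mf := measurable_radial_normc hf.
apply/integrableP; split; first by apply/measurable_EFinP; exact: measurable_powR_comp.
apply: (@le_lt_trans _ _ (c%:E * hardy_norm p f `^ p)%E).
  apply: le_trans (FR f hf); rewrite le_eqVlt; apply/orP; left; apply/eqP.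
  by apply: eq_integral => s _; rewrite /= ger0_norm ?powR_ge0.
have h0 := hardy_norm_ge0 p f.
have -> : hardy_norm p f = (fine (hardy_norm p f))%:E by rewrite fineK// ge0_fin_numE.
by rewrite poweR_EFin -EFinM ltey.
Qed.

(** By Fejer-Riesz, as [x <= 1 + x^p] on a set of finite measure. *)
Lemma hardy_radius_integrable p (f : C -> C) : 1 < p -> hardy p f ->
  mu.-integrable I01 (EFin \o (fun s => normc (f s%:C))).
Proof.
move=> p1 hpf; have ip := hardy_radius_powR_integrable p1 hpf.
have mf := measurable_radial_normc (proj1 hpf).
have i1 : mu.-integrable I01 (EFin \o (fun=> 1 : R)).
  apply: (@integrableS _ _ _ mu [set` `[0%R, (1%R : R)]]) => //.
    by apply: subset_itvl; rewrite bnd_simp.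
  apply: continuous_compact_integrable; first exact: segment_compact.
  by apply: continuous_subspaceT => x; exact: cvg_cst.
have ig : mu.-integrable I01 (EFin \o (fun s => 1 + normc (f s%:C) `^ p)).
  have := integrableD _ i1 ip => /(_ (measurable_itv _)) H.
  by apply: eq_integrable H => // s _; rewrite /= EFinD.
apply: (le_integrable _ _ _ ig) => //; first exact/measurable_EFinP.
move=> s _; rewrite lee_fin [leLHS]ger0_norm ?normc_ge0// ger0_norm ?addr_ge0 ?powR_ge0//.
have n0 := normc_ge0 (f s%:C); move: (normc _) n0 => x x0.
have [x1|x1] := leP x 1; first by rewrite (le_trans x1)// lerDl powR_ge0.
by rewrite (@le_trans _ _ (x `^ p)) ?lerDr// le1r_powR// ltW.
Qed.

(** Differentiation under the integral sign: the remainder of the symbol is quadratic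
    in [h], uniformly in [s], and [f] is integrable on the radius. *)
Lemma T_holomorphic p c (f : C -> C) : 1 < p -> tame c -> hardy p f -> holomorphic (T_ (power_series c) f).
Proof.
move=> p1 tc hpf z /unit_discE z1; have [hf _] := hpf.
have If := hardy_radius_integrable p1 hpf.
pose q := (1 + normc z) / 2.
have z0 := normc_ge0 z.
have [q01 zq] : 0 < q < 1 /\ normc z < q by rewrite /q; split; [apply/andP; split|]; lra.
have /andP[q0 q1] := q01.
have [S S0 HS] := ps_remainder tc q01.
have hps := ps_holomorphic tc; have hdps := ps_holomorphic (tame_dcoef tc).
have intT a w : tame a -> normc w <= q -> int01 (fun s => f s%:C * power_series a (s%:C * w) : C).
  move=> ta wq; have [M M0 HM] := ps_bound ta q01.
  apply: (@int01_dominated _ (fun s => normc (f s%:C) * M)).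
  - exact: integrable01_mulr.
  - move=> s s1.
    exact: (@T_integrand_continuous R (power_series a) f w s (ps_holomorphic ta) hf (ltW (le_lt_trans wq q1)) s1).
  - move=> s /andP[s0 s1]; rewrite normcM ler_wpM2l ?normc_ge0//; apply: HM.
    by rewrite normcM normc_ofR ger0_norm// (le_trans _ wq)// ler_piMl ?normc_ge0// ltW.
pose L : C := integral01 (fun s => f s%:C * power_series (dcoef c) (s%:C * z) * s%:C : C).
have intL : int01 (fun s => f s%:C * power_series (dcoef c) (s%:C * z) * s%:C : C).
  have [M M0 HM] := ps_bound (tame_dcoef tc) q01.
  apply: (@int01_dominated _ (fun s => normc (f s%:C) * M)).
  - exact: integrable01_mulr.
  - move=> s s1.
    exact: (cvgM (@T_integrand_continuous R (power_series (dcoef c)) f z s hdps hf (ltW z1) s1) (@ofR_continuous R s)).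
  - move=> s /andP[s0 s1]; rewrite normcM normcM normc_ofR ger0_norm//.
    rewrite (@le_trans _ _ (normc (f s%:C) * normc (power_series (dcoef c) (s%:C * z))))//.
      by rewrite ler_piMr ?mulr_ge0 ?normc_ge0// ltW.
    rewrite ler_wpM2l ?normc_ge0//; apply: HM.
    by rewrite normcM normc_ofR ger0_norm// (le_trans _ (ltW zq))// ler_piMl ?normc_ge0// ltW.
suff [] : derivable (T_ (power_series c) f) z 1 /\ derive1 (T_ (power_series c) f) z = L by [].
apply: is_derive_normc => e e0.
pose F := fine (\int[mu]_(s in I01) (normc (f s%:C))%:E)%E.
have FE : (\int[mu]_(s in I01) (normc (f s%:C))%:E)%E = F%:E.
  by rewrite /F fineK//; apply: integrable_fin_num.
have F0 : 0 <= F by apply: fine_ge0; apply: integral_ge0 => s _; rewrite lee_fin normc_ge0.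
have K0 : 0 <= 2 * S * F by rewrite !mulr_ge0.
exists (Num.min (q - normc z) (e / (2 * S * F + 1))).
  by rewrite lt_min subr_gt0 zq divr_gt0// ltr_wpDl.
move=> h; rewrite lt_min => /andP[hq he].
have zhq : normc (z + h) <= q by rewrite (le_trans (le_normcD _ _))//; lra.
have -> : (T_ (power_series c) f (z + h) : R[i]) - T_ (power_series c) f z - L * h =
    integral01 (fun s => f s%:C * (power_series c (s%:C * z + s%:C * h) - power_series c (s%:C * z) -
       power_series (dcoef c) (s%:C * z) * (s%:C * h)) : C).
  rewrite /L -integral01Z//.
  rewrite /T_ -integral01B; [|exact: intT|by apply: intT => //; exact: ltW].
  rewrite -integral01B//; last 2 first.
  - have [u1 u2] := intT c (z + h) tc zhq; have [v1 v2] := intT c z tc (ltW zq).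
    split.
      have := integrableB _ u1 v1 => /(_ (measurable_itv _)) H.
      by apply: eq_integrable H => // s _; rewrite /= ReB EFinB.
    have := integrableB _ u2 v2 => /(_ (measurable_itv _)) H.
    by apply: eq_integrable H => // s _; rewrite /= ImB EFinB.
  - exact: int01Z.
  congr integral01; apply/funext => s; rewrite mulrDr; ring.
pose G s : C := f s%:C * (power_series c (s%:C * z + s%:C * h) - power_series c (s%:C * z) -
       power_series (dcoef c) (s%:C * z) * (s%:C * h)).
have GE s : 0 <= s < 1 -> normc (G s) <= normc (f s%:C) * (S * normc h ^+ 2).
  move=> /andP[s0 s1]; rewrite normcM ler_wpM2l ?normc_ge0//.
  have sle w : normc (s%:C * w) <= normc w.
    by rewrite normcM normc_ofR ger0_norm// ler_piMl ?normc_ge0// ltW.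
  apply: (le_trans (HS _ _ _ _)).
  - by rewrite (le_trans (sle _))// ltW.
  - by rewrite -mulrDr (le_trans (sle _)).
  - by rewrite ler_wpM2l// lerXn2r ?nnegrE ?normc_ge0.
have cG s : `|s| < 1 -> G @ s --> G s.
  move=> s1; have zh1 : normc (z + h) <= 1 by rewrite (le_trans zhq)// ltW.
  have z1' : normc z <= 1 by exact: ltW.
  have c1 := @T_integrand_continuous R (power_series c) f (z + h) s hps hf zh1 s1.
  have c2 := @T_integrand_continuous R (power_series c) f z s hps hf z1' s1.
  have c3 := @T_integrand_continuous R (power_series (dcoef c)) f z s hdps hf z1' s1.
  have c5 : (fun s : R => s%:C * h : C) @ s --> (s%:C * h : C).
    exact: (cvgM (@ofR_continuous R s) (cvg_cst (h : C))).
  have c4 : (fun s : R => f s%:C * power_series (dcoef c) (s%:C * z) * (s%:C * h) : C) @ s -->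
      (f s%:C * power_series (dcoef c) (s%:C * z) * (s%:C * h) : C) by exact: (cvgM c3 c5).
  have GE2 : G = fun s => f s%:C * power_series c (s%:C * (z + h)) - f s%:C * power_series c (s%:C * z) -
      f s%:C * power_series (dcoef c) (s%:C * z) * (s%:C * h) : C.
    by apply/funext => x; rewrite /G (mulrDr x%:C) 2!mulrBr (mulrA (f _)).
  rewrite GE2; exact: (cvgB (cvgB c1 c2) c4).
have := @integral01_le R G; rewrite -/G => H.
have {}H : ((normc (integral01 G))%:E <= 2%:E * \int[mu]_(s in I01) (normc (G s))%:E)%E.
  by apply: H; apply: measurable_radius => s s1; [exact: (cvg_Re (cG s s1))|exact: (cvg_Im (cG s s1))].
rewrite -lee_fin; apply: (le_trans H).
apply: (@le_trans _ _ (2%:E * (F * (S * normc h ^+ 2))%:E)%E).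
  rewrite lee_wpmul2l ?lee_fin//.
  have -> : ((F * (S * normc h ^+ 2))%:E = \int[mu]_(s in I01) (normc (f s%:C) * (S * normc h ^+ 2))%:E)%E.
    rewrite EFinM -FE -ge0_integralZr//.
    - by move/integrableP : If => [].
    - by move=> s _; rewrite lee_fin normc_ge0.
    - by rewrite lee_fin mulr_ge0// exprn_ge0// normc_ge0.
  apply: ge0_le_integral => //.
  - by move=> s _; rewrite lee_fin normc_ge0.
  - by apply/measurable_EFinP; apply: measurable_radius => s s1; exact: (cvg_normc (cG s s1)).
  - apply/measurable_EFinP; apply: measurable_funM => //.
    by move/integrableP : If => [/measurable_EFinP].
rewrite -EFinM lee_fin.
rewrite ltr_pdivlMr ?ltr_wpDl// in he.
have := normc_ge0 h; move: (normc h) he => x he x0.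
have -> : 2 * (F * (S * x ^+ 2)) = 2 * S * F * x * x by rewrite expr2; ring.
rewrite ler_wpM2r// (le_trans _ (ltW he))// mulrC ler_wpM2l// lerDl//.
Qed.

End T_holomorphic.

(** * Fejer kernels in dyadic frequency intervals *)

Section dyadic_polynomials.
Context {R : realType}.
Local Notation C := (R[i]^o).
Implicit Types (z w : R[i]) (s x : R) (j k m n : nat).

Lemma holomorphic_horner (q : {poly R[i]}) : holomorphic (horner q : C -> C).
Proof.
move=> z _; elim/poly_ind: q => [|q a ih].
  have -> : (horner (0 : {poly R[i]}) : C -> C) = cst (0 : C).
    by apply/funext => w /=; rewrite horner0.
  exact: derivable_cst.
have -> : (horner (q * 'X + a%:P) : C -> C) = (fun w : C => (horner q w : C) * w + a).
  by apply/funext => w /=; rewrite !hornerE.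
exact: (derivableD (derivableM ih (@derivable_id _ _ _ _)) (@derivable_cst _ _ _ _ _ _)).
Qed.

(** The number of terms of the Dirichlet kernel in block [j]. It is [1] for [j = 0],
    so that the block [0] is the single frequency [1]. *)
Definition half_block j : nat := 2 ^ j.-1.

Definition dirichlet m : {poly R} := \sum_(k < m) 'X^k.

Definition fejer j : {poly R} :=
  (half_block j)%:R^-1 *: ('X^(2 ^ j) * dirichlet (half_block j) ^+ 2).

(** The same polynomial over [R[i]]; positivity is read on the real one. *)
Definition cfejer j : {poly R[i]} := map_poly (real_complex R) (fejer j).

Lemma half_block_gt0 j : (0 < half_block j)%N. Proof. by rewrite expn_gt0. Qed.

Lemma half_block_le j : (half_block j <= 2 ^ j)%N.
Proof. by rewrite leq_pexp2l// leq_pred. Qed.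

Lemma half_block_ge j : (2 ^ j <= 2 * half_block j)%N.
Proof. by case: j => [|j] //=; rewrite /half_block /= expnS. Qed.

(** The square of the Dirichlet kernel has [2 m - 1] frequencies, which fit in the block. *)
Lemma half_block_lt j : (2 ^ j + (2 * half_block j).-1 <= 2 ^ j.+1)%N.
Proof.
case: j => [|j] //; rewrite /half_block /= -expnS [in leqRHS]expnS mul2n -addnn leq_add2l.
exact: leq_pred.
Qed.

Lemma coef_dirichlet m k : (dirichlet m)`_k = (k < m)%N%:R.
Proof.
rewrite /dirichlet coef_sum; have [km|mk] := ltnP k m.
  rewrite (bigD1 (Ordinal km))//= coefXn eqxx big1 ?addr0// => i; rewrite -val_eqE/= => ik.
  by rewrite coefXn eq_sym (negbTE ik).
by rewrite big1// => i _; rewrite coefXn gtn_eqF// (leq_trans (ltn_ord i)).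
Qed.

Lemma coef_dirichlet2 m n : (dirichlet m ^+ 2)`_n =
  \sum_(i < n.+1) (((i < m) && (n - i < m))%N : nat)%:R.
Proof.
rewrite expr2 coefM; apply: eq_bigr => i _; rewrite !coef_dirichlet.
by case: (i < m)%N; case: (n - i < m)%N; rewrite ?mulr1 ?mulr0.
Qed.

Lemma coef_dirichlet2_ge0 m n : 0 <= (dirichlet m ^+ 2)`_n.
Proof. by rewrite coef_dirichlet2 sumr_ge0. Qed.

Lemma coef_dirichlet2_le m n : (dirichlet m ^+ 2)`_n <= n.+1%:R.
Proof.
rewrite coef_dirichlet2 (@le_trans _ _ (\sum_(i < n.+1) 1))//.
  by apply: ler_sum => i _; case: (_ && _).
by rewrite sumr_const card_ord.
Qed.

Lemma coef_dirichlet2_lt m n : (n < m)%N -> (dirichlet m ^+ 2)`_n = n.+1%:R.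
Proof.
move=> nm; rewrite coef_dirichlet2 (eq_bigr (fun=> 1)) ?sumr_const ?card_ord// => i _.
by rewrite (leq_ltn_trans (leq_subr _ _) nm) (leq_ltn_trans _ nm)// -ltnS.
Qed.

Lemma coef_fejer j n : (fejer j)`_n = if (n < 2 ^ j)%N then 0 else
  (half_block j)%:R^-1 * (dirichlet (half_block j) ^+ 2)`_(n - 2 ^ j).
Proof. by rewrite /fejer coefZ coefXnM; case: ifP; rewrite ?mulr0. Qed.

Lemma coef_fejer_ge0 j n : 0 <= (fejer j)`_n.
Proof. by rewrite coef_fejer; case: ifP => // _; rewrite mulr_ge0// coef_dirichlet2_ge0. Qed.

Lemma coef_fejer_le j n : (fejer j)`_n <= n.+1%:R.
Proof.
rewrite coef_fejer; case: ifP => // _.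
rewrite (le_trans (ler_piMl (coef_dirichlet2_ge0 _ _) _))//.
  by rewrite invf_le1 ?ltr0n ?half_block_gt0// ler1n half_block_gt0.
by rewrite (le_trans (coef_dirichlet2_le _ _))// ler_nat ltnS leq_subr.
Qed.

Lemma coef_fejer_gt0 j n : (2 ^ j <= n < 2 ^ j + half_block j)%N -> 0 < (fejer j)`_n.
Proof.
move=> /andP[jn nj]; rewrite coef_fejer ltnNge jn /= coef_dirichlet2_lt.
  by rewrite mulr_gt0// invr_gt0 ltr0n half_block_gt0.
by rewrite ltn_subLR.
Qed.

Lemma size_dirichlet m : (size (dirichlet m) <= m)%N.
Proof. by apply/leq_sizeP => k mk; rewrite coef_dirichlet ltnNge mk. Qed.

Lemma size_fejer j : (size (fejer j) <= 2 ^ j.+1)%N.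
Proof.
apply: leq_trans (size_scale_leq _ _) _; apply: leq_trans (half_block_lt j).
rewrite mulrC; have [->|d0] := eqVneq (dirichlet (half_block j) ^+ 2) 0.
  by rewrite mul0r size_poly0.
rewrite size_mulXn// leq_add2l expr2 (leq_trans (size_polyMleq _ _))//.
by rewrite mul2n -addnn -!subn1 leq_sub2r// leq_add// size_dirichlet.
Qed.

Lemma coef_fejer_out j n : ~~ (2 ^ j <= n < 2 ^ j.+1)%N -> (fejer j)`_n = 0.
Proof.
rewrite negb_and -!leqNgt -ltnNge => /orP[nj|jn]; first by rewrite coef_fejer nj.
by apply/nth_default/(leq_trans (size_fejer j)).
Qed.

Lemma coef_cfejer j n : (cfejer j)`_n = ((fejer j)`_n)%:C.
Proof. by rewrite coef_map. Qed.

Lemma cfejerE j : cfejer j = \sum_(2 ^ j <= n < 2 ^ j.+1) ((fejer j)`_n)%:C *: 'X^n.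
Proof.
apply/polyP => k; rewrite coef_cfejer coef_sum.
have E n : (((fejer j)`_n)%:C *: 'X^n)`_k = ((fejer j)`_n)%:C * (k == n)%:R.
  by rewrite (coefZ ((fejer j)`_n)%:C) coefXn.
have [jk|kj] := boolP (2 ^ j <= k < 2 ^ j.+1)%N; last first.
  rewrite coef_fejer_out// big_nat big1// => n jn; rewrite E.
  by have [kn|] := eqVneq k n; rewrite ?mulr0//; rewrite kn jn in kj.
rewrite (bigD1_seq k) ?mem_index_iota ?iota_uniq// E eqxx mulr1 big1 => [|n nk]; first by rewrite /= addr0.
by rewrite E eq_sym (negbTE nk) mulr0.
Qed.

Lemma cfejer_horner j z : (cfejer j).[z] = \sum_(2 ^ j <= n < 2 ^ j.+1) ((fejer j)`_n)%:C * z ^+ n.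
Proof. by rewrite cfejerE horner_sum; apply: eq_bigr => n _; rewrite !hornerE. Qed.

Lemma cfejer_ofR j x : (cfejer j).[x%:C] = ((fejer j).[x])%:C.
Proof. by rewrite horner_map. Qed.

Lemma fejer_horner j x : (fejer j).[x] =
  (half_block j)%:R^-1 * (x ^+ (2 ^ j) * (\sum_(k < half_block j) x ^+ k) ^+ 2).
Proof.
rewrite /fejer hornerZ hornerM hornerXn horner_exp horner_sum.
by congr (_ * (_ * _ ^+ 2)); apply: eq_bigr => k _; rewrite hornerXn.
Qed.

Lemma cfejerM j : cfejer j =
  ((half_block j)%:R^-1)%:C *: ('X^(2 ^ j) * (\sum_(k < half_block j) 'X^k) ^+ 2).
Proof.
rewrite /cfejer /fejer map_polyZ rmorphM !rmorphXn/= map_polyX /dirichlet rmorph_sum/=.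
by congr (_ *: (_ * _ ^+ 2)); apply: eq_bigr => k _; rewrite map_polyXn.
Qed.

Lemma normc_cfejer j z : normc (cfejer j).[z] =
  (half_block j)%:R^-1 * (normc z ^+ (2 ^ j) * normc (\sum_(k < half_block j) z ^+ k) ^+ 2).
Proof.
rewrite cfejerM hornerZ hornerM hornerXn horner_exp horner_sum normcM normc_ofR.
rewrite ger0_norm// normcM !normcX; congr (_ * (_ * normc _ ^+ 2)).
by apply: eq_bigr => k _; rewrite hornerXn.
Qed.

Lemma normc_geometric_le m z : normc z <= 1 -> normc (\sum_(k < m) z ^+ k) <= m%:R.
Proof.
move=> z1; apply: (le_trans (normc_sum _ _ _)).
rewrite (@le_trans _ _ (\sum_(k < m) 1))//; last by rewrite sumr_const card_ord.
by apply: ler_sum => k _; rewrite normcX exprn_ile1// normc_ge0.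
Qed.

(** The decay of the Dirichlet kernel away from [1]. *)
Lemma normc_geometric_le2 m z : normc z <= 1 ->
  normc (\sum_(k < m) z ^+ k) * normc (1 - z) <= 2.
Proof.
move=> z1; rewrite mulrC -normcM.
have -> : (1 - z) * (\sum_(k < m) z ^+ k) = 1 - z ^+ m.
  have := subrXX 1 z m; rewrite expr1n => ->; congr (_ * _).
  by apply: eq_bigr => i _; rewrite expr1n mul1r.
rewrite (le_trans (le_normcD _ _))// normcN normc1 normcX.
have : normc z ^+ m <= 1 by rewrite exprn_ile1// normc_ge0.
lra.
Qed.

(** Up to a factor [2], the size of a block is its first frequency. *)
Lemma block_scale j (y := (2 ^ j)%:R : R) (m := (half_block j)%:R : R) :
  [/\ 0 < m, 1 <= y, m <= y & y <= 2 * m].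
Proof.
rewrite /y /m; split; rewrite ?ltr0n ?half_block_gt0 ?ler1n ?expn_gt0 ?ler_nat ?half_block_le//.
by rewrite -natrM ler_nat half_block_ge.
Qed.

Lemma normc_cfejer_le j z : normc z <= 1 -> normc (cfejer j).[z] <= (2 ^ j)%:R.
Proof.
move=> z1; have [m0 _ my _] := block_scale j; apply: le_trans my; rewrite normc_cfejer.
have h1 := normc_geometric_le (half_block j) z1.
have h2 : normc z ^+ (2 ^ j) <= 1 by rewrite exprn_ile1// normc_ge0.
rewrite mulrC ler_pdivrMr// -expr2.
rewrite (le_trans (ler_piMl _ h2)) ?exprn_ge0 ?normc_ge0//.
by rewrite lerXn2r ?nnegrE ?normc_ge0// ltW.
Qed.

Lemma normc_cfejer_sqr j z : normc z <= 1 ->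
  normc (cfejer j).[z] <= 2 / (2 ^ j)%:R * normc (\sum_(k < half_block j) z ^+ k) ^+ 2.
Proof.
move=> z1; have [m0 y1 _ ym] := block_scale j; rewrite normc_cfejer.
have h2 : normc z ^+ (2 ^ j) <= 1 by rewrite exprn_ile1// normc_ge0.
rewrite ler_pM ?invr_ge0 ?mulr_ge0 ?exprn_ge0 ?normc_ge0 ?(ltW m0)//.
  by rewrite ler_pdivlMr ?(lt_le_trans ltr01)// mulrC ler_pdivrMr.
by rewrite (ler_piMl _ h2)// exprn_ge0// normc_ge0.
Qed.

(** The increments in [j] of this bounded sequence dominate, up to a constant, the size
    of the [j]th bump at distance [x] from [1]. *)
Definition stair x j : R := (2 ^ j)%:R / (1 + (2 ^ j)%:R * x).

(** With [y = 2^j] and [u = y x], the increment of [stair] is [y / ((1 + u) (1 + 2 u))],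
    while the bump is at most [y] and at most [8 y / u^2]. *)
Lemma normc_cfejer_stair j z : normc z < 1 ->
  normc (cfejer j).[z] <= 31 * (stair (normc (1 - z)) j.+1 - stair (normc (1 - z)) j).
Proof.
move=> z1; have [m0 y1 my ym] := block_scale j.
have x0 : 0 < normc (1 - z).
  by rewrite normc_gt0 subr_eq0; apply/eqP => z1'; rewrite -z1' normc1 ltxx in z1.
have h1 := normc_cfejer_le j (ltW z1).
have h2 : normc (cfejer j).[z] * normc (1 - z) ^+ 2 <= 8 / (2 ^ j)%:R.
  have := normc_geometric_le2 (half_block j) (ltW z1) => h.
  have h' : (normc (\sum_(k < half_block j) z ^+ k) * normc (1 - z)) ^+ 2 <= 2 ^+ 2.
    by rewrite lerXn2r ?nnegrE ?mulr_ge0 ?normc_ge0.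
  apply: (le_trans (ler_wpM2r (exprn_ge0 _ (ltW x0)) (normc_cfejer_sqr j (ltW z1)))).
  rewrite -[leLHS]mulrA -exprMn (le_trans (ler_wpM2l _ h'))//.
  by rewrite le_eqVlt; apply/orP; left; apply/eqP; ring.
have b0 := normc_ge0 (cfejer j).[z].
rewrite /stair expnS natrM; move: (normc _) (normc (1 - z)) x0 ((2 ^ j)%:R : R) y1 h1 h2 b0 {my ym}.
move=> b x x0 y y1 h1 h2 b0.
have yx0 : 0 < y * x by rewrite mulr_gt0//; lra.
have -> : 2 * y / (1 + 2 * y * x) - y / (1 + y * x) = y / ((1 + y * x) * (1 + 2 * (y * x))).
  by field; apply/andP; split; rewrite gt_eqF//; lra.
rewrite mulrA ler_pdivlMr; last by rewrite mulr_gt0//; lra.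
have h3 : b * (y * x) ^+ 2 <= 8 * y.
  rewrite ler_pdivlMr in h2; last lra.
  have -> : b * (y * x) ^+ 2 = y * (b * x ^+ 2 * y) by ring.
  by rewrite [leRHS]mulrC ler_wpM2l//; lra.
move: (y * x) yx0 h3 => u u0 h3.
have : 0 <= b * (u - 1) ^+ 2 by rewrite mulr_ge0// sqr_ge0.
have -> : b * (u - 1) ^+ 2 = b * u ^+ 2 - 2 * (b * u) + b by ring.
have -> : b * ((1 + u) * (1 + 2 * u)) = b + 3 * (b * u) + 2 * (b * u ^+ 2) by ring.
lra.
Qed.

(** The sum telescopes, and [stair x J <= 1 / x]. *)
Lemma sum_normc_cfejer J z : normc z < 1 ->
  \sum_(0 <= j < J) normc (cfejer j).[z] <= 31 / normc (1 - z).
Proof.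
move=> z1; have x0 : 0 < normc (1 - z).
  by rewrite normc_gt0 subr_eq0; apply/eqP => z1'; rewrite -z1' normc1 ltxx in z1.
rewrite (@le_trans _ _ (31 * (stair (normc (1 - z)) J - stair (normc (1 - z)) 0)))//.
  rewrite -telescope_sumr// mulr_sumr; apply: ler_sum => j _; exact: normc_cfejer_stair.
rewrite ler_wpM2l// (@le_trans _ _ (stair (normc (1 - z)) J))//.
  rewrite lerBlDr lerDl /stair divr_ge0// addr_ge0// mulr_ge0//; exact: ltW.
rewrite /stair ler_pdivrMr; last by rewrite ltr_pwDl// mulr_ge0//; exact: ltW.
rewrite mulrDr mulr1 mulrCA mulVf ?gt_eqF// mulr1 lerDr invr_ge0; exact: ltW.
Qed.

Lemma bernoulli_ineq n s : 0 <= s <= 1 -> 1 - n%:R * s <= (1 - s) ^+ n.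
Proof.
move=> /andP[s0 s1]; elim: n => [|n ih]; first by rewrite mul0r subr0.
rewrite exprS (@le_trans _ _ ((1 - s) * (1 - n%:R * s)))//.
  rewrite -natr1; have : 0 <= n%:R * (s * s) by rewrite !mulr_ge0.
  have -> : (1 - s) * (1 - n%:R * s) = 1 - (n%:R + 1) * s + n%:R * (s * s) by ring.
  lra.
by rewrite ler_wpM2l// subr_ge0.
Qed.

Lemma fejer_ge0 j x : 0 <= x -> 0 <= (fejer j).[x].
Proof.
move=> x0; rewrite fejer_horner mulr_ge0// mulr_ge0 ?exprn_ge0//.
by rewrite sumr_ge0// => k _; rewrite exprn_ge0.
Qed.

(** On an interval of length comparable to [2^-j] the powers up to [2^(j+1)] are bounded
    below by Bernoulli, so the bump keeps a fraction of its height. *)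
Lemma fejer_lower j x : 1 - (2 * (2 ^ j)%:R)^-1 <= x <= 1 -> (2 ^ j)%:R / 16 <= (fejer j).[x].
Proof.
have [m0 y1 my ym] := block_scale j; move=> /andP[hx x1].
have x0 : 0 <= x.
  apply: le_trans hx; rewrite subr_ge0 invf_le1; lra.
have half : 2^-1 <= x ^+ (2 ^ j).
  have s01 : 0 <= 1 - x <= 1 by lra.
  have := bernoulli_ineq (2 ^ j) s01; rewrite subKr; apply: le_trans.
  have : (2 ^ j)%:R * (1 - x) <= 2^-1.
    rewrite mulrC -ler_pdivlMr; last lra.
    by rewrite -invfM; lra.
  lra.
rewrite fejer_horner.
have S : (half_block j)%:R * x ^+ (half_block j) <= \sum_(k < half_block j) x ^+ k.
  rewrite mulrC mulr_natr -{2}(card_ord (half_block j)) -sumr_const.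
  apply: ler_sum => k _; by rewrite ler_wiXn2l// ltnW.
have hm : 4^-1 <= (x ^+ half_block j) ^+ 2.
  apply: (@le_trans _ _ (2^-1 ^+ 2)); first lra.
  rewrite lerXn2r ?nnegrE ?exprn_ge0// (le_trans half)//.
  by rewrite -(subnK (half_block_le j)) exprD ler_piMl ?exprn_ge0// exprn_ile1.
have S2 : (half_block j)%:R ^+ 2 * 4^-1 <= (\sum_(k < half_block j) x ^+ k) ^+ 2.
  apply: (@le_trans _ _ (((half_block j)%:R * x ^+ (half_block j)) ^+ 2)).
    by rewrite exprMn ler_wpM2l// exprn_ge0// ltW.
  by rewrite lerXn2r ?nnegrE ?(le_trans _ S)// mulr_ge0 ?exprn_ge0// ltW.
apply: (@le_trans _ _ ((half_block j)%:R^-1 * (2^-1 * ((half_block j)%:R ^+ 2 * 4^-1)))).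
  rewrite mulrCA expr2 -!mulrA mulKf ?gt_eqF//; lra.
rewrite ler_wpM2l ?invr_ge0 ?(ltW m0)// ler_pM//.
Qed.

End dyadic_polynomials.

(** * Hardy norms of the Fejer kernels *)

Section fejer_norms.
Context {R : realType}.
Local Notation C := (R[i]^o).
Local Notation mu := (@lebesgue_measure R).
Local Notation I01 := ([set` `[0%R, (1%R : R)[]).
Implicit Types (z w : R[i]) (s x p r t : R) (j k m n : nat) (f : C -> C).

Lemma hardy_normZ_le p (a : R) f : 0 < p -> 0 <= a -> holomorphic f ->
  (hardy_norm p (fun z => a%:C%C * f z : C)%R <= a%:E * hardy_norm p f)%E.
Proof.
move=> p0 a0 hf; apply: hardy_norm_le => //.
  by rewrite mule_ge0 ?hardy_norm_ge0// lee_fin.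
move=> r r01; have r1 : `|r| < 1 by rewrite gtr0_norm; case/andP: r01.
have mf : measurable_fun setT (fun t => normc (f (circle_point r t))).
  by apply: continuous_measurable_fun; exact: normc_circle_continuous.
have -> : circle_powint p (fun z => a%:C * f z : C) r = ((a `^ p)%:E * circle_powint p f r)%E.
  rewrite /circle_powint -ge0_integralZl//.
  - apply: eq_integral => t _; rewrite -EFinM normcM normc_ofR ger0_norm//.
    by rewrite powRM// normc_ge0.
  - by apply/measurable_EFinP/measurable_powR_comp; exact: measurable_funS mf.
  - by move=> t _; rewrite lee_fin powR_ge0.
  - by rewrite lee_fin powR_ge0.
rewrite poweRM ?hardy_norm_ge0// ?lee_fin// poweR_EFin muleCA.
by rewrite lee_wpmul2l ?lee_fin ?powR_ge0// circle_powint_le.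
Qed.

Lemma holomorphicZ (a : C) f : holomorphic f -> holomorphic (fun z => a * f z : C).
Proof. by move=> hf z z1; exact: (derivableM (@derivable_cst _ _ _ a _ _) (hf z z1)). Qed.

Lemma holomorphicB f g : holomorphic f -> holomorphic g -> holomorphic (f - g).
Proof. by move=> hf hg z z1; exact: (derivableB (hf z z1) (hg z z1)). Qed.

(** The upper bound [hardy_normZ_le] for [a] and for its inverse. *)
Lemma hardy_normZ p (a : R) f : 0 < p -> 0 < a -> holomorphic f ->
  hardy_norm p (fun z => a%:C * f z : C) = (a%:E * hardy_norm p f)%E.
Proof.
move=> p0 a0 hf; apply/eqP; rewrite eq_le hardy_normZ_le ?(ltW a0)//=.
rewrite -lee_pdivlMl//.
have ai : 0 <= a^-1 by rewrite invr_ge0 ltW.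
have hg : holomorphic (fun z => a%:C * f z : C) by exact: (@holomorphicZ a%:C f hf).
have H := hardy_normZ_le p0 ai hg.
apply: (le_trans _ H) => {H}.
rewrite le_eqVlt; apply/orP; left; apply/eqP; congr hardy_norm; apply/funext => z.
by rewrite mulrA -rmorphM mulVf ?gt_eqF// mul1r.
Qed.

Lemma powR_conj_exponent (y p : R) : 0 < p -> (y `^ (1 - p^-1)) `^ p = y `^ (p - 1).
Proof. by move=> p0; rewrite -powRrM mulrBl mul1r mulVf// gt_eqF. Qed.

Lemma powRV (y a : R) : 0 < y -> y^-1 `^ a = (y `^ a)^-1.
Proof. by move=> y0; rewrite -[y^-1]powR_inv1 ?(ltW y0)// -powRrM mulN1r powRN. Qed.

Lemma powR_pred (x p : R) : 0 < p -> 0 <= x -> x `^ p = x `^ (p - 1) * x.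
Proof.
move=> p0 x0; have E : p = p - 1 + 1 by ring.
by rewrite {1}E powRD ?powRr1// -E gt_eqF.
Qed.

(** The height [2^j] of the bump reduces the power [p] to the first power, that is, to
    the square of the Dirichlet kernel. This square is at most a Riesz weight of exponent [1/2] at scale
    [2^-j], whose integral is known. *)
Lemma circle_powint_cfejer p : 1 < p -> exists2 c, 0 <= c & forall j r, 0 < r < 1 ->
  (circle_powint p (horner (cfejer j) : C -> C) r <= (c * (2 ^ j)%:R `^ (p - 1))%:E)%E.
Proof.
move=> p1; have [mD mX X0 wX] := @circle_scale R.
have h01 : 0 < (2^-1 : R) < 1 by apply/andP; split; lra.
have [c c0 W] := wX _ h01.
exists (2 * 49 * c); first by rewrite !mulr_ge0.
move=> j r /andP[r0 r1]; have [m0 y1 my ym] := @block_scale R j.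
set m := ((half_block j)%:R : R) in m0 my ym; set y := ((2 ^ j)%:R : R) in y1 my ym *.
have y0 : 0 < y by lra.
have hr : `|r| < 1 by rewrite gtr0_norm.
have mf : measurable_fun setT (fun t => normc (horner (cfejer j) (circle_point r t))).
  apply: continuous_measurable_fun; apply: normc_circle_continuous => //.
  exact: holomorphic_horner.
rewrite /circle_powint integral_circle_open; last exact: measurable_powR_comp.
pose K := y `^ (p - 1) * (2 / y) * 49 * y `^ 2^-1.
have K0 : 0 <= K by rewrite !mulr_ge0 ?powR_ge0 ?invr_ge0 ?(ltW y0).
have yi0 : 0 < y^-1 by rewrite invr_gt0.
have mW : measurable_fun [set` `]0%R, (2 * pi)%R[] (fun t => riesz_weight 2^-1 y^-1 (chord t)).
  apply: open_continuous_measurable_fun; first exact: interval_open.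
  move=> t; rewrite inE /= in_itv /= => /chord_gt0 t0.
  apply: (@continuous_comp _ _ _ (@chord R) (riesz_weight 2^-1 y^-1)); first exact: chord_continuous.
  exact: riesz_weight_cont.
have pt t : 0 < chord t ->
   normc (horner (cfejer j) (circle_point r t)) `^ p <= K * riesz_weight 2^-1 y^-1 (chord t).
  move=> x0; set z := circle_point r t : R[i].
  have z1 : normc z <= 1 by rewrite normc_circle_point ltW.
  have b0 := normc_ge0 (cfejer j).[z].
  have h1 := normc_cfejer_le j z1.
  have h2 := normc_cfejer_sqr j z1.
  have h3 := normc_geometric_le (half_block j) z1.
  have h4 := normc_geometric_le2 (half_block j) z1.
  have r01 : 0 <= r <= 1 by rewrite !ltW.
  have h5 := cauchy_kernel_lower t r01.
  set d := normc (\sum_(k < half_block j) z ^+ k) in h2 h3 h4.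
  have d0 : 0 <= d by exact: normc_ge0.
  set x := chord t in x0 h5 *.
  (* 6 from the decay of the Dirichlet kernel, 1 from its height *)
  have dx : d * (x + y^-1) <= 7.
    have h6 : d * x <= 6.
      rewrite -/z in h5; move: (normc (1 - z)) h4 h5 => v h4 h5.
      apply: (@le_trans _ _ (d * (3 * v))).
        rewrite ler_wpM2l// (le_trans _ h5)//; lra.
      rewrite mulrCA; lra.
    have h7 : d * y^-1 <= 1 by rewrite ler_pdivrMr// mul1r (le_trans h3).
    rewrite mulrDr; lra.
  have xy0 : 0 < x + y^-1 by rewrite addr_gt0// invr_gt0.
  have d2 : d ^+ 2 <= 49 / (x + y^-1) ^+ 2.
    rewrite ler_pdivlMr ?exprn_gt0// -exprMn (le_trans (_ : _ <= 7 ^+ 2))//; last lra.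
    by rewrite lerXn2r ?nnegrE// mulr_ge0// ltW.
  have key : ((x + y^-1) ^+ 2)^-1 <= y `^ 2^-1 * (x `^ (- 2^-1) / (x + y^-1)).
    rewrite expr2 invfM mulrA ler_wpM2r ?invr_ge0 ?(ltW xy0)//.
    have -> : y `^ 2^-1 * x `^ (- 2^-1) = ((x * y^-1) `^ 2^-1)^-1.
      rewrite powRN powRM ?invr_ge0 ?(ltW x0) ?(ltW y0)// invfM mulrC; congr (_ * _).
      by rewrite powRV// invrK.
    rewrite lef_pV2 ?posrE ?powR_gt0 ?divr_gt0//.
    rewrite powR12_sqrt ?divr_ge0 ?(ltW x0) ?(ltW y0)//.
    rewrite -[leRHS]gtr0_norm// -sqrtr_sqr ler_wsqrtr//.
    have : 0 <= x ^+ 2 + (y^-1) ^+ 2 by rewrite addr_ge0// sqr_ge0.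
    have : 0 <= x / y by rewrite divr_ge0// ltW.
    rewrite sqrrD; lra.
  have bp : normc (cfejer j).[z] `^ p <= y `^ (p - 1) * normc (cfejer j).[z].
    rewrite powR_pred//; last lra.
    rewrite ler_wpM2r// ge0_ler_powR ?nnegrE//; lra.
  apply: (le_trans bp); rewrite /K /riesz_weight -!mulrA ler_wpM2l ?powR_ge0//.
  apply: (le_trans h2); rewrite -!mulrA ler_wpM2l// ler_wpM2l ?(ltW yi0)//.
  by apply: (le_trans d2); rewrite ler_wpM2l.
apply: (@le_trans _ _ (\int[mu]_(t in `]0%R, (2 * pi)%R[) (K * riesz_weight 2^-1 y^-1 (chord t))%:E)%E).
  apply: ge0_le_integral => //.
  - by move=> t _; rewrite lee_fin powR_ge0.
  - by apply/measurable_EFinP/measurable_powR_comp; exact: measurable_funS mf.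
  - by apply/measurable_EFinP; exact: measurable_funM.
  - by move=> t; rewrite /= in_itv /= => /chord_gt0 /pt; rewrite lee_fin.
under eq_integral do rewrite EFinM.
rewrite ge0_integralZl ?lee_fin//; last 2 first.
- exact/measurable_EFinP.
- move=> t; rewrite /= in_itv /= => /chord_gt0 t0.
  by rewrite lee_fin /riesz_weight divr_ge0 ?powR_ge0// addr_ge0// ltW.
apply: (le_trans (lee_wpmul2l _ (W _ yi0))); first by rewrite lee_fin.
rewrite -EFinM lee_fin /K.
have -> : y^-1 `^ (- 2^-1) = y `^ 2^-1.
  by rewrite powRV// powRN invrK.
have yy : y `^ 2^-1 * y `^ 2^-1 = y.
  by rewrite -powRD ?(gt_eqF y0) ?implybT// -[RHS]powRr1 ?(ltW y0)//; congr (_ `^ _); lra.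
move: (y `^ (p - 1)) => Y; move: (y `^ 2^-1) yy => v yy.
rewrite le_eqVlt; apply/orP; left; apply/eqP.
have -> : Y * (2 / y) * 49 * v * (c * v) = 2 * 49 * c * Y * ((v * v) / y) by ring.
by rewrite yy mulfV ?mulr1// gt_eqF.
Qed.

Lemma hardy_norm_cfejer_le p : 1 < p -> exists2 c, 0 <= c & forall j,
  (hardy_norm p (horner (cfejer j) : C -> C) <= (c * (2 ^ j)%:R `^ (1 - p^-1))%:E)%E.
Proof.
move=> p1; have p0 : 0 < p by lra.
have [c c0 W] := circle_powint_cfejer p1.
have pi0 : 0 < 2 * pi :> R by rewrite mulr_gt0 ?pi_gt0.
exists ((c / (2 * pi)) `^ p^-1); first exact: powR_ge0.
move=> j; apply: hardy_norm_le => //; first by rewrite lee_fin mulr_ge0 ?powR_ge0.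
move=> r r01; apply: (le_trans (W j r r01)).
rewrite poweR_EFin powRM ?powR_ge0// powR_conj_exponent// -powRrM mulVf ?gt_eqF//.
rewrite powRr1 ?divr_ge0 ?(ltW pi0)// -EFinM lee_fin mulrA.
by rewrite mulrCA mulfV ?gt_eqF// mulr1.
Qed.

Lemma radial_measure_lower (h p a : R) (u : R -> R) : 0 < h <= 1 -> 0 <= a -> 0 <= p ->
  measurable_fun I01 u -> (forall s, 0 <= s < 1 -> 0 <= u s) ->
  (forall s, 1 - h <= s < 1 -> a <= u s) ->
  ((a `^ p * h)%:E <= \int[mu]_(s in [set` `[(1 - h)%R, (1%R : R)[]) (u s `^ p)%:E)%E.
Proof.
move=> /andP[h0 h1] a0 p0 mu0 u0 ua.
have -> : ((a `^ p * h)%:E = \int[mu]_(s in [set` `[(1 - h)%R, (1%R : R)[]) (a `^ p)%:E)%E.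
  rewrite integral_cst//= lebesgue_measure_itv /= lte_fin ltrBlDr ltrDl h0 -EFinB -EFinM.
  by congr (_ * _)%:E; ring.
apply: ge0_le_integral => //.
- by move=> s _; rewrite lee_fin powR_ge0.
- apply/measurable_EFinP; apply: measurable_powR_comp; apply: measurable_funS mu0 => //.
  by apply: subset_itvr; rewrite bnd_simp subr_ge0.
- move=> s; rewrite /= in_itv /= => s1; rewrite lee_fin ge0_ler_powR ?nnegrE//; last exact: ua.
  by rewrite (le_trans a0)// ua.
Qed.

(** By Fejer-Riesz it is enough to bound the bump from below on the radius. *)
Lemma hardy_norm_cfejer_ge p : 1 < p -> exists2 c, 0 < c & forall j,
  ((c * (2 ^ j)%:R `^ (1 - p^-1))%:E <= hardy_norm p (horner (cfejer j) : C -> C))%E.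
Proof.
move=> p1; have p0 : 0 < p by lra.
have [c c0 FR] := fejer_riesz p1.
pose b := 16^-1 `^ p / 2 / (c + 1).
have c10 : 0 < c + 1 by lra.
have b0 : 0 < b by rewrite !divr_gt0// powR_gt0// invr_gt0.
exists (b `^ p^-1); first exact: powR_gt0.
move=> j; have [m0 y1 my ym] := @block_scale R j.
set y := ((2 ^ j)%:R : R) in y1 my ym *; set N := hardy_norm _ _.
have y0 : 0 < y by lra.
have hB := @holomorphic_horner R (cfejer j).
have N0 : (0 <= N)%E by exact: hardy_norm_ge0.
have -> : N = ((N `^ p) `^ p^-1)%E by rewrite -poweRrM mulfV ?gt_eqF// poweRe1.
have -> : (b `^ p^-1 * y `^ (1 - p^-1))%:E = ((b * y `^ (p - 1))%:E `^ p^-1)%E.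
  rewrite poweR_EFin powRM ?powR_ge0 ?(ltW b0)// -powRrM mulrBl mul1r mulfV//.
  by rewrite gt_eqF.
apply: ler_poweR; rewrite ?invr_ge0 ?(ltW p0)//.
  by rewrite lee_fin mulr_ge0 ?powR_ge0// ltW.
pose h := (2 * y)^-1.
have h01 : 0 < h <= 1 by apply/andP; split; rewrite /h ?invr_gt0 ?invf_le1; lra.
have mB := measurable_radial_normc hB.
have lowB s : 1 - h <= s < 1 -> y / 16 <= normc (cfejer j).[s%:C].
  move=> /andP[s0 s1]; rewrite cfejer_ofR normc_ofR (le_trans _ (ler_norm _))//.
  by apply: fejer_lower; rewrite s0 ltW.
have := radial_measure_lower h01 _ (ltW p0) mB (fun s _ => normc_ge0 _) lowB.
rewrite divr_ge0 ?(ltW y0)// => /(_ isT) H.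
have : ((b * y `^ (p - 1) * (c + 1))%:E <= (c + 1)%:E * N `^ p)%E.
  apply: (@le_trans _ _ (c%:E * N `^ p)%E); last first.
    by rewrite lee_wpmul2r ?poweR_ge0// lee_fin; lra.
  apply: le_trans (FR _ hB); apply: le_trans (le_trans H _).
    rewrite lee_fin powRM ?invr_ge0 ?(ltW y0)//.
    rewrite (powR_pred p0 (ltW y0)).
    rewrite /h /b; move: (y `^ _) (16^-1 `^ p) => Y Q.
    by rewrite le_eqVlt; apply/orP; left; apply/eqP; field; rewrite !gt_eqF.
  apply: ge0_subset_integral => //.
  - by apply/measurable_EFinP; exact: measurable_powR_comp.
  - by move=> s _; rewrite lee_fin powR_ge0.
  - by apply: subset_itvr; rewrite bnd_simp; case/andP: h01 => _; rewrite subr_ge0.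
rewrite EFinM muleC lee_pmul2l//.
Qed.

End fejer_norms.

(** * The symbol *)

Section block_series.
Context {R : realType}.
Local Notation C := (R[i]^o).
Local Notation mu := (@lebesgue_measure R).
Local Notation I01 := ([set` `[0%R, (1%R : R)[]).
Implicit Types (z w : R[i]) (s x p r t : R) (j k m n : nat) (f : C -> C) (a : nat -> R).

(** The frequency [n] belongs to the dyadic block of index [trunc_log 2 n]; for [n = 0]
    this index is [0] and the coefficient vanishes. *)
Definition block_coef a n : R := a (trunc_log 2 n) * (fejer (trunc_log 2 n))`_n.

Definition block_series a : C -> C := power_series (block_coef a).

Lemma block_coefE a j n : (2 ^ j <= n < 2 ^ j.+1)%N -> block_coef a n = a j * (fejer j)`_n.
Proof. by move=> jn; rewrite /block_coef (trunc_log_eq _ jn). Qed.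

Variables (a : nat -> R) (A : R).
Hypothesis a0 : forall j, 0 < a j.
Hypothesis aA : forall j, a j <= A.

Lemma block_coef_ge0 n : 0 <= block_coef a n.
Proof. by rewrite mulr_ge0 ?coef_fejer_ge0// ltW. Qed.

Lemma tame_block_coef : tame (block_coef a).
Proof.
move=> q q01; have [M HM] := natmul_geometric_bounded q01.
have A0 : 0 <= A by rewrite (le_trans (ltW (a0 0%N))).
have q0 n : 0 <= q ^+ n by rewrite exprn_ge0//; case/andP: q01 => /ltW.
exists (A * (M + 1)) => n; rewrite ger0_norm ?block_coef_ge0//.
rewrite -mulrA ler_pM ?(ltW (a0 _))// ?mulr_ge0 ?coef_fejer_ge0//.
rewrite (le_trans (ler_wpM2r (q0 n) (coef_fejer_le _ n)))//.
rewrite -natr1 mulrDl mul1r lerD// exprn_ile1//; case/andP: q01 => /ltW // _ /ltW //.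
Qed.

Lemma block_partial_sum J z : \sum_(0 <= n < 2 ^ J) (block_coef a n)%:C * z ^+ n =
  \sum_(0 <= j < J) (a j)%:C * (cfejer j).[z].
Proof.
elim: J => [|J ih].
  rewrite expn0 big_nat1 big_nil /block_coef trunc_log0 coef_fejer_out// mulr0.
  by rewrite mul0r.
rewrite (big_cat_nat _ (_ : (2 ^ J <= 2 ^ J.+1)%N))//=; last by rewrite leq_pexp2l.
rewrite ih big_nat_recr//=; congr (_ + _); rewrite cfejer_horner mulr_sumr.
by apply: eq_big_nat => n /block_coefE ->; rewrite rmorphM mulrA.
Qed.

Lemma block_series_holomorphic : holomorphic (block_series a).
Proof. exact: ps_holomorphic tame_block_coef. Qed.

(** The partial sums of the power series at the frequencies [2^J] are sums of whole blocks. *)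
Lemma block_series_cvg z : normc z < 1 ->
  (fun J => \sum_(0 <= j < J) (a j)%:C * (cfejer j).[z] : C) @ \oo --> (block_series a z : C).
Proof.
move=> z1; have H := ps_cvg tame_block_coef z1.
rewrite (_ : (fun J => _) = (fun n => \sum_(0 <= k < n) (block_coef a k)%:C * z ^+ k : C) \o (fun J => 2 ^ J)%N).
  apply: cvg_comp H => P [N _ HN]; exists N => // J /= NJ; apply: HN => /=.
  by rewrite (leq_trans NJ)// ltnW// ltn_expl.
by apply/funext => J /=; rewrite block_partial_sum.
Qed.

Lemma normc_block_series_le z : normc z < 1 ->
  normc (block_series a z) <= (31 * A) / normc (1 - z).
Proof.
move=> z1; apply: (normc_lim_le (block_series_cvg z1)) => J.
have A0 : 0 <= A by rewrite (le_trans (ltW (a0 0%N))).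
apply: (le_trans (normc_sum _ _ _)); apply: (@le_trans _ _ (\sum_(0 <= j < J) A * normc (cfejer j).[z])).
  apply: ler_sum => j _; rewrite normcM normc_ofR gtr0_norm//.
  by rewrite ler_wpM2r// normc_ge0.
rewrite -mulr_sumr [31 * A]mulrC -mulrA ler_wpM2l//; exact: sum_normc_cfejer.
Qed.

Lemma taylor_block_series n : taylor (block_series a) n = (block_coef a n)%:C.
Proof. exact: taylor_ps tame_block_coef. Qed.

Lemma spectrum_block_series n : spectrum (block_series a) n <-> 0 < block_coef a n.
Proof.
rewrite /spectrum /= taylor_block_series lt_neqAle block_coef_ge0 andbT eq_sym.
by rewrite (inj_eq (@complexI R) 0).
Qed.

Lemma dyadic_block_series j : dyadic_block (block_series a) j = (a j)%:C *: cfejer j.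
Proof.
rewrite /dyadic_block cfejerE scaler_sumr; apply: eq_big_nat => n jn.
by rewrite taylor_block_series (block_coefE _ jn) rmorphM scalerA.
Qed.

Lemma cfejer_spectrum j n : (@cfejer R j)`_n != 0 -> spectrum (block_series a) n.
Proof.
move=> bn; have jn : (2 ^ j <= n < 2 ^ j.+1)%N.
  by apply: contraNT bn => jn; rewrite coef_cfejer coef_fejer_out.
apply/spectrum_block_series; rewrite (block_coefE _ jn) mulr_gt0// lt_neqAle coef_fejer_ge0 andbT.
by rewrite eq_sym; apply: contraNneq bn; rewrite coef_cfejer => ->.
Qed.

Lemma spectrum_interval j n : (2 ^ j <= n < 2 ^ j + half_block j)%N -> spectrum (block_series a) n.
Proof.
move=> /(@coef_fejer_gt0 R) h; apply: (@cfejer_spectrum j).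
by rewrite coef_cfejer (inj_eq (@complexI R) _ 0) gt_eqF.
Qed.

(** All coefficients are nonnegative, so on the radius each block is a lower bound. *)
Lemma Re_block_series_ge j x : 0 <= x < 1 ->
  a j * (fejer j).[x] <= complex.Re (block_series a x%:C).
Proof.
move=> /andP[x0 x1]; have x1' : normc x%:C < 1 by rewrite normc_ofR ger0_norm.
have H : (fun J => complex.Re (\sum_(0 <= j < J) (a j)%:C * (cfejer j).[x%:C])) @ \oo -->
    complex.Re (block_series a x%:C) by exact: (cvg_Re (block_series_cvg x1')).
rewrite -(cvg_lim _ H)//; apply: limr_ge; first by apply/cvg_ex; eexists; exact: H.
near=> J.
have -> : complex.Re (\sum_(0 <= i < J) (a i)%:C * (cfejer i).[x%:C]) =
   \sum_(0 <= i < J) a i * (fejer i).[x].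
  by rewrite Re_sum; apply: eq_bigr => i _; rewrite cfejer_ofR -rmorphM.
have jJ : (j < J)%N by near: J; exists j.+1.
rewrite (bigD1_seq j) ?mem_index_iota ?iota_uniq//= lerDl sumr_ge0// => i _.
by rewrite mulr_ge0 ?fejer_ge0// ltW.
Unshelve. all: by end_near. Qed.

Lemma int01_bounded (u : R -> C) (M : R) : (forall s, `|s| < 1 -> u @ s --> u s) ->
  (forall s, 0 <= s < 1 -> normc (u s) <= M) -> int01 u.
Proof.
move=> cu uM; apply: (@int01_dominated _ u (fun=> M)) => //.
apply: (@integrableS _ _ _ mu [set` `[0%R, (1%R : R)]]) => //.
  by apply: subset_itvl; rewrite bnd_simp.
apply: continuous_compact_integrable; first exact: segment_compact.
by apply: continuous_subspaceT => x; exact: cvg_cst.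
Qed.

(** For [s] and [x] both within [1 / (4 y)] of [1], with [y = 2^j], the product [s x] is within [1 / (2 y)] of [1];
    there the block [j] of the symbol and the test function are both of the order of [y],
    on a set of [x] of length [1 / (4 y)]. The constant is [16^2 4]. *)
Lemma T_block_lower (b : R) j s : 0 <= b -> 1 - (4 * (2 ^ j)%:R)^-1 <= s < 1 ->
  b * a j * (2 ^ j)%:R / 1024 <=
  normc (T_ (block_series a) (fun z => b%:C * horner (cfejer j) z : C) s%:C).
Proof.
move=> b0 /andP[hs s1]; have [m0 y1 my ym] := @block_scale R j.
set y := ((2 ^ j)%:R : R) in y1 my ym hs *.
have y0 : 0 < y by lra.
pose h := (4 * y)^-1.
have h01 : 0 < h <= 1 by apply/andP; split; rewrite /h ?invr_gt0 ?invf_le1; lra.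
have [h0 h1] := andP h01.
have s0 : 0 <= s by rewrite (le_trans _ hs)// -/h; lra.
set f := (fun z => _).
have hf : holomorphic f by apply: holomorphicZ; exact: holomorphic_horner.
pose u x : C := f x%:C * block_series a (x%:C * s%:C).
have s1' : normc s%:C < 1 by rewrite normc_ofR ger0_norm.
have cu x : `|x| < 1 -> u @ x --> u x.
  exact: (T_integrand_continuous block_series_holomorphic hf (ltW s1')).
have A0 : 0 <= A by rewrite (le_trans (ltW (a0 0%N))).
have iu : int01 u.
  apply: (@int01_bounded _ (b * y * (31 * A / (1 - s)))) => // x /andP[x0 x1].
  rewrite normcM; apply: ler_pM; rewrite ?normc_ge0//.
    rewrite normcM normc_ofR ger0_norm// ler_wpM2l//; apply: normc_cfejer_le.
    by rewrite normc_ofR ger0_norm// ltW.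
  have xs : x * s <= s by rewrite ler_piMl// ltW.
  have xs0 : 0 <= x * s by rewrite mulr_ge0.
  rewrite -rmorphM; apply: (le_trans (normc_block_series_le _)).
    by rewrite normc_ofR ger0_norm// (le_lt_trans xs).
  have E : normc (1 - (x * s)%:C) = 1 - x * s.
    by rewrite -[X in X - _](rmorph1 (real_complex R)) -rmorphB normc_ofR ger0_norm//; lra.
  by rewrite ler_wpM2l ?mulr_ge0// E lef_pV2 ?posrE; lra.
have ReU x : 0 <= x < 1 -> complex.Re (u x) =
    b * (fejer j).[x] * complex.Re (block_series a (x * s)%:C).
  move=> _; rewrite /u /f cfejer_ofR -!rmorphM.
  by case: (block_series a _) => c d; simpc.
have xs01 x : 0 <= x < 1 -> 0 <= x * s < 1.
  by move=> /andP[x0 x1]; rewrite mulr_ge0//= mulr_ilt1.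
have ReU0 x : 0 <= x < 1 -> 0 <= complex.Re (u x).
  move=> x01; rewrite ReU// mulr_ge0//.
    by rewrite mulr_ge0// fejer_ge0//; case/andP: x01.
  apply: le_trans (Re_block_series_ge j (xs01 _ x01)).
  by rewrite mulr_ge0 ?(ltW (a0 j))// fejer_ge0//; case/andP: (xs01 _ x01).
have low x : 1 - h <= x < 1 -> b * a j * y ^+ 2 / 256 <= complex.Re (u x).
  move=> /andP[x0 x1]; have x01 : 0 <= x < 1 by rewrite x1 (le_trans _ x0)//; lra.
  have h2 : 2 * h = (2 * y)^-1 by rewrite /h; field; rewrite gt_eqF.
  have Bx : y / 16 <= (fejer j).[x].
    apply: fejer_lower; rewrite -/y -h2 (ltW x1) andbT; lra.
  have Bxs : y / 16 <= (fejer j).[x * s].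
    apply: fejer_lower; rewrite -/y -h2; have /andP[_ /ltW ->] := xs01 _ x01; rewrite andbT.
    have : (1 - h) * (1 - h) <= x * s by rewrite ler_pM//; lra.
    have : 0 <= h * h by rewrite mulr_ge0// ltW.
    have -> : (1 - h) * (1 - h) = 1 - 2 * h + h * h by ring.
    lra.
  rewrite ReU//.
  have -> : b * a j * y ^+ 2 / 256 = b * (y / 16) * (a j * (y / 16)) by rewrite expr2; field.
  apply: ler_pM.
  - by rewrite mulr_ge0// divr_ge0// ltW.
  - by rewrite mulr_ge0 ?(ltW (a0 j))// divr_ge0// ltW.
  - by rewrite ler_wpM2l.
  - apply: le_trans (Re_block_series_ge j (xs01 _ x01)).
    by rewrite ler_wpM2l// ltW.
have c0 : 0 <= b * a j * y ^+ 2 / 256.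
  by rewrite divr_ge0// mulr_ge0 ?exprn_ge0 ?(ltW y0)// mulr_ge0// ltW.
have mR : measurable_fun I01 (fun x => complex.Re (u x)).
  by apply: measurable_radius => x x1; exact: (cvg_Re (cu x x1)).
have H := radial_measure_lower h01 c0 ler01 mR ReU0 low.
rewrite powRr1// in H.
have E : b * a j * y / 1024 = b * a j * y ^+ 2 / 256 * h.
  by rewrite /h expr2; field; rewrite gt_eqF.
rewrite E; apply: le_trans (Re_le_normc _); apply: le_trans (ler_norm _).
rewrite /T_ /integral01 /= /Rintegral -lee_fin fineK; last exact: (integrable_fin_num _ (proj1 iu)).
apply: (le_trans H).
apply: (@le_trans _ _ (\int[mu]_(x in [set` `[(1 - h)%R, (1%R : R)[]) (complex.Re (u x))%:E)%E).
  rewrite le_eqVlt; apply/orP; left; apply/eqP; apply: eq_integral => x.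
  rewrite inE /= in_itv /= => /andP[x0 x1]; rewrite powRr1// ReU0// x1 (le_trans _ x0)//; lra.
apply: ge0_subset_integral => //.
- exact/measurable_EFinP.
by apply: subset_itvr; rewrite bnd_simp; lra.
Qed.

End block_series.

(** * Noncompactness *)

Section noncompactness.
Context {R : realType}.
Local Notation C := (R[i]^o).
Local Notation mu := (@lebesgue_measure R).
Local Notation I01 := ([set` `[0%R, (1%R : R)[]).
Implicit Types (z w : R[i]) (s x p r t h : R) (j k m n : nat) (f g : C -> C) (a : nat -> R).

(** Absolute continuity of the integral of [|g|^p], which is finite by Fejer-Riesz. *)
Lemma hardy_radius_tail p g (e : R) : 1 < p -> hardy p g -> 0 < e ->
  exists2 d, 0 < d & forall h, 0 < h <= 1 -> h < d ->
    (\int[mu]_(s in [set` `[(1 - h)%R, (1%R : R)[]) (normc (g s%:C) `^ p)%:E < e%:E)%E.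
Proof.
move=> p1 hg e0; have ig := hardy_radius_powR_integrable p1 hg.
pose F := (fun s => normc (g s%:C) `^ p) \_ I01.
have iF : mu.-integrable setT (EFin \o F).
  have := @integrable_mkcond _ _ R mu I01 (EFin \o (fun s => normc (g s%:C) `^ p)) (measurable_itv _).
  by move=> [/(_ ig)]; rewrite restrict_EFin.
have [d [d0 Hd]] := integral_normr_continuous iF e0.
exists d => // h /andP[h0 h1] hd.
have sub : [set` `[(1 - h)%R, (1%R : R)[] `<=` I01.
  by apply: subset_itvr; rewrite bnd_simp subr_ge0.
have mE : measurable [set` `[(1 - h)%R, (1%R : R)[] by exact: measurable_itv.
have := Hd _ mE => /=; rewrite lebesgue_measure_itv /= lte_fin ltrBlDr ltrDl h0 -EFinB lte_fin.
rewrite subKr => /(_ hd); rewrite -lte_fin /Rintegral fineK; last first.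
  apply: integrable_fin_num => //.
  have : mu.-integrable [set` `[(1 - h)%R, (1%R : R)[] (EFin \o F) by exact: integrableS iF.
  by move/(integrable_norm).
apply: le_lt_trans; rewrite le_eqVlt; apply/orP; left; apply/eqP.
apply: eq_integral => s sE; rewrite /F patchE ifT; last by rewrite inE; apply: sub; rewrite inE in sE.
by rewrite ger0_norm// powR_ge0.
Qed.

Lemma powR_le_split (p x y v : R) : 0 < p -> 0 <= x -> 0 <= y -> 0 <= v -> x <= y + v ->
  x `^ p <= 2 `^ p * (y `^ p + v `^ p).
Proof.
move=> p0 x0 y0 v0 xyv.
have m0 : 0 <= Num.max y v by rewrite le_max y0.
apply: (@le_trans _ _ ((2 * Num.max y v) `^ p)).
  rewrite ge0_ler_powR ?nnegrE ?mulr_ge0 ?(ltW p0)// (le_trans xyv)//.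
  by rewrite mulr_natl mulr2n lerD// le_max lexx ?orbT.
rewrite powRM// ler_wpM2l ?powR_ge0//.
by case: (leP y v) => _; rewrite ?lerDl ?lerDr powR_ge0.
Qed.

(** If the images keep mass [del] on radial intervals that shrink to [1], no subsequence
    converges: on the radius the limit is close to the images in [L^p], but has little
    mass on short intervals. *)
Lemma not_compact_radial p (T : (C -> C) -> C -> C) (u : nat -> C -> C) (h : nat -> R) (del : R) :
  1 < p -> (forall f, hardy p f -> holomorphic (T f)) ->
  (forall j, hardy p (u j)) -> (forall j, hardy_norm p (u j) = 1%E) ->
  (forall j, 0 < h j <= 1) -> (h @ \oo --> (0 : R)) -> 0 < del ->
  (forall j, (del%:E <=
    \int[mu]_(s in [set` `[(1 - h j)%R, (1%R : R)[]) (normc (T (u j) s%:C) `^ p)%:E)%E) ->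
  ~ hardy_compact p T.
Proof.
move=> p1 HT Hu nu h01 hcvg del0 lower; have p0 : 0 < p by lra.
move=> /(_ u Hu) []; first by exists 1 => n; rewrite nu.
move=> k [g [kinc hg cg]].
have kn n : (n <= k n)%N.
  by elim: n => // n ih; rewrite (leq_ltn_trans ih)// kinc.
have [c c0 FR] := fejer_riesz p1.
have [eta eta0 etaE] : exists2 eta : R, 0 < eta & 2 `^ p * (eta + eta) < del.
  have Q0 : 0 < 2 `^ p :> R by rewrite powR_gt0.
  exists (del / 2 `^ p / 4); first by rewrite divr_gt0 ?divr_gt0.
  by move: (2 `^ p) Q0 => Q Q0; rewrite (_ : _ * _ = del / 2); [lra|field; rewrite gt_eqF].
have [d d0 Hd] := hardy_radius_tail p1 hg eta0.
have [ep ep0 epE] : exists2 ep : R, 0 < ep & c * ep `^ p <= eta.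
  have c10 : 0 < c + 1 by lra.
  exists ((eta / (c + 1)) `^ p^-1); first by rewrite powR_gt0 ?divr_gt0.
  rewrite -powRrM mulVf ?gt_eqF// powRr1; last by rewrite divr_ge0 ?(ltW eta0) ?(ltW c10).
  by rewrite mulrCA ler_piMr ?(ltW eta0)// ler_pdivrMr// mul1r; lra.
pose v n : C -> C := T (u (k n)) - g.
have hv n : holomorphic (v n) by exact: (holomorphicB (HT _ (Hu (k n))) (proj1 hg)).
have nearv : \forall n \near \oo, (hardy_norm p (v n) < ep%:E)%E.
  have H : nbhs (0%E : \bar R) [set x | (x < ep%:E)%E].
    by apply: open_ereal_lt'; rewrite lte_fin.
  exact: (cg _ H).
have nearh : \forall n \near \oo, h (k n) < d.
  have /cvgr0Pnorm_lt /(_ _ d0) [N _ HN] := hcvg.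
  exists N => // n /= Nn; apply: (le_lt_trans (ler_norm _)); apply: HN => /=.
  exact: leq_trans (kn n).
have [n [hn vn]] : exists n, h (k n) < d /\ (hardy_norm p (v n) < ep%:E)%E.
  by near \oo => n; exists n; split; near: n.
set E := [set` `[(1 - h (k n))%R, (1%R : R)[].
have sub : E `<=` I01.
  by apply: subset_itvr; rewrite bnd_simp subr_ge0; case/andP: (h01 (k n)).
have mE : measurable E by exact: measurable_itv.
have mp f : holomorphic f -> measurable_fun E (EFin \o (fun s => normc (f s%:C) `^ p)).
  move=> hf; apply/measurable_EFinP; apply: measurable_powR_comp.
  exact: measurable_funS (measurable_radial_normc hf).
have Iv : (\int[mu]_(s in E) (normc (v n s%:C) `^ p)%:E <= eta%:E)%E.
  apply: (@le_trans _ _ (c%:E * hardy_norm p (v n) `^ p)%E).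
    apply: le_trans (FR _ (hv n)); apply: ge0_subset_integral.
    - exact: mE.
    - exact: measurable_itv.
    - apply/measurable_EFinP; apply: measurable_powR_comp.
      exact: (measurable_radial_normc (hv n)).
    - by move=> s _; rewrite lee_fin powR_ge0.
    - exact: sub.
  apply: (@le_trans _ _ (c%:E * (ep%:E `^ p))%E); last by rewrite poweR_EFin -EFinM lee_fin.
  rewrite lee_wpmul2l ?lee_fin//; apply: ler_poweR.
  - exact: ltW.
  - exact: hardy_norm_ge0.
  - exact: ltW.
have Ig := Hd _ (h01 (k n)) hn.
suff : (del%:E <= (2 `^ p)%:E * (eta%:E + eta%:E))%E.
  by rewrite -EFinD -EFinM lee_fin leNgt etaE.
apply: (le_trans (lower (k n))).
apply: (@le_trans _ _ ((2 `^ p)%:E * (\int[mu]_(s in E)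
     ((normc (v n s%:C) `^ p)%:E + (normc (g s%:C) `^ p)%:E)))%E).
  rewrite -ge0_integralZl.
  - apply: ge0_le_integral.
    - exact: mE.
    - by move=> s _; rewrite lee_fin powR_ge0.
    - exact: mp (HT _ (Hu (k n))).
    - apply: measurable_funeM; apply: emeasurable_funD; apply: mp; [exact: hv|by case: hg].
    - move=> s _; rewrite -EFinD -EFinM lee_fin; apply: powR_le_split.
      + exact: p0.
      + exact: normc_ge0.
      + exact: normc_ge0.
      + exact: normc_ge0.
      have -> : T (u (k n)) s%:C = v n s%:C + g s%:C by rewrite /v /= subrK.
      exact: le_normcD.
  - exact: mE.
  - apply: emeasurable_funD; apply: mp; [exact: hv|by case: hg].
  - by move=> s _; rewrite -EFinD lee_fin addr_ge0 ?powR_ge0.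
  - by rewrite lee_fin powR_ge0.
rewrite lee_wpmul2l ?lee_fin ?powR_ge0// ge0_integralD.
- by apply: leeD; [exact: Iv|exact: ltW].
- exact: mE.
- by move=> s _; rewrite lee_fin powR_ge0.
- exact: mp (hv n).
- by move=> s _; rewrite lee_fin powR_ge0.
- exact: mp (proj1 hg).
Unshelve. all: by end_near.
Qed.

Lemma block_scale_cvg0 : (fun j => (4 * (2 ^ j)%:R)^-1) @ \oo --> (0 : R).
Proof.
apply/cvgr0Pnorm_lt => e e0; exists (Num.Def.truncn (e^-1)).+1 => // n /= en.
have y0 : 0 < (2 ^ n)%:R :> R by rewrite ltr0n expn_gt0.
rewrite gtr0_norm ?invr_gt0 ?mulr_gt0//.
rewrite invf_plt ?posrE ?mulr_gt0//.
apply: (lt_le_trans (truncnS_gt _)); apply: (@le_trans _ _ n%:R); first by rewrite ler_nat.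
apply: (@le_trans _ _ (2 ^ n)%:R); first by rewrite ler_nat; exact: ltnW (ltn_expl n (ltnSn 1)).
lra.
Qed.

Lemma T_block_not_compact p a (A al : R) : 1 < p -> 0 < al ->
  (forall j, al <= a j) -> (forall j, a j <= A) ->
  (forall f, hardy p f -> holomorphic (T_ (block_series a) f)) ->
  (forall j, (a j)%:E * hardy_norm p (horner (@cfejer R j) : C -> C) =
    ((2 ^ j)%:R `^ (1 - p^-1))%:E)%E ->
  ~ hardy_compact p (T_ (block_series a)).
Proof.
move=> p1 al0 a_ge aA HT norm_block; have p0 : 0 < p by lra.
have a0 j : 0 < a j by exact: lt_le_trans (a_ge j).
pose y j : R := (2 ^ j)%:R.
have y0 j : 0 < y j by rewrite /y ltr0n expn_gt0.
have y1 j : 1 <= y j by rewrite /y ler1n expn_gt0.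
pose b j := (y j `^ (1 - p^-1))^-1 * a j.
have b0 j : 0 < b j by rewrite mulr_gt0 ?invr_gt0 ?powR_gt0.
pose u j : C -> C := fun z => (b j)%:C * horner (cfejer j) z.
have hu j : holomorphic (u j) by apply: holomorphicZ; exact: holomorphic_horner.
have nu j : hardy_norm p (u j) = 1%E.
  rewrite hardy_normZ; [|exact: p0|exact: b0|exact: holomorphic_horner].
  by rewrite /b EFinM -muleA norm_block -EFinM mulVf ?gt_eqF ?powR_gt0.
have Hu j : hardy p (u j) by split; [exact: hu|rewrite nu ltey].
pose kap := al * al / 1024.
have kap0 : 0 < kap by rewrite divr_gt0 ?mulr_gt0 ?ltr0n.
have h01 j : 0 < (4 * y j)^-1 <= 1.
  by have := y1 j => yk; apply/andP; split; rewrite ?invr_gt0 ?invf_le1; lra.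
have del0 : 0 < kap `^ p / 4 by rewrite divr_gt0 ?powR_gt0.
apply: (not_compact_radial p1 HT Hu nu h01 block_scale_cvg0 del0) => j.
have mT := measurable_radial_normc (HT _ (Hu j)).
have lo s : 1 - (4 * y j)^-1 <= s < 1 -> kap * y j `^ p^-1 <= normc (T_ (block_series a) (u j) s%:C).
  move=> hs; apply: le_trans (T_block_lower a0 aA (ltW (b0 _)) hs).
  rewrite -/(y _) /b /kap.
  have -> : y j `^ p^-1 = (y j `^ (1 - p^-1))^-1 * y j.
    rewrite -powRN -[X in _ * X]powRr1 ?(ltW (y0 _))// -powRD; first by congr (_ `^ _); ring.
    by rewrite (gt_eqF (y0 _)) implybT.
  have q0 : 0 < (y j `^ (1 - p^-1))^-1 by rewrite invr_gt0 powR_gt0.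
  move: (y j) (y0 j) (_^-1) q0 (a j) (a_ge j) => Y Y0 q q0 v lv.
  have -> : al * al / 1024 * (q * Y) = (al * al) * (q * Y / 1024) by ring.
  have -> : q * v * v * Y / 1024 = (v * v) * (q * Y / 1024) by ring.
  apply: ler_wpM2r; first by rewrite divr_ge0 ?ler0n ?mulr_ge0 ?(ltW q0) ?(ltW Y0).
  by apply: ler_pM; rewrite ?(ltW al0).
have k0 : 0 <= kap * y j `^ p^-1 by rewrite mulr_ge0 ?powR_ge0 ?ltW.
apply: le_trans (radial_measure_lower (h01 j) k0 (ltW p0) mT (fun s _ => normc_ge0 _) lo).
rewrite lee_fin powRM ?powR_ge0 ?(ltW kap0)// -powRrM mulVf ?gt_eqF// powRr1 ?(ltW (y0 _))//.
have -> : kap `^ p * y j * (4 * y j)^-1 = kap `^ p / 4.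
  by move: (kap `^ p) (y j) (y0 j) => K Y Y0; field; rewrite gt_eqF.
exact: lexx.
Qed.

End noncompactness.

(** * Size of the spectrum *)

Section spectrum_size.
Context {R : realType}.
Local Notation C := (R[i]^o).

Lemma dyadic_unbounded (M : R) : exists j, M <= (2 ^ j)%:R.
Proof.
exists (Num.Def.truncn M).+1; apply: (le_trans (ltW (truncnS_gt _))).
by rewrite ler_nat; exact: ltnW (ltn_expl _ (ltnSn 1)).
Qed.

Lemma nneseries1 : (\sum_(0 <= j <oo) (1 : \bar R) = +oo)%E.
Proof.
apply: eq_infty => r; pose n := (Num.Def.truncn r).+1.
apply: (@le_trans _ _ (\sum_(0 <= j < n) (1 : \bar R))%E); last first.
  by apply: nneseries_lim_ge => j _ _; exact: lee01.
have -> : (\sum_(0 <= j < n) (1 : \bar R) = n%:R%:E)%E.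
  elim: n => [|m ih]; first by rewrite big_nil.
  by rewrite big_nat_recr //= ih -EFinD natr1.
by rewrite lee_fin; exact: ltW (truncnS_gt _).
Qed.

(** The test polynomials are the [cfejer j]: the exponent [1 - 1/p] of their norm
    in [H^p] exceeds the exponent [1/2] of their norm in [H^2]. *)
Lemma not_Lambda_of_cfejer (p : R) (E : set nat) : 2 < p ->
  (forall j n, (@cfejer R j)`_n != 0 -> E n) -> ~ analytic_Lambda p E.
Proof.
move=> p2 HE [K HK]; have p1 : 1 < p by lra.
have p0 : 0 < p by lra.
have [c1 c10 H1] := @hardy_norm_cfejer_ge R p p1.
have [c2 c20 H2] := @hardy_norm_cfejer_le R 2 (ltr1n _ 2).
pose th := 2^-1 - p^-1.
have th0 : 0 < th by rewrite subr_gt0 ltf_pV2 ?posrE.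
pose M := `|K| * c2 / c1 + 1.
have M0 : 0 <= `|K| * c2 / c1 by rewrite divr_ge0 ?mulr_ge0 ?(ltW c10).
have [j Mj] := dyadic_unbounded (M `^ th^-1).
have y0 : 0 < (2 ^ j)%:R :> R by rewrite ltr0n expn_gt0.
have big : M <= (2 ^ j)%:R `^ th.
  have -> : M = (M `^ th^-1) `^ th.
    by rewrite -powRrM mulVf ?gt_eqF// powRr1// /M addr_ge0.
  by rewrite ge0_ler_powR ?nnegrE ?powR_ge0 ?(ltW y0) ?(ltW th0).
have : ((c1 * (2 ^ j)%:R `^ (1 - p^-1))%:E <= (`|K| * (c2 * (2 ^ j)%:R `^ 2^-1))%:E)%E.
  apply: le_trans (H1 j) _; apply: le_trans (HK _ (HE j)) _.
  have E2 : 1 - 2^-1 = 2^-1 :> R by lra.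
  have h2 := H2 j; rewrite E2 in h2.
  apply: (@le_trans _ _ (`|K|%:E * hardy_norm 2 (horner (@cfejer R j) : C -> C))%E).
    by rewrite lee_wpmul2r ?hardy_norm_ge0 ?lee_fin ?ler_norm.
  by rewrite [leRHS]EFinM lee_wpmul2l ?lee_fin.
rewrite lee_fin.
have -> : (2 ^ j)%:R `^ (1 - p^-1) = (2 ^ j)%:R `^ th * (2 ^ j)%:R `^ 2^-1 :> R.
  rewrite -powRD; first by congr (_ `^ _); rewrite /th; lra.
  by rewrite (gt_eqF y0) implybT.
have v0 : 0 < (2 ^ j)%:R `^ 2^-1 :> R by exact: powR_gt0.
rewrite !mulrA ler_pM2r//.
apply/negP; rewrite -ltNge; apply: lt_le_trans (ler_wpM2l (ltW c10) big).
rewrite /M mulrDr mulr1 mulrCA mulfV ?gt_eqF// mulr1.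
by rewrite ltrDl.
Qed.

(** If [n] and [n + 1] are in the spectrum then [q n <= n + 1], so [n] is at most
    [1 / (q - 1)]. *)
Lemma not_lacunary_of_consecutive (f : C -> C) :
  (forall M : R, exists2 n, M <= n%:R & spectrum f n /\ spectrum f n.+1) ->
  ~ hadamard_lacunary f.
Proof.
move=> H [k [kinc sk [q [q1 hq]]]].
have q10 : 0 < q - 1 by rewrite subr_gt0.
have [n Mn] := H ((q - 1)^-1 + 1); rewrite sk => -[[i _ ki] [i' _ ki']].
have kle m m' : (m <= m')%N -> (k m <= k m')%N.
  by rewrite leq_eqVlt => /predU1P[->//|/kinc /ltnW].
have ii' : (i < i')%N.
  by rewrite ltnNge; apply/negP => /kle; rewrite ki ki' ltnn.
have h1 : ((k i.+1)%:R : R) <= n.+1%:R by rewrite ler_nat -ki'; exact: kle.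
have := le_trans (hq i) h1; rewrite ki -natr1.
have : 1 < (q - 1) * n%:R.
  rewrite mulrC -ltr_pdivrMr// mul1r; lra.
lra.
Qed.

End spectrum_size.

(** * The counterexample *)

Theorem theorem4p3 (R : realType) (p p' t : R) (hp : 2 < p)
    (hp' : p^-1 + p'^-1 = 1) (ht : t = 2 * p / (p - 2)) :
  exists (phi : R[i]^o -> R[i]^o) (j0 : nat),
    holomorphic phi
    /\ (hardy_bounded p (T_ phi) /\ ~ hardy_compact p (T_ phi))
    /\ (\forall j \near \oo, dyadic_block phi j <> 0
          /\ has_interval (spectrum phi) (2 ^ j) (2 ^ j.+1) (2 ^ (j.-1)))
    /\ ~ analytic_Lambda p (spectrum phi)
    /\ (forall j : nat, (j0 <= j)%N ->
          ((2 `^ (- (j%:R / p')))%:E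
             * hardy_norm p (horner (dyadic_block phi j)) = 1)%E)
    /\ ~ (\sum_(0 <= j <oo)
            ((2 `^ (- (j%:R / p')))%:E
               * hardy_norm p (horner (dyadic_block phi j))) `^ t < +oo)%E
    /\ ~ hadamard_lacunary phi
    /\ ~ (exists E : set nat, analytic_Lambda p E /\ spectrum phi `<=` E).
Proof.
have p1 : 1 < p by lra.
have p0 : 0 < p by lra.
have [c1 c10 H1] := @hardy_norm_cfejer_ge R p p1.
have [c2 c20 H2] := @hardy_norm_cfejer_le R p p1.
pose N j := fine (hardy_norm p (horner (@cfejer R j))).
pose w j : R := (2 ^ j)%:R `^ (1 - p^-1).
have w0 j : 0 < w j by rewrite powR_gt0 ?ltr0n ?expn_gt0.
have NE j : hardy_norm p (horner (@cfejer R j)) = (N j)%:E.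
  rewrite /N fineK// ge0_fin_numE ?hardy_norm_ge0//.
  exact: le_lt_trans (H2 j) (ltey _).
have N1 j : c1 * w j <= N j by rewrite -lee_fin -NE; exact: H1.
have N2 j : N j <= (c2 + 1) * w j.
  rewrite -lee_fin -NE; apply: le_trans (H2 j) _.
  by rewrite lee_fin ler_wpM2r ?(ltW (w0 j)) ?lerDl.
have N0 j : 0 < N j by apply: lt_le_trans (N1 j); rewrite mulr_gt0.
have c210 : 0 < c2 + 1 by rewrite ltr_wpDl.
pose a j := w j / N j.
have a_ge j : (c2 + 1)^-1 <= a j.
  by rewrite /a ler_pdivlMr// mulrC ler_pdivrMr// mulrC.
have a_le j : a j <= c1^-1.
  by rewrite /a ler_pdivrMr// mulrC ler_pdivlMr// mulrC.
have al0 : 0 < (c2 + 1)^-1 by rewrite invr_gt0.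
have a0 j : 0 < a j by exact: lt_le_trans (a_ge j).
have aN j : ((a j)%:E * hardy_norm p (horner (@cfejer R j)) = (w j)%:E)%E.
  by rewrite NE -EFinM /a divfK ?gt_eqF.
have weight j : 2 `^ (- (j%:R / p')) = (w j)^-1.
  have -> : p'^-1 = 1 - p^-1 by lra.
  by rewrite powRN powRrM powR_mulrn// -natrX.
pose phi : R[i]^o -> R[i]^o := block_series a.
have holT f : hardy p f -> holomorphic (T_ phi f).
  exact: (T_holomorphic p1 (tame_block_coef a0 a_le)).
have norm1 j : ((2 `^ (- (j%:R / p')))%:E
    * hardy_norm p (horner (dyadic_block phi j)) = 1)%E.
  rewrite (dyadic_block_series a0 a_le).
  have -> : horner (((a j)%:C)%C *: cfejer j) = (fun z : R[i]^o => ((a j)%:C)%C * horner (cfejer j) z).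
    by apply/funext => z; rewrite hornerZ.
  rewrite (hardy_normZ p0 (a0 j) (@holomorphic_horner R _)) aN weight -EFinM.
  by rewrite mulVf ?gt_eqF.
exists phi, 0%N.
split; first exact: block_series_holomorphic a0 a_le.
split.
  split; last exact: (T_block_not_compact p1 al0 a_ge a_le holT aN).
  exact: (T_bounded p1 (block_series_holomorphic a0 a_le) (normc_block_series_le a0 a_le) holT).
split.
  exists 0%N => // j _; split.
    move=> e; have := norm1 j; rewrite e.
    have -> : horner (0 : {poly R[i]}) = (fun z : R[i]^o => ((0 : R)%:C)%C * horner (@cfejer R j) z).
      by apply/funext => z; rewrite horner0 mul0r.
    move=> h; have := hardy_normZ_le p0 (lexx (0:R)) (@holomorphic_horner R (cfejer j)).
    rewrite mul0e => h'.
    have h0 : hardy_norm p (fun z : R[i]^o => ((0 : R)%:C)%C * horner (@cfejer R j) z) = 0%E.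
      by apply/eqP; rewrite eq_le h' hardy_norm_ge0.
    by move: h; rewrite h0 mule0 => /eqP; rewrite eq_sym onee_eq0.
  exists (2 ^ j)%N; split => //.
    rewrite expnS mul2n -addnn leq_add2l; exact: half_block_le.
  by move=> n; exact: (spectrum_interval a0 a_le).
have cs := cfejer_spectrum a0 a_le.
split; first exact: (not_Lambda_of_cfejer hp cs).
split; first by move=> j _; exact: norm1.
split.
  apply/negP; rewrite -leNgt.
  under eq_eseriesr do rewrite norm1 poweR_EFin powR1.
  by rewrite nneseries1.
split.
  apply: not_lacunary_of_consecutive => M; have [j Mj] := dyadic_unbounded M.
  (* the index j.+2 leaves at least two frequencies in half a block *)
  exists (2 ^ j.+2)%N.
    by rewrite (le_trans Mj)// ler_nat leq_pexp2l// ltnW.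
  have h : (2 ^ j.+2 + 2 <= 2 ^ j.+2 + half_block j.+2)%N.
    by rewrite leq_add2l /half_block /= expnS leq_pmulr// expn_gt0.
  split; apply: (spectrum_interval a0 a_le (j := j.+2)).
    by rewrite leqnn /= (leq_trans _ h)// addn2.
  by rewrite leqnSn /= (leq_trans _ h)// addn2.
by move=> [E [LE sE]]; apply: (not_Lambda_of_cfejer hp _ LE) => j n /cs /sE.
Qed.
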